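(* Let $\Omega\subset\mathbb R^n$ be a bounded smooth domain and let $0<\lambda_1<\lambda_2\le\lambda_3\le\cdots$ be the eigenvalues of $-\Delta$ in $\Omega$ with zero Dirichlet boundary condition, ordered and repeated according to multiplicity. Let $(b_i)_{i\ge1}$ be an orthonormal basis of $L^2(\Omega)$ such that, for all $m\ge1$, $$\Big\|f-\sum_{i=1}^m(f,b_i)b_i\Big\|_{L^2}^2\le\frac{\|\nabla f\|_{L^2}^2}{\lambda_{m+1}}\qquad\forall f\in H_0^1(\Omega).$$ Then $(b_i)$ consists of an orthonormal basis of eigenfunctions of $-\Delta$ (with Dirichlet boundary condition) with corresponding eigenvalues $(\lambda_i)$; that is, for every $i\ge1$, $b_i\in H_0^1(\Omega)$ and $-\Delta b_i=\lambda_ib_i$ in $\Omega$.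
   Context: $(\cdot,\cdot)$ is the scalar product of $L^2(\Omega)$. *)

(* Defs.v *)
From HB Require Import structures.
From mathcomp Require Import all_boot all_order all_algebra.
From mathcomp Require Import all_classical all_reals all_analysis.

Set Implicit Arguments.
Unset Strict Implicit.
Unset Printing Implicit Defensive.

Import Order.TTheory GRing.Theory Num.Theory.
Import numFieldNormedType.Exports.

Local Open Scope classical_set_scope.
Local Open Scope ring_scope.

(* 'rV[T]_n carries the product sigma-algebra generated by the coordinates;
   for T = R this is the Borel sigma-algebra of R^n. *)
Definition measure_rV_display : measure_display -> measure_display.
Proof. exact. Qed.

Section measurable_rV.
Context {d} {T : sigmaRingType d}.
Variable n : nat.

Let coors : 'I_n -> 'rV[T]_n -> T := fun i x => x ord0 i.

Let rV_set0 : g_sigma_preimage coors set0.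
Proof. exact: sigma_algebra0. Qed.

Let rV_setC A : g_sigma_preimage coors A -> g_sigma_preimage coors (~` A).
Proof. exact: sigma_algebraC. Qed.

Let rV_bigcup (F : _^nat) : (forall i, g_sigma_preimage coors (F i)) ->
  g_sigma_preimage coors (\bigcup_i (F i)).
Proof. exact: sigma_algebra_bigcup. Qed.

HB.instance Definition _ := @isMeasurable.Build (measure_rV_display d)
  'rV[T]_n (g_sigma_preimage coors) rV_set0 rV_setC rV_bigcup.

End measurable_rV.

Lemma measurable_coord_rV d (T : sigmaRingType d) n (i : 'I_n) :
  measurable_fun [set: 'rV[T]_n] (fun x : 'rV[T]_n => x ord0 i).
Proof.
move=> _ Y mY; rewrite setTI; apply: sub_sigma_algebra => /=.
rewrite -bigcup_seq/=; exists i => /=; first by rewrite mem_index_enum.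
by exists Y => //; rewrite setTI.
Qed.

Lemma measurable_fun_rVP d1 d2 (T1 : measurableType d1)
    (T2 : measurableType d2) n (f : T1 -> 'rV[T2]_n) :
  measurable_fun [set: T1] f <->
  forall i, measurable_fun [set: T1] (fun x => f x ord0 i).
Proof.
split=> [mf i|mf].
  exact: (measurableT_comp (measurable_coord_rV (T:=T2) i) mf).
apply: (measurability (\big[setU/set0]_(i < n) preimage_set_system setT
  (fun v : 'rV[T2]_n => v ord0 i) measurable)) => // _ [B + <-].
rewrite -bigcup_seq/= => -[i _ [Y mY <-]].
by rewrite !setTI; have := mf i measurableT _ mY; rewrite setTI.
Qed.

Section lebesgue_rV.
Context {R : realType}.

Definition cons_rV n (z : R * 'rV[R]_n) : 'rV[R]_n.+1 :=
  \row_i (if unlift ord0 i is Some j then z.2 ord0 j else z.1).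

Definition uncons_rV n (x : 'rV[R]_n.+1) : R * 'rV[R]_n :=
  (x ord0 ord0, \row_j x ord0 (lift ord0 j)).

Lemma cons_rVK n : cancel (@cons_rV n) (@uncons_rV n).
Proof.
move=> [x v]; rewrite /uncons_rV mxE unlift_none; congr (_, _).
by apply/rowP => j; rewrite !mxE liftK.
Qed.

Lemma uncons_rVK n : cancel (@uncons_rV n) (@cons_rV n).
Proof.
by move=> x; apply/rowP => i; rewrite mxE; case: unliftP => [j|] ->; rewrite ?mxE.
Qed.

Lemma measurable_cons_rV n : measurable_fun setT
  (@cons_rV n : (measurableTypeR R * 'rV[R]_n)%type -> 'rV[R]_n.+1).
Proof.
apply/measurable_fun_rVP => i.
case: (unliftP ord0 i) => [j|] ->.
  rewrite (_ : (fun _ => _) = (fun v : 'rV[R]_n => v ord0 j) \o snd).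
    exact: (measurableT_comp (measurable_coord_rV (T:=R) j) measurable_snd).
  by apply/funext => z /=; rewrite mxE liftK.
rewrite (_ : (fun _ => _) = fst); first exact: measurable_fst.
by apply/funext => z /=; rewrite mxE unlift_none.
Qed.

Lemma measurable_uncons_rV n : measurable_fun setT
  (@uncons_rV n : 'rV[R]_n.+1 -> (measurableTypeR R * 'rV[R]_n)%type).
Proof.
apply/measurable_fun_pairP; split; first exact: measurable_coord_rV.
apply/measurable_fun_rVP => j.
rewrite (_ : (fun _ => _) = (fun x : 'rV[R]_n.+1 => x ord0 (lift ord0 j))).
  exact: measurable_coord_rV.
by apply/funext => x /=; rewrite mxE.
Qed.

Section step.
Variables (n : nat) (mu : {sigma_finite_measure set 'rV[R]_n -> \bar R}).

Definition lebesgue_rV_step : set 'rV[R]_n.+1 -> \bar R :=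
  pushforward (lebesgue_measure \x mu)%E (@cons_rV n).

Let step0 : lebesgue_rV_step set0 = 0%E.
Proof. by rewrite /lebesgue_rV_step /pushforward preimage_set0 measure0. Qed.

Let step_ge0 A : (0 <= lebesgue_rV_step A)%E.
Proof. by rewrite /lebesgue_rV_step /pushforward. Qed.

Let step_additive : semi_sigma_additive lebesgue_rV_step.
Proof.
have mh A : measurable A -> measurable (@cons_rV n @^-1` A).
  by move=> mA; rewrite -[X in measurable X]setTI; exact: measurable_cons_rV.
move=> F mF tF mUF; rewrite /lebesgue_rV_step /pushforward preimage_bigcup.
apply: measure_semi_sigma_additive.
- by move=> k; exact: mh.
- apply/trivIsetP => /= i j _ _ ij; rewrite -preimage_setI.
  by move/trivIsetP : tF => /(_ _ _ _ _ ij) ->//; rewrite preimage_set0.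
- by rewrite -preimage_bigcup; exact: mh.
Qed.

HB.instance Definition _ := isMeasure.Build _ _ _
  lebesgue_rV_step step0 step_ge0 step_additive.

Let step_sigma_finite : sigma_finite setT lebesgue_rV_step.
Proof.
have /sigma_finiteP[F [TF ndF Foo]] := sigma_finiteT (@lebesgue_measure R).
have /sigma_finiteP[G [TG ndG Goo]] := sigma_finiteT mu.
have mX k : measurable (F k `*` G k).
  by apply: measurableX; [have [] := Foo k|have [] := Goo k].
exists (fun k => @uncons_rV n @^-1` (F k `*` G k)).
  rewrite -preimage_bigcup -(preimage_setT (@uncons_rV n)); congr (_ @^-1` _).
  apply/esym/seteqP; split=> // -[x y] _.
  have : (\bigcup_i F i) x by rewrite -TF.
  have : (\bigcup_i G i) y by rewrite -TG.
  move=> [k _ Gky] [l _ Flx]; exists (maxn k l) => //; split.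
  - by have /subsetPset := ndF _ _ (leq_maxr k l); exact.
  - by have /subsetPset := ndG _ _ (leq_maxl k l); exact.
move=> k; split.
  by rewrite -[X in measurable X]setTI; exact: measurable_uncons_rV.
rewrite /lebesgue_rV_step /pushforward -comp_preimage.
rewrite (_ : _ \o _ = id); last by apply/funext => z /=; rewrite cons_rVK.
have [mF Fk] := Foo k; have [mG Gk] := Goo k.
by rewrite preimage_id product_measure1E// lte_mul_pinfty// ge0_fin_numE.
Qed.

HB.instance Definition _ := @Measure_isSigmaFinite.Build _ _ _
  lebesgue_rV_step step_sigma_finite.

End step.

(* n-dimensional Lebesgue measure, as the n-fold product of the
   one-dimensional one. *)
Fixpoint lebesgue_rV n : {sigma_finite_measure set 'rV[R]_n -> \bar R} :=
  match n with
  | 0 => [the {sigma_finite_measure set 'rV[R]_0 -> \bar R} of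
           dirac (0 : 'rV[R]_0)]
  | n'.+1 => [the {sigma_finite_measure set 'rV[R]_n'.+1 -> \bar R} of
              lebesgue_rV_step (lebesgue_rV n')]
  end.

Lemma lebesgue_rV_box n (A : 'I_n -> set R) : (forall i, measurable (A i)) ->
  lebesgue_rV n [set x | forall i, A i (x ord0 i)] =
  (\prod_(i < n) lebesgue_measure (A i))%E.
Proof.
elim: n => [|n IH] in A *; move=> mA.
  by rewrite big_ord0 /= diracE mem_set// => -[].
set B := [set v : 'rV[R]_n | forall j, A (lift ord0 j) (v ord0 j)].
have mB : measurable B.
  rewrite (_ : B =
    \bigcap_(j in [set: 'I_n]) ((fun v : 'rV[R]_n => v ord0 j) @^-1` A (lift ord0 j))).
    apply: fin_bigcap_measurable => // j _.
    rewrite -[X in measurable X]setTI.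
    exact: (measurable_coord_rV (T:=R)).
  by apply/seteqP; split=> v /= h j; [move=> _|]; exact: h.
rewrite big_ord_recl -(IH (fun j => A (lift ord0 j)))// -/B.
rewrite -(product_measure1E (@lebesgue_measure R) (lebesgue_rV n) (mA ord0) mB).
change ((lebesgue_measure \x lebesgue_rV n)%E (@cons_rV n @^-1`
    [set x | forall i, A i (x ord0 i)]) = (lebesgue_measure \x lebesgue_rV n)%E (A ord0 `*` B)).
congr (_ _).
apply/seteqP; split=> -[x v] /=.
  move=> h; split; first by have := h ord0; rewrite mxE unlift_none.
  by move=> j; have := h (lift ord0 j); rewrite mxE liftK.
by move=> [hx hv] i; rewrite mxE; case: unliftP => [j|] ->.
Qed.

End lebesgue_rV.

Section smooth_functions.
Context {R : realType} {n : nat}.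
Implicit Types (f phi : 'rV[R]_n -> R) (Omega : set 'rV[R]_n).

Definition pderiv (i : 'I_n) f : 'rV[R]_n -> R :=
  fun x => 'D_(delta_mx ord0 i) f x.

Definition pderivs (s : seq 'I_n) f : 'rV[R]_n -> R := foldr pderiv f s.

Definition smooth f := forall s : seq 'I_n, continuous (pderivs s f) /\
  forall (i : 'I_n) x, derivable (pderivs s f) x (delta_mx ord0 i).

Definition laplacian f : 'rV[R]_n -> R :=
  fun x => \sum_(i < n) pderiv i (pderiv i f) x.

(* Near each boundary point, Omega is the sublevel set {rho < 0} of a smooth
   function rho with nonvanishing gradient at that point. *)
Definition smooth_boundary Omega := forall p, (closure Omega `\` Omega) p ->
  exists rho : 'rV[R]_n -> R, [/\ smooth rho,
    exists i, pderiv i rho p != 0 &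
    \forall x \near p, Omega x <-> rho x < 0].

Definition bounded_smooth_domain Omega :=
  [/\ open Omega, connected Omega, Omega !=set0, bounded_set Omega &
      smooth_boundary Omega].

(* C_c^oo(Omega) *)
Definition test_function Omega phi := smooth phi /\
  exists K, [/\ compact K, K `<=` Omega & forall x, ~ K x -> phi x = 0].

End smooth_functions.

Section sobolev.
Context {R : realType} {n : nat}.
Variable Omega : set 'rV[R]_n.
Implicit Types (f g u phi : 'rV[R]_n -> R) (b : nat -> 'rV[R]_n -> R).

Local Notation leb := (@lebesgue_rV R n).

(* L^2 classes are handled through representatives; equality in L^2 is
   equality almost everywhere on Omega. *)
Definition in_L2 f := measurable_fun Omega f /\
  (\int[leb]_(x in Omega) ((f x) ^+ 2)%:E < +oo)%E.

Definition dotL2 f g : R := \int[leb]_(x in Omega) (f x * g x).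

Definition sqnormL2 f : R := dotL2 f f.

Definition partial_sumL2 b f (m : nat) : 'rV[R]_n -> R :=
  fun x => \sum_(i < m) dotL2 f (b i) * b i x.

Definition orthonormal_basisL2 b := [/\ forall i, in_L2 (b i),
  forall i j, dotL2 (b i) (b j) = (i == j)%:R &
  forall f, in_L2 f ->
    (fun m => sqnormL2 (f \- partial_sumL2 b f m)) @ \oo --> (0 : R)].

Definition weak_gradient u (du : 'I_n -> 'rV[R]_n -> R) :=
  forall i phi, test_function Omega phi ->
    dotL2 u (pderiv i phi) = - dotL2 (du i) phi.

Definition in_H1 u (du : 'I_n -> 'rV[R]_n -> R) :=
  [/\ in_L2 u, forall i, in_L2 (du i) & weak_gradient u du].

(* u is in H^1_0(Omega), the closure of C_c^oo(Omega) in H^1(Omega), and du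
   represents its gradient. *)
Definition H10_gradient u (du : 'I_n -> 'rV[R]_n -> R) := in_H1 u du /\
  exists phi : nat -> 'rV[R]_n -> R,
    [/\ forall k, test_function Omega (phi k),
       (fun k => sqnormL2 (phi k \- u)) @ \oo --> (0 : R) &
       forall i, (fun k => sqnormL2 (pderiv i (phi k) \- du i)) @ \oo
                 --> (0 : R)].

Definition in_H10 u := exists du, H10_gradient u du.

Definition sqnorm_gradient (du : 'I_n -> 'rV[R]_n -> R) : R :=
  \sum_(i < n) sqnormL2 (du i).

(* u in H^1_0(Omega) and - Delta u = mu u in Omega, in the sense of
   distributions. *)
Definition dirichlet_eigen (mu : R) u := in_H10 u /\
  forall phi, test_function Omega phi ->
    - dotL2 u (laplacian phi) = mu * dotL2 u phi.

Definition free_L2 (k : nat) (u : 'I_k -> 'rV[R]_n -> R) :=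
  forall c : 'I_k -> R,
    {ae leb, forall x, Omega x -> \sum_(j < k) c j * u j x = 0} ->
    forall j, c j = 0.

(* lam lists the Dirichlet eigenvalues in nondecreasing order, each repeated
   according to the dimension of its eigenspace: mu occurs at least k times in
   lam iff its eigenspace contains k linearly independent functions. *)
Definition dirichlet_spectrum (lam : nat -> R) :=
  {homo lam : i j / (i <= j)%N >-> i <= j} /\
  forall (mu : R) (k : nat),
    (exists s : 'I_k -> nat, injective s /\ forall j, lam (s j) = mu) <->
    (exists u : 'I_k -> 'rV[R]_n -> R,
       (forall j, dirichlet_eigen mu (u j)) /\ free_L2 u).

End sobolev.

(* Main.v *)
(* For m >= 1 let lam_m = ... = lam_k be the part of an eigenvalue block starting
   at m.  Some nonzero f in span(e_0, ..., e_{m-1}, e_k) is orthogonal to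
   b_0, ..., b_{m-1}, and |f|^2 <= |grad f|^2 / lam_m <= |f|^2 forces f to be
   proportional to e_k.  Hence e_k is orthogonal to b_i as soon as
   lam_i < lam_k.  As the eigenfunctions are complete, b_i is a combination of
   the e_k with lam_k <= lam_i, and comparing dimensions excludes lam_k < lam_i.

   Completeness of the eigenfunctions is obtained by minimizing the Rayleigh
   quotient.  The compactness needed there comes from a Poincare inequality on
   small cubes: |f|^2 <= e |grad f|^2 + C sum_q (int_q f)^2 on H^1_0, with
   finitely many cubes q for each e > 0. *)
Require Import Defs.
From HB Require Import structures.
From mathcomp Require Import all_boot all_order all_algebra.
From mathcomp Require Import all_classical all_reals all_analysis.
From mathcomp Require Import measurable_realfun.
From mathcomp Require Import ring lra zify.

Set Implicit Arguments.
Unset Strict Implicit.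
Unset Printing Implicit Defensive.

Import Order.TTheory GRing.Theory Num.Theory.
Import numFieldNormedType.Exports.

Local Open Scope classical_set_scope.
Local Open Scope ring_scope.

(** * Rigidity of optimal bases for a quadratic form *)

(** Functions are kept as representatives, and an element of H^1_0 is a function together with a
    chosen gradient, so the forms at hand are only semidefinite. The abstract part is therefore
    written for semidefinite forms on two modules V and W linked by a linear map [j], without
    quotients: equality in L^2 becomes vanishing of the norm of a difference, and Cauchy-Schwarz
    allows such a difference to be dropped from any product.

    The spectrum is given through multiplicities alone, with nothing postulated about completeness
    or growth. Both come from counting: K + 1 orthonormal eigenvectors with bounded eigenvalues
    cannot be controlled by K functionals, so [lam] is unbounded; and an eigenvector found by
    minimization below [lam m], orthogonal to those already listed, would exceed a prescribed
    multiplicity.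

    Optimality is available for m >= 1 only. This is enough because it is applied at the start of an
    eigenvalue block that has a strictly smaller eigenvalue before it, and such a block starts at a
    positive index. *)

Record psd_form (R : realType) (V : lmodType R) (B : V -> V -> R) : Prop := PsdForm {
  psd_linear : forall c x y z, B (c *: x + y) z = c * B x z + B y z;
  psd_sym : forall x y, B x y = B y x;
  psd_ge0 : forall x, 0 <= B x x }.

Section psd_theory.
Context {R : realType} {V : lmodType R} {B : V -> V -> R}.
Hypothesis pB : psd_form B.
Implicit Types x y z : V.

Lemma psdDl x y z : B (x + y) z = B x z + B y z.
Proof. by have := psd_linear pB 1 x y z; rewrite scale1r mul1r. Qed.

Lemma psd0l z : B 0 z = 0.
Proof. by have := psdDl 0 0 z; rewrite addr0; lra. Qed.

Lemma psdZl c x z : B (c *: x) z = c * B x z.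
Proof. by have := psd_linear pB c x 0 z; rewrite addr0 psd0l addr0. Qed.

Lemma psdNl x z : B (- x) z = - B x z.
Proof. by rewrite -scaleN1r psdZl mulN1r. Qed.

Lemma psdBl x y z : B (x - y) z = B x z - B y z.
Proof. by rewrite psdDl psdNl. Qed.

Lemma psd_suml (I : Type) (r : seq I) (P : pred I) (F : I -> V) z :
  B (\sum_(i <- r | P i) F i) z = \sum_(i <- r | P i) B (F i) z.
Proof. by elim/big_rec2: _ => [|i u v _ <-]; rewrite ?psd0l// psdDl. Qed.

Lemma psdDr x y z : B z (x + y) = B z x + B z y.
Proof. by rewrite psd_sym// psdDl !(psd_sym pB z). Qed.

Lemma psd0r z : B z 0 = 0.
Proof. by rewrite psd_sym// psd0l. Qed.

Lemma psdZr c x z : B z (c *: x) = c * B z x.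
Proof. by rewrite psd_sym// psdZl !(psd_sym pB z). Qed.

Lemma psdNr x z : B z (- x) = - B z x.
Proof. by rewrite psd_sym// psdNl !(psd_sym pB z). Qed.

Lemma psdBr x y z : B z (x - y) = B z x - B z y.
Proof. by rewrite psdDr psdNr. Qed.

Lemma psd_sumr (I : Type) (r : seq I) (P : pred I) (F : I -> V) z :
  B z (\sum_(i <- r | P i) F i) = \sum_(i <- r | P i) B z (F i).
Proof. by elim/big_rec2: _ => [|i u v _ <-]; rewrite ?psd0r// psdDr. Qed.

Lemma psdBB x y : B (x - y) (x - y) = B x x - B x y *+ 2 + B y y.
Proof. by rewrite psdBl !psdBr (psd_sym pB y x); ring. Qed.

Lemma psdDD x y : B (x + y) (x + y) = B x x + B x y *+ 2 + B y y.
Proof. by rewrite psdDl !psdDr (psd_sym pB y x); ring. Qed.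

Lemma psdBC x y : B (x - y) (x - y) = B (y - x) (y - x).
Proof. by rewrite !psdBB (psd_sym pB x y); ring. Qed.

Lemma psd_parallelogram x y :
  B (x - y) (x - y) = B x x *+ 2 + B y y *+ 2 - B (x + y) (x + y).
Proof. by rewrite psdBB psdDD; ring. Qed.

Lemma psd_cauchy_schwarz x y : B x y ^+ 2 <= B x x * B y y.
Proof.
have h t : 0 <= B x x - t * B x y *+ 2 + t ^+ 2 * B y y.
  have := psd_ge0 pB (x - t *: y).
  by rewrite psdBB psdZl !psdZr expr2 -mulrA.
have [yy0|yy0] := eqVneq (B y y) 0.
  have := psd_ge0 pB x; have [->|xy0 xx0] := eqVneq (B x y) 0.
    by rewrite expr0n /= yy0 mulr0.
  (* For degenerate [y] the quadratic in t is affine; at this t it equals - B x x - 2, which is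
     negative. *)
  have := h ((B x x + 1) / B x y); rewrite yy0 divfK//; lra.
have yyp : 0 < B y y by rewrite lt0r yy0 psd_ge0.
have /(mulr_ge0 (ltW yyp)) := h (B x y / B y y).
rewrite -[_ <= B x x * _]subr_ge0; congr (_ <= _).
by field.
Qed.

Lemma psd_eq0l x y : B x x = 0 -> B x y = 0.
Proof.
move=> x0; apply/eqP; rewrite -sqrf_eq0 eq_le sqr_ge0 andbT.
by have := psd_cauchy_schwarz x y; rewrite x0 mul0r.
Qed.

Lemma psd_eq0r x y : B y y = 0 -> B x y = 0.
Proof. by move=> y0; rewrite psd_sym// psd_eq0l. Qed.

Lemma psdDD_le x y : B (x + y) (x + y) <= B x x *+ 2 + B y y *+ 2.
Proof. by have := psd_parallelogram x y; have := psd_ge0 pB (x - y); lra. Qed.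

Lemma psdBB_le x y z :
  B (x - z) (x - z) <= B (x - y) (x - y) *+ 2 + B (y - z) (y - z) *+ 2.
Proof. by have := psdDD_le (x - y) (y - z); rewrite addrA subrK. Qed.

Lemma psd_cvg (u : nat -> V) z y :
  (fun k => B (u k - z) (u k - z)) @ \oo --> (0 : R) ->
  (fun k => B (u k) y) @ \oo --> B z y.
Proof.
move=> uz; apply/cvgrPdist_lt => e e0.
(* The added 1 keeps the divisor positive when [y] has zero norm. *)
have d0 : 0 < e ^+ 2 / (B y y + 1).
  by rewrite divr_gt0 ?exprn_gt0// ltr_wpDl// psd_ge0.
move/cvgrPdist_lt : uz => /(_ _ d0); apply: filterS => k /=.
rewrite sub0r normrN ger0_norm ?psd_ge0// => kd.
rewrite distrC -psdBl -(@ltr_pXn2r _ 2)// ?nnegrE ?ltW// -normrX.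
rewrite ger0_norm ?sqr_ge0//.
have yp : 0 < B y y + 1 by rewrite ltr_wpDl// psd_ge0.
apply: le_lt_trans (psd_cauchy_schwarz _ _) _.
move: kd; rewrite ltr_pdivlMr// mulrDr mulr1 => kd.
by have := psd_ge0 pB (u k - z); lra.
Qed.

Lemma psd_cvg_diag (u : nat -> V) z :
  (fun k => B (u k - z) (u k - z)) @ \oo --> (0 : R) ->
  (fun k => B (u k) (u k)) @ \oo --> B z z.
Proof.
move=> uz; rewrite (_ : (fun _ => _) =
  (fun k => B (u k - z) (u k - z) + B (u k) z *+ 2 - B z z)); last first.
  by apply/funext => k; rewrite psdBB; ring.
rewrite [X in _ --> X](_ : _ = 0 + (B z z) *+ 2 - B z z); last by ring.
have uzz := psd_cvg (y := z) uz.
apply: cvgB; last exact: cvg_cst.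
by apply: cvgD => //; apply: cvgMn.
Qed.

End psd_theory.

Lemma psd_form_comp (R : realType) (V W : lmodType R) (B : W -> W -> R)
  (f : {linear V -> W}) : psd_form B -> psd_form (fun x y => B (f x) (f y)).
Proof.
move=> pB; split=> [c x y z|x y|x].
- by rewrite linearP (psd_linear pB).
- by rewrite (psd_sym pB).
- by rewrite (psd_ge0 pB).
Qed.

(** The rank of a (K+1) x K matrix is at most K, so its left kernel is nonzero. Every nonzero
    combination below that must satisfy finitely many orthogonality relations is obtained this
    way. *)
Lemma underdetermined_system (F : fieldType) K (A : 'I_K.+1 -> 'I_K -> F) :
  exists c : 'I_K.+1 -> F,
    (exists i, c i != 0) /\ forall k, \sum_i c i * A i k = 0.
Proof.
pose M := \matrix_(i, k) A i k.
have : kermx M != 0.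
  by rewrite kermx_eq0 /row_free neq_ltn (leq_ltn_trans (rank_leq_col _)).
case/rowV0Pn => v /sub_kermxP vM v0; exists (fun i => v 0 i); split.
  by apply/existsP; move: v0; apply: contra_neqT => /existsPn h; apply/rowP => i;
     rewrite mxE; apply/eqP; have := h i; rewrite negbK.
move=> k; have /rowP/(_ k) := vM; rewrite !mxE => vMk.
by rewrite -[RHS]vMk; apply: eq_bigr => i _; rewrite mxE.
Qed.

(** Any selection v r in A r stays in a compact cube, and a cluster point of it is approached from
    inside each A r because the sets are nested. This replaces the extraction of a convergent
    subsequence of functional values. *)
Lemma rV_bounded_cluster (R : realType) K (A : nat -> set 'rV[R]_K) (M : R) :
  (forall r, A r !=set0) -> (forall r s, (r <= s)%N -> A s `<=` A r) ->
  (forall v, A 0%N v -> forall i, `|v ord0 i| <= M) ->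
  exists p : 'rV[R]_K, forall r (e : R), 0 < e ->
    exists2 v, A r v & forall i, `|v ord0 i - p ord0 i| < e.
Proof.
move=> A0 Adec AM.
pose C := [set v : 'rV[R]_K | forall i, `[- M, M]%classic (v ord0 i)].
have cC : compact C.
  by apply: (@rV_compact R K (fun=> `[- M, M]%classic)) => i; exact: segment_compact.
have [v vA] : {v : nat -> 'rV[R]_K & forall r, A r (v r)}.
  by apply: (@choice _ _ (fun r v => A r v)).
have vC : (v @ \oo) C.
  exists 0%N => // k _ i /=; rewrite in_itv/= -ler_norml; apply: AM.
  exact: (Adec 0%N k (leq0n k) _ (vA k)).
have [p [_ pcl]] := cC _ _ vC.
exists p => r e e0.
have vAr : (v @ \oo) (A r).
  by exists r => // k /= rk; apply: (Adec r k).
have [w [Aw pw]] := pcl _ (ball p e) vAr (nbhsx_ballx p e e0).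
by exists w => // i; rewrite distrC; case: pw => _ /(_ ord0 i).
Qed.

(** * Eigenvectors of a form relative to a compact embedding *)

Section spectral.
Context {R : realType} {V W : lmodType R}.
Variables (dot : W -> W -> R) (j : {linear V -> W}) (a : V -> V -> R).
Hypotheses (pdot : psd_form dot) (pa : psd_form a).

Local Notation s x y := (dot (j x) (j y)).

Hypothesis complete : forall x : nat -> V,
  (forall e : R, 0 < e -> exists N, forall k l, (N <= k)%N -> (N <= l)%N ->
     s (x k - x l) (x k - x l) + a (x k - x l) (x k - x l) < e) ->
  exists z, (fun k => s (x k - z) (x k - z) + a (x k - z) (x k - z))
    @ \oo --> (0 : R).

Hypothesis rellich : forall e : R, 0 < e ->
  exists K (l : 'I_K -> W) (C : R), 0 <= C /\
    forall x, s x x <= e * a x x + C * \sum_k dot (j x) (l k) ^+ 2.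

Definition eigen mu x := forall y, a x y = mu * s x y.

Definition eproj m (e : nat -> V) x := \sum_(i < m) s x (e i) *: e i.

(** Only the first m entries of [e] are constrained, so that a finite list read through [nth 0]
    qualifies during the inductive construction. *)
Definition orthonormal_eigen (lam : nat -> R) m (e : nat -> V) :=
  (forall i, (i < m)%N -> eigen (lam i) (e i)) /\
  (forall i k, (i < m)%N -> (k < m)%N -> s (e i) (e k) = (i == k)%:R).

Let ps : psd_form (fun x y => s x y) := psd_form_comp j pdot.

Lemma eigen_lin mu (I : Type) (r : seq I) (P : pred I) (c : I -> R) (u : I -> V) :
  (forall i, P i -> eigen mu (u i)) -> eigen mu (\sum_(i <- r | P i) c i *: u i).
Proof.
move=> eu y; rewrite (psd_suml pa) (psd_suml ps) mulr_sumr.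
by apply: eq_bigr => i Pi; rewrite (psdZl pa) (psdZl ps) eu// mulrCA.
Qed.

Lemma eigen_orthogonal mu nu x y : eigen mu x -> eigen nu y -> mu != nu ->
  s x y = 0.
Proof.
move=> ex ey; have := ex y; rewrite (psd_sym pa) ey (psd_sym pdot) => /eqP.
by rewrite -subr_eq0 -mulrBl mulf_eq0 subr_eq0 => /orP[/eqP->|/eqP//]; rewrite eqxx.
Qed.

Section projection.
Context {lam : nat -> R} {m : nat} {e : nat -> V}.
Hypothesis oe : orthonormal_eigen lam m e.

Lemma dot_proj x i : (i < m)%N -> s (eproj m e x) (e i) = s x (e i).
Proof.
case: oe => _ one im; rewrite (psd_suml ps) (bigD1 (Ordinal im))//= big1 ?addr0.
  by rewrite (psdZl ps) one// eqxx mulr1.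
move=> k ki; rewrite (psdZl ps) one// (_ : _ == _ = false) ?mulr0//.
by apply/negbTE; move: ki; rewrite -val_eqE.
Qed.

Lemma dot_sub_proj x i : (i < m)%N -> s (x - eproj m e x) (e i) = 0.
Proof. by move=> im; rewrite (psdBl ps) dot_proj// subrr. Qed.

Lemma projP c x y : eproj m e (c *: x + y) = c *: eproj m e x + eproj m e y.
Proof.
rewrite /eproj scaler_sumr -big_split/=; apply: eq_bigr => i _.
by rewrite (psd_linear ps) scalerDl scalerA.
Qed.

Lemma form_proj x y : a (eproj m e x) y = \sum_(i < m) lam i * s x (e i) * s y (e i).
Proof.
case: oe => ee _; rewrite (psd_suml pa); apply: eq_bigr => i _.
by rewrite (psdZl pa) ee// mulrCA mulrA (psd_sym pdot (j y)).
Qed.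

(** Since [x] and its projection have the same coefficients on the e_i, the cross term and the
    square of the projection combine, and exactly the sum of lam_i s(x, e_i)^2 is removed from the
    energy. *)
Lemma form_sub_proj x : (forall i, (i < m)%N -> 0 <= lam i) ->
  a (x - eproj m e x) (x - eproj m e x) <= a x x.
Proof.
move=> lam0; rewrite (psdBB pa) (psd_sym pa x (eproj m e x)) !form_proj.
rewrite [X in _ + X <= _](eq_bigr (fun i : 'I_m => lam i * s x (e i) * s x (e i))) => [|i _].
  rewrite -subr_ge0 (_ : _ - _ = \sum_(i < m) lam i * s x (e i) * s x (e i)).
    by apply: sumr_ge0 => i _; rewrite -mulrA mulr_ge0 ?lam0// -expr2 sqr_ge0.
  ring.
by rewrite dot_proj.
Qed.

(* In a minimizing sequence for the Rayleigh quotient the finitely many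
   functionals of [rellich] converge along a subsequence; the parallelogram
   identity and 2 e mu <= 1 then make that subsequence Cauchy. *)
Lemma minimizer_eigen L x0 : (forall i, (i < m)%N -> s x0 (e i) = 0) ->
  a x0 x0 < L * s x0 x0 ->
  exists mu z, [/\ mu < L, eigen mu z, s z z = 1 &
    forall i, (i < m)%N -> s z (e i) = 0].
Proof.
case: (oe) => ee one x0e ax0.
have s0p : 0 < s x0 x0.
  rewrite lt0r (psd_ge0 ps) andbT; apply/eqP => s0.
  by move: ax0; rewrite s0 mulr0 ltNge (psd_ge0 pa).
pose ok x := (forall i, (i < m)%N -> s x (e i) = 0) /\ s x x = 1.
pose S := [set r | exists2 x, ok x & r = a x x].
have normalize x : (forall i, (i < m)%N -> s x (e i) = 0) -> 0 < s x x ->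
    S (a x x / s x x).
  move=> xe sx; exists ((Num.sqrt (s x x))^-1 *: x).
    split=> [i im|].
      by rewrite (psdZl ps) xe// mulr0.
    by rewrite (psdZl ps) (psdZr ps) mulrA -expr2 exprVn sqr_sqrtr ?ltW// mulVf ?gt_eqF.
  by rewrite (psdZl pa) (psdZr pa) mulrA -expr2 exprVn sqr_sqrtr ?ltW// mulrC.
have S0 := normalize _ x0e s0p.
have lbS : lbound S 0 by move=> _ [x _ ->]; exact: psd_ge0.
have infS : has_inf S by split; [exists (a x0 x0 / s x0 x0)|exists 0].
pose mu := inf S.
have mu0 : 0 <= mu by apply: lb_le_inf => //; exists (a x0 x0 / s x0 x0).
have muS r : S r -> mu <= r by move=> Sr; apply: ge_inf => //; exists 0.
have muL : mu < L.
  by apply: le_lt_trans (muS _ S0) _; rewrite ltr_pdivrMr.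
have rayleigh x : (forall i, (i < m)%N -> s x (e i) = 0) -> mu * s x x <= a x x.
  move=> xe; have [sx|sx] := eqVneq (s x x) 0; first by rewrite sx mulr0 (psd_ge0 pa).
  have sxp : 0 < s x x by rewrite lt0r sx (psd_ge0 ps).
  by rewrite -ler_pdivlMr//; apply: muS; exact: normalize.
have ep0 : 0 < (2 * (mu + 1))^-1 by rewrite invr_gt0; lra.
have [K [l [C [C0 relK]]]] := rellich ep0.
pose near_min r x := ok x /\ a x x < mu + r.+1%:R^-1.
pose A r := [set v : 'rV[R]_K | exists2 x, near_min r x & v = \row_k dot (j x) (l k)].
have A0 r : A r !=set0.
  have [_ [x okx ->] xr] := @inf_adherent _ S r.+1%:R^-1 (ltac:(by rewrite invr_gt0)) infS.
  by exists (\row_k dot (j x) (l k)); exists x.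
have Adec r t : (r <= t)%N -> A t `<=` A r.
  move=> rt _ [x [okx xt] ->]; exists x => //; split=> //.
  by apply: (lt_le_trans xt); rewrite lerD2l lef_pV2 ?posrE// ler_nat.
have [p pA] : exists p : 'rV[R]_K, forall r (eps : R), 0 < eps ->
    exists2 v, A r v & forall i, `|v ord0 i - p ord0 i| < eps.
  (* With s x x = 1, Cauchy-Schwarz bounds the i-th value by the square root of t = dot (l i) (l i),
     hence by t + 1; the sum over k serves all coordinates at once. *)
  apply: (@rV_bounded_cluster _ _ _ (\sum_k (dot (l k) (l k) + 1))) => // _ [x [[_ sx] _] ->] i.
  rewrite mxE; apply: (@le_trans _ _ (dot (l i) (l i) + 1)).
    have := psd_cauchy_schwarz pdot (j x) (l i); rewrite sx mul1r => h.
    have l0 := psd_ge0 pdot (l i).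
    rewrite -(@ler_pXn2r _ 2)// ?nnegrE ?addr_ge0// -normrX ger0_norm ?sqr_ge0//.
    by have := sqr_ge0 (dot (l i) (l i)); rewrite sqrrD1; lra.
  rewrite (bigD1 i)//= lerDl; apply: sumr_ge0 => k _.
  by rewrite addr_ge0 ?(psd_ge0 pdot).
have /choice[g gP] r : exists x, near_min r x /\
    forall k, `|dot (j x) (l k) - p ord0 k| < r.+1%:R^-1.
  have [|_ [x xr ->] xp] := pA r r.+1%:R^-1; first by rewrite invr_gt0.
  by exists x; split=> // k; have := xp k; rewrite mxE.
(* Write d = 1/(k+1) and s, a for the two forms at the difference. The parallelogram identity gives
   a <= 4 d + mu s, and the functionals differ by at most 2 d, so their squares add up to at most 4
   K d (as d <= 1). Inserting this in [relK] and absorbing s/2 yields s <= 4 d + 8 C K d. *)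
have gap k t : (k <= t)%N ->
    s (g k - g t) (g k - g t) <= (4 + 8 * C * K%:R) * k.+1%:R^-1.
  move=> kt; set d := k.+1%:R^-1; pose d' : R := t.+1%:R^-1.
  have [[[gke gks] gka] gkp] := gP k; have [[[gte gts] gta] gtp] := gP t.
  have td : d' <= d :> R by rewrite lef_pV2 ?posrE// ler_nat.
  have d0 : 0 < d by rewrite invr_gt0.
  have dp0 : 0 < d' by rewrite invr_gt0.
  have d1 : d <= 1 by rewrite invf_le1// ler1n.
  have sum_le : \sum_k0 dot (j (g k - g t)) (l k0) ^+ 2 <= 4 * K%:R * d.
    rewrite (_ : 4 * K%:R * d = \sum_(i < K) 4 * d); last first.
      by rewrite sumr_const card_ord -mulr_natl; ring.
    apply: ler_sum => i _; rewrite linearB (psdBl pdot).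
    have := gkp i; have := gtp i; rewrite -/d -/d' !ltr_norml => /andP[h1 h2] /andP[h3 h4].
    set X := dot _ _ in h3 h4 *; set Y := dot _ _ in h1 h2 *.
    have XY1 : X - Y <= 2 * d by lra.
    have XY2 : - (2 * d) <= X - Y by lra.
    have : (X - Y) ^+ 2 <= (2 * d) ^+ 2.
      by rewrite -subr_ge0 subr_sqr mulr_ge0//; lra.
    have : d * d <= d by rewrite ger_pMl.
    by rewrite [(2 * d) ^+ 2]exprMn expr2; lra.
  have := relK (g k - g t).
  have := rayleigh (g k + g t).
  rewrite (psd_parallelogram pa) (psdDD ps) (psdBB ps) gks gts => ray relgt.
  have {}ray : mu * (1 + s (g k) (g t) *+ 2 + 1) <= a (g k + g t) (g k + g t).
    by apply: ray => i im; rewrite (psdDl ps) gke// gte// addr0.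
  set sg := s (g k) (g t) in ray relgt *.
  set ag := a (g k + g t) _ in ray relgt *.
  have agle : a (g k) (g k) *+ 2 + a (g t) (g t) *+ 2 - ag <= 4 * d + mu * (1 - sg *+ 2 + 1).
    by move: gka gta td ray; rewrite -/d -/d'; lra.
  set ep := (2 * (mu + 1))^-1 in relgt ep0.
  have epmu : ep * mu <= 2^-1.
    rewrite /ep mulrC ler_pdivrMr; lra.
  have ep1 : ep <= 2^-1 by rewrite /ep lef_pV2 ?posrE; lra.
  set S2 := \sum_ _ _ in relgt sum_le.
  have CS : C * S2 <= C * (4 * K%:R * d) by rewrite ler_wpM2l.
  have sg2 : 0 <= 1 - sg *+ 2 + 1.
    by have := psd_ge0 ps (g k - g t); rewrite (psdBB ps) gks gts.
  have := ler_wpM2l (ltW ep0) agle.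
  rewrite [X in _ <= X -> _]mulrDr [ep * (mu * _)]mulrA => h.
  have : ep * mu * (1 - sg *+ 2 + 1) <= 2^-1 * (1 - sg *+ 2 + 1) by rewrite ler_wpM2r.
  have : ep * (4 * d) <= 2^-1 * (4 * d) by rewrite ler_wpM2r// mulr_ge0// ltW.
  lra.
pose D := (1 + mu) * (4 + 8 * C * K%:R) + 4.
have gapN k t : (k <= t)%N ->
    s (g k - g t) (g k - g t) + a (g k - g t) (g k - g t) <= D * k.+1%:R^-1.
  move=> kt; have := gap k t kt; set d := k.+1%:R^-1.
  pose d' : R := t.+1%:R^-1.
  have td : d' <= d :> R by rewrite lef_pV2 ?posrE// ler_nat.
  have [[[gke gks] gka] _] := gP k; have [[[gte gts] gta] _] := gP t.
  have := rayleigh (g k + g t).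
  rewrite (psd_parallelogram pa) (psdDD ps) (psdBB ps) gks gts => ray sd.
  have {}ray : mu * (1 + s (g k) (g t) *+ 2 + 1) <= a (g k + g t) (g k + g t).
    by apply: ray => i im; rewrite (psdDl ps) gke// gte// addr0.
  move: gka gta td; rewrite -/d -/d' => gka gta td.
  move: ray sd; set ag := a (g k + g t) _; set sg := s _ _ => ray sd.
  have := ler_wpM2l mu0 sd; rewrite /D.
  clear -ray sd gka gta td.
  move: (a (g k) (g k)) (a (g t) (g t)) gka gta => A1 A2 gka gta.
  rewrite mulrDl; lra.
have D0 : 0 < D by rewrite /D ltr_wpDl// mulr_ge0// addr_ge0// !mulr_ge0.
have [z zlim] : exists z, (fun k => s (g k - z) (g k - z) + a (g k - z) (g k - z))
    @ \oo --> (0 : R).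
  apply: complete => eps eps0.
  have [N DN] : exists N : nat, D / eps < N.+1%:R.
    exists (Num.truncn (D / eps)); apply: truncnS_gt.
  have small k : (N <= k)%N -> D * k.+1%:R^-1 < eps.
    move=> Nk; rewrite ltr_pdivrMr// mulrC -ltr_pdivrMr//.
    by apply: lt_le_trans DN _; rewrite ler_nat.
  exists N => k t Nk Nt; have [kt|/ltnW tk] := leqP k t.
    exact: le_lt_trans (gapN _ _ kt) (small _ Nk).
  rewrite (psdBC ps) (psdBC pa).
  exact: le_lt_trans (gapN _ _ tk) (small _ Nt).
have szlim : (fun k => s (g k - z) (g k - z)) @ \oo --> (0 : R).
  apply: (squeeze_cvgr _ (cvg_cst 0) zlim); apply: nearW => k.
  by rewrite (psd_ge0 ps)/= lerDl (psd_ge0 pa).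
have azlim : (fun k => a (g k - z) (g k - z)) @ \oo --> (0 : R).
  apply: (squeeze_cvgr _ (cvg_cst 0) zlim); apply: nearW => k.
  by rewrite (psd_ge0 pa)/= lerDr (psd_ge0 ps).
have szz : s z z = 1.
  apply: (cvg_unique _ (psd_cvg_diag ps szlim)) => //.
  rewrite (_ : (fun _ => _) = cst 1); first exact: cvg_cst.
  by apply/funext => k /=; have [[[]]] := gP k.
have sze i : (i < m)%N -> s z (e i) = 0.
  move=> im; apply: (cvg_unique _ (psd_cvg ps (y := e i) szlim)) => //.
  rewrite (_ : (fun _ => _) = cst 0); first exact: cvg_cst.
  by apply/funext => k /=; have [[[->]]] := gP k.
have azz : a z z = mu.
  apply/eqP; rewrite eq_le; apply/andP; split; last first.
    by have := rayleigh z sze; rewrite szz mulr1.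
  have : (fun k => mu + harmonic k) @ \oo --> mu + (0 : R).
    by apply: cvgD; [exact: cvg_cst|exact: cvg_harmonic].
  rewrite addr0 => mulim; apply: (ler_cvg_to (psd_cvg_diag pa azlim) mulim).
  by apply: nearW => k; have [[[_ _] /ltW]] := gP k.
pose P x := x - eproj m e x.
have Plin c x y : P (c *: x + y) = c *: P x + P y.
  by rewrite /P projP scalerBr opprD addrACA.
have Pe x i : (i < m)%N -> s (P x) (e i) = 0 by exact: dot_sub_proj.
(* [a - mu s] is positive semidefinite on the orthogonal of the e_i and
   vanishes at [z], so Cauchy-Schwarz yields the Euler-Lagrange equation. *)
have pq : psd_form (fun x y => a (P x) (P y) - mu * s (P x) (P y)).
  split=> [c x y t|x y|x].
  - by rewrite Plin (psd_linear pa) (psd_linear ps); ring.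
  - by rewrite (psd_sym pa) (psd_sym ps).
  - by rewrite subr_ge0 rayleigh// => i im; exact: Pe.
have projz : eproj m e z = 0.
  by rewrite /eproj big1// => i _; rewrite sze// scale0r.
have Pz : P z = z by rewrite /P projz subr0.
exists mu, z; split=> // y.
have := psd_eq0l pq (x := z) y; rewrite Pz szz azz mulr1 subrr => /(_ erefl).
rewrite /P (psdBr pa) (psdBr ps) (psd_sym pa z (eproj m e y)) form_proj.
rewrite big1 => [|i _]; last by rewrite sze// mulr0.
rewrite (psd_sumr ps) big1 => [|i _]; last by rewrite (psdZr ps) sze// mulr0.
by rewrite !subr0 => /eqP; rewrite subr_eq0 => /eqP.
Qed.

End projection.

Hypothesis dense : forall g, (forall x, dot g (j x) = 0) -> dot g g = 0.

Variable lam : nat -> R.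
Hypothesis lam_homo : {homo lam : i k / (i <= k)%N >-> i <= k}.
Hypothesis spectrum : forall (mu : R) (k : nat),
    (exists t : 'I_k -> nat, injective t /\ forall i, lam (t i) = mu) <->
    (exists u : 'I_k -> V, (forall i, eigen mu (u i)) /\
       forall c : 'I_k -> R,
         s (\sum_i c i *: u i) (\sum_i c i *: u i) = 0 -> forall i, c i = 0).
Hypothesis lam0_gt0 : 0 < lam 0%N.

Lemma lam_gt0 i : 0 < lam i.
Proof. exact: lt_le_trans lam0_gt0 (lam_homo (leq0n i)). Qed.

(** If k indices below m carry the value [lam m], then together with m there are k + 1, so the
    eigenspace contains k + 1 independent vectors. Some nonzero combination of these is orthogonal
    to the k vectors already chosen there; orthogonality to the other e_i is automatic. *)
Lemma extend_orthonormal_eigen m e : orthonormal_eigen lam m e ->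
  exists x, [/\ eigen (lam m) x, s x x = 1 &
    forall i, (i < m)%N -> s x (e i) = 0].
Proof.
move=> [ee one]; pose J := [seq i <- iota 0 m | lam i == lam m].
set k := size J.
have [u [ue uf]] : exists u : 'I_k.+1 -> V, (forall i, eigen (lam m) (u i)) /\
    forall c : 'I_k.+1 -> R,
      s (\sum_i c i *: u i) (\sum_i c i *: u i) = 0 -> forall i, c i = 0.
  apply/spectrum.
  have uJ : uniq (rcons J m).
    by rewrite rcons_uniq filter_uniq ?iota_uniq// andbT mem_filter mem_iota ltnn !andbF.
  have sJ : size (rcons J m) = k.+1 by rewrite size_rcons.
  exists (fun i => nth 0%N (rcons J m) i); split=> [i i' /eqP|i].
    by rewrite nth_uniq ?sJ// => /eqP/val_inj.
  have : nth 0%N (rcons J m) i \in rcons J m by rewrite mem_nth ?sJ.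
  by rewrite mem_rcons inE mem_filter => /orP[/eqP->//|/andP[/eqP]].
have [c [[i0 ci0] cz]] := underdetermined_system (fun i (t : 'I_k) => s (u i) (e (nth 0%N J t))).
pose x := \sum_i c i *: u i.
have xe : eigen (lam m) x by apply: eigen_lin.
have sx0 : s x x != 0.
  by apply: contra ci0 => /eqP /uf ->.
have sxp : 0 < s x x by rewrite lt0r sx0 (psd_ge0 ps).
have xei i : (i < m)%N -> s x (e i) = 0.
  move=> im; have [li|li] := eqVneq (lam i) (lam m); last first.
    by apply: (eigen_orthogonal xe (ee _ im)); rewrite eq_sym.
  have iJ : i \in J by rewrite mem_filter li eqxx mem_iota.
  have iJk : (index i J < k)%N by rewrite index_mem.
  have := cz (Ordinal iJk); rewrite /= nth_index// => <-.
  by rewrite (psd_suml ps); apply: eq_bigr => t _; rewrite (psdZl ps).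
exists ((Num.sqrt (s x x))^-1 *: x); split.
- by move=> y; rewrite (psdZl pa) (psdZl ps) xe mulrCA.
- by rewrite (psdZl ps) (psdZr ps) mulrA -expr2 exprVn sqr_sqrtr ?ltW// mulVf.
- by move=> i im; rewrite (psdZl ps) xei// mulr0.
Qed.

Lemma eq_orthonormal_eigen m (e e' : nat -> V) :
  (forall i, (i < m)%N -> e i = e' i) ->
  orthonormal_eigen lam m e -> orthonormal_eigen lam m e'.
Proof.
move=> eqe [ee one]; split=> [i im|i k im km]; first by rewrite -eqe//; exact: ee.
by rewrite -!eqe//; exact: one.
Qed.

Lemma orthonormal_eigen_sequence :
  exists e, forall m, orthonormal_eigen lam m e.
Proof.
(* Dependent choice through lists: [next] is total, with the junk value 0 on lists that are not
   orthonormal eigenvectors; such lists never occur among the iterates. *)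
have /choice[next nextP] (t : seq V) : exists x,
    orthonormal_eigen lam (size t) (nth 0 t) ->
    orthonormal_eigen lam (size t).+1 (nth 0 (rcons t x)).
  have [ot|] := pselect (orthonormal_eigen lam (size t) (nth 0 t)); last by exists 0.
  have [x [xe xx xt]] := extend_orthonormal_eigen ot; exists x => _.
  have nx : nth 0 (rcons t x) (size t) = x by rewrite nth_rcons ltnn eqxx.
  have nt i : (i < size t)%N -> nth 0 (rcons t x) i = nth 0 t i.
    by move=> it; rewrite nth_rcons it.
  have [ee one] := ot; split=> [i|i k].
    by rewrite ltnS leq_eqVlt => /predU1P[->|it]; rewrite ?nx// nt//; exact: ee.
  rewrite ltnS leq_eqVlt => /predU1P[->|it];
    rewrite ltnS leq_eqVlt => /predU1P[->|kt]; rewrite ?nx ?nt ?xx ?eqxx//.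
  - by rewrite xt// (gtn_eqF kt).
  - by rewrite (psd_sym pdot) xt// (ltn_eqF it).
  - exact: one.
pose t k := iter k (fun t => rcons t (next t)) [::].
have st k : size (t k) = k by elim: k => //= k IH; rewrite size_rcons IH.
have ot k : orthonormal_eigen lam k (nth 0 (t k)).
  elim: k => [|k IH]; first by split.
  by have := nextP (t k); rewrite st; exact.
exists (fun i => nth 0 (t i.+1) i) => m; apply: eq_orthonormal_eigen (ot m) => i im.
elim: m im => // m IH; rewrite ltnS leq_eqVlt => /orP[/eqP->//|im].
by rewrite -IH//= nth_rcons st im.
Qed.

Variable e : nat -> V.
Hypothesis oe : forall m, orthonormal_eigen lam m e.

Lemma e_eigen i : eigen (lam i) (e i).
Proof. by have [h _] := oe i.+1; exact: h. Qed.

Lemma e_orthonormal i k : s (e i) (e k) = (i == k)%:R.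
Proof.
by have [_ h] := oe (maxn i k).+1; rewrite h// ltnS ?leq_maxl ?leq_maxr.
Qed.

(** If all eigenvalues were at most L, the compactness inequality with e = 1/(2L) would provide K
    functionals; a nonzero combination x of K + 1 eigenvectors annihilated by all of them would
    satisfy s x x <= a x x / (2L) <= s x x / 2. *)
Lemma lam_unbounded L : exists m, L < lam m.
Proof.
apply: contrapT => /forallNP lamL.
have {}lamL m : lam m <= L by rewrite leNgt; apply/negP; exact: lamL.
have L0 : 0 < L by exact: lt_le_trans lam0_gt0 (lamL _).
have [|K [l [C [C0 rel]]]] := rellich (e := (2 * L)^-1).
  by rewrite invr_gt0 mulr_gt0.
have [c [[i0 ci0] cz]] := underdetermined_system (fun i (k : 'I_K) => dot (j (e i)) (l k)).
pose x := \sum_(i < K.+1) c i *: e i.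
have sxe (i : 'I_K.+1) : s x (e i) = c i.
  rewrite (psd_suml ps) (bigD1 i)//= (psdZl ps) e_orthonormal eqxx mulr1.
  rewrite big1 ?addr0// => k /negbTE ki.
  by rewrite (psdZl ps) e_orthonormal (_ : _ == _ = false) ?mulr0.
have sxx : s x x = \sum_(i < K.+1) c i ^+ 2.
  rewrite [LHS](psd_sumr ps); apply: eq_bigr => i _.
  by rewrite (psdZr ps) sxe.
have axx : a x x <= L * s x x.
  rewrite sxx mulr_sumr [leLHS](psd_suml pa); apply: ler_sum => i _.
  rewrite (psdZl pa) e_eigen (psd_sym pdot) sxe mulrCA -expr2.
  by rewrite ler_wpM2r// sqr_ge0.
have sxp : 0 < s x x.
  rewrite sxx (bigD1 i0)//= ltr_wpDr ?sumr_ge0// => [i _|].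
    exact: sqr_ge0.
  by rewrite exprn_even_gt0.
have := rel x; rewrite big1 => [|k _]; last first.
  rewrite linear_sum (psd_suml pdot) (_ : \sum_i _ = 0) ?expr0n//.
  by rewrite -[RHS](cz k); apply: eq_bigr => i _; rewrite linearZ (psdZl pdot).
rewrite mulr0 addr0 => h.
have iL : 0 <= (2 * L)^-1 by rewrite invr_ge0 mulr_ge0 ?ltW.
have := le_trans h (ler_wpM2l iL axx).
rewrite (_ : _ * _ = 2^-1 * s x x); last by field; rewrite gt_eqF.
lra.
Qed.

(** The e_i with eigenvalue [mu] and i < m, together with [z], are k + 1 independent eigenvectors,
    so [mu] occurs k + 1 times in [lam]. As mu < lam m, all occurrences lie below m, where there are
    only k. *)
Lemma no_extra_eigen mu z m : mu < lam m -> eigen mu z -> s z z = 1 ->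
  (forall i, (i < m)%N -> s z (e i) = 0) -> False.
Proof.
move=> mum ez zz ze; pose J := [seq i <- iota 0 m | lam i == mu].
pose t := rcons (map e J) z; pose k := size J.
have st : size t = k.+1 by rewrite size_rcons size_map.
have Jm i : (i < k)%N -> (nth 0%N J i < m)%N /\ lam (nth 0%N J i) = mu.
  move=> ik; have : nth 0%N J i \in J by rewrite mem_nth.
  by rewrite mem_filter mem_iota => /andP[/eqP -> /andP[]].
have tJ i : (i < k)%N -> nth 0 t i = e (nth 0%N J i).
  by move=> ik; rewrite nth_rcons size_map ik (nth_map 0%N).
have tz : nth 0 t k = z by rewrite nth_rcons size_map ltnn eqxx.
have ot i i' : (i < k.+1)%N -> (i' < k.+1)%N ->
    s (nth 0 t i) (nth 0 t i') = (i == i')%:R.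
  rewrite !ltnS leq_eqVlt => /orP[/eqP->|ik]; rewrite leq_eqVlt => /orP[/eqP->|ik'].
  - by rewrite tz eqxx.
  - by rewrite tz tJ// ze ?(gtn_eqF ik')//; have [] := Jm _ ik'.
  - by rewrite tz tJ// (psd_sym pdot) ze ?(ltn_eqF ik)//; have [] := Jm _ ik.
  - by rewrite !tJ// e_orthonormal nth_uniq// filter_uniq// iota_uniq.
have [r [rinj rmu]] : exists r : 'I_k.+1 -> nat, injective r /\ forall i, lam (r i) = mu.
  apply/spectrum; exists (fun i => nth 0 t i); split=> [i|c c0 i].
    have := ltn_ord i; rewrite ltnS leq_eqVlt => /orP[/eqP->|ik]; first by rewrite tz.
    by rewrite tJ//; have [_ <-] := Jm _ ik; exact: e_eigen.
  have := psd_eq0l ps (nth 0 t i) c0.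
  rewrite (psd_suml ps) (bigD1 i)//= (psdZl ps) ot// eqxx mulr1 big1 ?addr0//.
  by move=> i' ii'; rewrite (psdZl ps) ot// (_ : _ == _ = false) ?mulr0//; apply/negbTE.
have rJ i : r i \in J.
  rewrite mem_filter rmu eqxx mem_iota/= add0n ltnNge; apply/negP => mr.
  by have := lam_homo mr; rewrite rmu leNgt mum.
have : (size (map r (enum 'I_k.+1)) <= size J)%N.
  apply: uniq_leq_size; first by rewrite map_inj_uniq ?enum_uniq.
  by move=> _ /mapP[i _ ->].
by rewrite size_map size_enum_ord -/k ltnn.
Qed.

(** A violation would be turned by minimization into a normalized eigenvector below [lam m] that is
    orthogonal to e_0, ..., e_{m-1}, which the multiplicity count forbids. *)
Lemma spectral_gap m x : (forall i, (i < m)%N -> s x (e i) = 0) ->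
  lam m * s x x <= a x x.
Proof.
move=> xe; rewrite leNgt; apply/negP => axx.
have [mu [z [mum ez zz ze]]] :=
  minimizer_eigen (oe m) xe axx.
exact: no_extra_eigen mum ez zz ze.
Qed.

Lemma proj_error m x :
  s (x - eproj m e x) (x - eproj m e x) <= a x x / lam m.
Proof.
rewrite ler_pdivlMr ?lam_gt0// mulrC.
apply: le_trans (form_sub_proj (oe m) x _); last by move=> *; rewrite ltW ?lam_gt0.
by apply: spectral_gap => i im; rewrite (dot_sub_proj (oe m)).
Qed.

Variable b : nat -> W.
Hypothesis b_orthonormal : forall i k, dot (b i) (b k) = (i == k)%:R.

Let psum m w := \sum_(i < m) dot w (b i) *: b i.

Hypothesis b_optimal : forall m x, (1 <= m)%N ->
  dot (j x - psum m (j x)) (j x - psum m (j x)) <= a x x / lam m.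

(** By monotonicity the least index carrying the value [lam i] separates off the strictly smaller
    eigenvalues, which turns comparisons of eigenvalues into comparisons of indices. *)
Lemma eigen_block_start i : exists m, [/\ lam m = lam i, (m <= i)%N &
  forall k, lam k < lam i <-> (k < m)%N].
Proof.
have exP : exists m, lam m == lam i by exists i.
case: (ex_minnP exP) => m /eqP mi mmin; exists m; split=> //; first exact: mmin.
move=> k; split=> [ki|km].
  by rewrite ltnNge; apply/negP => /lam_homo; rewrite mi leNgt ki.
rewrite lt_neqAle -{2}mi lam_homo 1?ltnW// andbT.
by apply/negP => /mmin; rewrite leqNgt km.
Qed.

(* With m the first index such that lam m = lam k, some nonzero x in
   span(e_0, ..., e_{m-1}, e_k) is orthogonal to b_0, ..., b_{m-1}; optimality
   at x forces equality, which leaves only the e_k component. *)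
Lemma basis_orthogonal_above i k : lam i < lam k -> dot (b i) (j (e k)) = 0.
Proof.
have [m [mk mlek mP]] := eigen_block_start k.
move=> /mP im; have m0 : (1 <= m)%N by case: (m) im.
(* The m + 1 vectors e_0, ..., e_{m-1}, e_k are enumerated by [f], with e_k in the last position;
   [g] records the underlying index. *)
pose f (t : nat) := if (t < m)%N then e t else e k.
pose g (t : nat) := if (t < m)%N then t else k.
have fg t : f t = e (g t) by rewrite /f /g; case: ifP.
have gm t : (t <= m)%N -> lam (g t) <= lam m.
  by rewrite /g; case: ifP => [tm _|_ _]; [exact/lam_homo/ltnW|rewrite mk].
have ginj (t t' : 'I_m.+1) : (g t == g t') = (t == t').
  rewrite /g; apply/eqP/eqP => [|->//]; have := ltn_ord t; have := ltn_ord t'.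
  by move=> h1 h2; case: ifP; case: ifP => h3 h4 h5; apply/val_inj => /=; lia.
have [c [[i0 ci0] cz]] := underdetermined_system
  (fun (t : 'I_m.+1) (r : 'I_m) => dot (j (f t)) (b r)).
pose x := \sum_(t < m.+1) c t *: f t.
have sxf (t : 'I_m.+1) : s x (f t) = c t.
  rewrite (psd_suml ps) (bigD1 t)//= (psdZl ps) !fg e_orthonormal eqxx mulr1.
  rewrite big1 ?addr0// => t' /negbTE tt'.
  by rewrite (psdZl ps) !fg e_orthonormal ginj tt' mulr0.
have sxx : s x x = \sum_(t < m.+1) c t ^+ 2.
  rewrite [LHS](psd_sumr ps); apply: eq_bigr => t _.
  by rewrite (psdZr ps) sxf.
have axx : a x x = \sum_(t < m.+1) lam (g t) * c t ^+ 2.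
  rewrite [LHS](psd_suml pa); apply: eq_bigr => t _.
  by rewrite (psdZl pa) fg e_eigen (psd_sym pdot) -fg sxf mulrCA -expr2.
have xb (r : 'I_m) : dot (j x) (b r) = 0.
  rewrite linear_sum (psd_suml pdot).
  by rewrite -[RHS](cz r); apply: eq_bigr => t _; rewrite linearZ (psdZl pdot).
have lm0 := lam_gt0 m.
have := b_optimal x m0; rewrite /psum big1 => [|r _]; last by rewrite xb scale0r.
rewrite subr0 ler_pdivlMr// mulrC axx sxx mulr_sumr -subr_ge0 -sumrB => h.
(* Each term is nonnegative because lam (g t) <= lam m, while optimality makes the sum at most 0;
   hence every term vanishes. *)
have hsum : \sum_(t < m.+1) (lam m * c t ^+ 2 - lam (g t) * c t ^+ 2) == 0.
  rewrite eq_le -oppr_ge0 -sumrN (le_trans h) ?ler_sum//.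
    apply: sumr_ge0 => t _; rewrite -mulrBl mulr_ge0 ?sqr_ge0// subr_ge0 gm//.
    by rewrite -ltnS.
  by move=> t _; rewrite opprB.
have ct (t : 'I_m.+1) : (t < m)%N -> c t = 0.
  move=> tm; move: hsum; rewrite psumr_eq0 => [|t' _]; last first.
    by rewrite -mulrBl mulr_ge0 ?sqr_ge0// subr_ge0 gm// -ltnS.
  move=> /allP/(_ t); rewrite mem_index_enum => /(_ isT)/=.
  rewrite -mulrBl mulf_eq0 sqrf_eq0 subr_eq0 /g tm => /orP[|/eqP//].
  by rewrite mk gt_eqF//; exact/mP.
have i0m : i0 = ord_max.
  apply/val_inj => /=; have := ltn_ord i0; rewrite ltnS leq_eqVlt => /orP[/eqP//|].
  by move=> /ct c0; rewrite c0 eqxx in ci0.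
have xk : x = c i0 *: e k.
  rewrite /x (bigD1 i0)//= big1 ?addr0 => [|t ti0].
    by rewrite i0m /f/= ltnn.
  rewrite ct ?scale0r//; have := ltn_ord t; rewrite ltnS leq_eqVlt => /orP[/eqP tm|//].
  by move: ti0; rewrite i0m -val_eqE/= tm eqxx.
have := xb (Ordinal im); rewrite xk linearZ (psdZl pdot) => /eqP.
by rewrite mulf_eq0 (negbTE ci0)/= (psd_sym pdot) => /eqP.
Qed.

(** The residual g is orthogonal to every e_k: by subtraction for k < p, by [basis_orthogonal_above]
    for k >= p. In its product with j x, the vector x may thus be replaced by x minus its
    projection, whose norm tends to 0 since [lam] is unbounded. So g is orthogonal to the dense
    image of [j]. *)
Lemma basis_in_low_modes i p : (forall k, (p <= k)%N -> lam i < lam k) ->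
  let g := b i - j (\sum_(k < p) dot (b i) (j (e k)) *: e k) in dot g g = 0.
Proof.
move=> pk g; have ge k : dot g (j (e k)) = 0.
  rewrite /g (psdBl pdot) (psd_suml ps).
  have [kp|pk'] := ltnP k p.
    rewrite (bigD1 (Ordinal kp))//= (psdZl ps) e_orthonormal eqxx mulr1.
    rewrite big1 ?addr0 ?subrr// => k' kk'.
    by rewrite (psdZl ps) e_orthonormal (_ : _ == _ = false) ?mulr0//; apply/negbTE.
  rewrite basis_orthogonal_above ?pk// big1 ?subrr// => k' _.
  by rewrite (psdZl ps) e_orthonormal ltn_eqF ?mulr0//; exact: leq_trans pk'.
apply: dense => x; apply/eqP; rewrite -sqrf_eq0; apply/eqP/le_anti.
rewrite sqr_ge0 andbT leNgt; apply/negP => gx.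
pose A := dot g g * a x x.
have [m lamm] := lam_unbounded (A / dot g (j x) ^+ 2).
have : dot g (j x) ^+ 2 <= A / lam m.
  have -> : dot g (j x) = dot g (j (x - eproj m e x)).
    rewrite linearB (psdBr pdot) /eproj linear_sum (psd_sumr pdot) big1 ?subr0//.
    by move=> k _; rewrite linearZ (psdZr pdot) ge mulr0.
  apply: le_trans (psd_cauchy_schwarz pdot _ _) _.
  by rewrite /A -mulrA ler_wpM2l ?(psd_ge0 pdot)// proj_error.
rewrite ler_pdivlMr ?lam_gt0// leNgt mulrC; move: lamm.
by rewrite ltr_pdivrMr// => ->.
Qed.

(* The coefficients of b_0, ..., b_{m-1} on e_0, ..., e_{m-1} form a square
   matrix U with U U^T = 1, hence U^T U = 1 and e_k lies in the span of the
   b_r, r < m. *)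
Lemma basis_orthogonal_below i k : lam k < lam i -> dot (b i) (j (e k)) = 0.
Proof.
have [m [mi mlei mP]] := eigen_block_start i.
move=> /mP km.
pose U := \matrix_(r < m, t < m) dot (b r) (j (e t)).
(* For r < m the eigenvalue lam r is strictly below lam m, so [basis_in_low_modes] applies with p =
   m. *)
have bU (r : 'I_m) y : dot (b r) y = \sum_(t < m) U r t * dot (j (e t)) y.
  have low : forall k, (m <= k)%N -> lam r < lam k.
    by move=> k' mk'; apply: lt_le_trans (lam_homo mk'); rewrite mi; exact/mP.
  have := psd_eq0l pdot y (basis_in_low_modes low).
  rewrite (psdBl pdot) => /eqP; rewrite subr_eq0 => /eqP->.
  rewrite linear_sum (psd_suml pdot); apply: eq_bigr => t _.
  by rewrite linearZ (psdZl pdot) mxE.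
have UUt : U *m U^T = 1%:M.
  apply/matrixP => r r'; rewrite !mxE -[RHS]/((r == r')%:R).
  rewrite -[(r == r')%:R]/((val r == val r')%:R) -b_orthonormal bU.
  by apply: eq_bigr => t _; rewrite !mxE (psd_sym pdot (b r')).
have /matrixP/(_ (Ordinal km) (Ordinal km)) := mulmx1C UUt.
rewrite !mxE eqxx => UtU.
pose w := j (e k) - \sum_(r < m) U r (Ordinal km) *: b r.
(* With q the diagonal entry of U^T U at k, which is 1, the square of w expands to 1 - 2 q + q. *)
have ww : dot w w = 0.
  rewrite /w (psdBB pdot) e_orthonormal eqxx (psd_sumr pdot).
  rewrite (eq_bigr (fun r : 'I_m => U^T (Ordinal km) r * U r (Ordinal km))) => [|r _]; last first.
    by rewrite (psdZr pdot) (psd_sym pdot) !mxE.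
  rewrite UtU (psd_suml pdot).
  rewrite (eq_bigr (fun r : 'I_m => U^T (Ordinal km) r * U r (Ordinal km))) => [|r _]; last first.
    rewrite (psdZl pdot) (psd_sumr pdot) (bigD1 r)//= (psdZr pdot) b_orthonormal eqxx mulr1.
    rewrite big1 ?addr0 => [|r' rr']; last first.
      rewrite (psdZr pdot) b_orthonormal (_ : _ == _ = false) ?mulr0//.
      by rewrite eq_sym; apply/negbTE.
    by rewrite !mxE.
  by rewrite UtU; ring.
have := psd_eq0r pdot (b i) ww.
rewrite /w (psdBr pdot) (psd_sumr pdot) => /eqP; rewrite subr_eq0 => /eqP ->.
rewrite big1// => r _; rewrite (psdZr pdot) b_orthonormal (_ : _ == _ = false) ?mulr0//.
by apply/negbTE; rewrite gtn_eqF// (leq_trans _ mlei).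
Qed.

(** In the low mode expansion of b_i, the orthogonality relations above and below leave only the e_k
    with lam k = lam i. The eigenvector equals b_i up to a vector of zero norm, since W consists of
    representatives. *)
Lemma basis_eigen i : exists2 x, eigen (lam i) x &
  dot (b i - j x) (b i - j x) = 0.
Proof.
have [p lamp] := lam_unbounded (lam i).
exists (\sum_(k < p) dot (b i) (j (e k)) *: e k); last first.
  by apply: basis_in_low_modes => k pk; apply: lt_le_trans (lam_homo pk).
rewrite (bigID (fun k : 'I_p => lam k == lam i))/= addrC big1 ?add0r.
  by apply: eigen_lin => // k /eqP <-; exact: e_eigen.
move=> k; rewrite neq_lt => /orP[ki|ik].
  by rewrite basis_orthogonal_below// scale0r.
by rewrite basis_orthogonal_above// scale0r.
Qed.

End spectral.

(** * Lebesgue measurability of open sets of R^n *)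

Section rV_topology.
Context {R : realType} {n : nat}.
Implicit Types (U : set 'rV[R]_n) (c : 'rV[R]_n) (r : R).

Definition box c r : set 'rV[R]_n := [set v | forall i, `|v ord0 i - c ord0 i| < r].
Definition cbox c r : set 'rV[R]_n := [set v | forall i, `|v ord0 i - c ord0 i| <= r].

Lemma ball_box c r : 0 < r -> ball c r = box c r.
Proof.
move=> r0; apply/seteqP; split=> [v [_ cv] i|v cv].
  by rewrite distrC; exact: cv.
by split=> // i k; rewrite ord1 /ball/= distrC; exact: cv.
Qed.

Lemma compact_cbox c r : compact (cbox c r).
Proof.
rewrite (_ : cbox c r = [set v | forall i, `[c ord0 i - r, c ord0 i + r]%classic (v ord0 i)]).
  by apply: (@rV_compact R n (fun i => `[c ord0 i - r, c ord0 i + r]%classic)) => i;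
    exact: segment_compact.
by apply/seteqP; split=> v cv i; have := cv i; rewrite /= in_itv/= ler_distl.
Qed.

Lemma measurable_box c r : measurable (box c r).
Proof.
rewrite (_ : box c r = \bigcap_(i in [set: 'I_n])
    ((fun v : 'rV[R]_n => v ord0 i) @^-1` `]c ord0 i - r, c ord0 i + r[%classic)).
  apply: fin_bigcap_measurable => // i _; rewrite -[X in measurable X]setTI.
  by apply: (measurable_coord_rV (T := R)) => //; exact: measurable_itv.
apply/seteqP; split=> v cv i; [move=> _|]; have := cv i.
  by rewrite /= in_itv/= ltr_distl.
by move=> /(_ I); rewrite /= in_itv/= ltr_distl.
Qed.

Lemma rational_box_nbhs U v : open U -> U v -> exists (q : 'rV[rat]_n) (k : nat),
  box (map_mx ratr q) k.+1%:R^-1 v /\ cbox (map_mx ratr q) k.+1%:R^-1 `<=` U.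
Proof.
move=> oU Uv; have /nbhs_ballP[e /= e0 eU] : nbhs v U by exact: open_nbhs_nbhs.
pose k := Num.truncn (2 / e); have ke : 2 / e < k.+1%:R by exact: truncnS_gt.
have d0 : 0 < k.+1%:R^-1 :> R by rewrite invr_gt0.
have ke' : 2 * k.+1%:R^-1 < e by rewrite ltr_pdivrMr// mulrC -ltr_pdivrMr.
have /choice[q qP] i : exists q : rat,
    ratr q \in `](v ord0 i - k.+1%:R^-1), (v ord0 i + k.+1%:R^-1)[.
  have [|q qi] := @rat_in_itvoo R (v ord0 i - k.+1%:R^-1) (v ord0 i + k.+1%:R^-1).
    by rewrite ltrBlDr -addrA ltrDl addr_gt0.
  by exists q.
exists (\row_i q i), k; split=> [i|w qw].
  by rewrite !mxE distrC; have := qP i; rewrite in_itv/= ltr_distl.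
apply: eU; rewrite ball_box// => i.
have := qw i; rewrite !mxE; have := qP i.
rewrite in_itv/= -ltr_distl; move: ke'; move: (k.+1%:R^-1) => d ke' h1 h2.
by apply: le_lt_trans (ler_distD (ratr (q i)) _ _) _; lra.
Qed.

(** Boxes with rational centers and radii 1/(k+1) are enumerated by [unpickle], a code of no pair
    falling back to (0, 0). Closed boxes inside U are requested because they will contain the
    compact supports of bumps. *)
Lemma open_bigcup_box U : open U -> exists (P : set nat) (c : nat -> 'rV[R]_n) (r : nat -> R),
  [/\ forall k, 0 < r k, forall k, P k -> cbox (c k) (r k) `<=` U &
      U = \bigcup_(k in P) box (c k) (r k)].
Proof.
move=> oU.
pose w (k : nat) : 'rV[rat]_n * nat := odflt (0, 0%N) (unpickle k).
pose c k : 'rV[R]_n := map_mx ratr (w k).1.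
pose r k : R := (w k).2.+1%:R^-1.
exists [set k | cbox (c k) (r k) `<=` U], c, r; split=> [k|//|].
  by rewrite invr_gt0.
apply/seteqP; split=> [v Uv|v [k kU kv]].
  have [q [k [vqk qkU]]] := rational_box_nbhs oU Uv.
  by exists (pickle (q, k)); rewrite /= /c /r /w pickleK.
by apply: kU => i; exact/ltW/kv.
Qed.

Lemma open_measurable_rV U : open U -> measurable U.
Proof.
move=> /open_bigcup_box[P [c [r [_ _ ->]]]].
by apply: bigcup_measurable => k _; exact: measurable_box.
Qed.

Lemma continuous_measurable_rV (f : 'rV[R]_n -> R) : continuous f -> measurable_fun setT f.
Proof.
move=> cf; apply: (measurability _ (measurable_realfun.RGenOInfty.measurableE R)).
move=> _ [_ [x ->] <-]; rewrite setTI; apply: open_measurable_rV.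
by apply: open_comp => [+ _|]; [exact: cf|exact: rray_open].
Qed.

(** The sigma-algebra generated by the coordinates is the Borel one: open sets are countable unions
    of boxes, and coordinates are continuous. This permits a Dynkin argument starting from open
    sets. *)
Lemma measurable_rV_open : @measurable _ 'rV[R]_n = <<s @open 'rV[R]_n >>.
Proof.
apply/seteqP; split; last first.
  apply: smallest_sub; first exact: sigma_algebra_measurable.
  by move=> U; exact: open_measurable_rV.
apply: smallest_sub; first exact: smallest_sigma_algebra.
move=> A; rewrite -bigcup_seq/= => -[i _ [B mB <-]].
rewrite setTI.
pose T := g_sigma_algebraType (@open 'rV[R]_n).
suff : measurable_fun [set: T] (fun x : T => (x : 'rV[R]_n) ord0 i).
  by move=> /(_ measurableT B mB); rewrite setTI.
apply: (measurability _ (measurable_realfun.RGenOInfty.measurableE R)).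
move=> _ [_ [x ->] <-]; rewrite setTI; apply: sub_sigma_algebra.
apply: (@open_comp 'rV[R]_n R (fun v => v ord0 i)) => [v _|]; last exact: rray_open.
exact: coord_continuous.
Qed.

End rV_topology.

(** * Smooth functions and bumps *)

(** When g carries a line affinely to a line, the difference quotients coincide term by term. This
    handles both functions of a single coordinate and slices of a function through [cons_rV]. *)
Lemma derivable_line (R : numFieldType) (U V W : normedModType R)
    (f : V -> W) (g : U -> V) x u v :
  (forall h : R, g (h *: u + x) = h *: v + g x) ->
  (derivable (f \o g) x u <-> derivable f (g x) v) /\
  'D_u (f \o g) x = 'D_v f (g x).
Proof.
move=> gE; rewrite /derivable /derive.
suff -> : (fun h : R => h^-1 *: ((f \o g \o shift x) (h *: u) - (f \o g) x)) =
    (fun h : R => h^-1 *: ((f \o shift (g x)) (h *: v) - f (g x))) by [].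
by apply/funext => h /=; rewrite gE.
Qed.

Section flat.
Context {R : realType}.
Implicit Type t : R.

(* The family t^-m exp(-1/t) (extended by 0) is closed under differentiation. *)
Definition flat m t : R := if 0 < t then t^-1 ^+ m * expR (- t^-1) else 0.

Lemma flat_ge0 m t : 0 <= flat m t.
Proof.
by rewrite /flat; case: ifPn => // t0; rewrite mulr_ge0 ?expR_ge0// exprn_ge0// invr_ge0 ltW.
Qed.

Lemma flat_eq0 m t : t <= 0 -> flat m t = 0.
Proof. by rewrite /flat leNgt => /negbTE ->. Qed.

(** With s = 1/t, the exponential dominates s^(m+1) / (m+1)!. The linear bound is what gives the
    derivative at 0. *)
Lemma flat_le m t : flat m t <= m.+1`!%:R * `|t|.
Proof.
rewrite /flat; case: ifPn => [t0|_]; last by rewrite mulr_ge0.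
have := expR_ge1Dxn m (ltW (ltac:(by rewrite invr_gt0) : 0 < t^-1)) => h.
have {}h : t^-1 ^+ m.+1 <= m.+1`!%:R * expR t^-1.
  by rewrite mulrC -ler_pdivrMr ?ltr0n ?fact_gt0//; apply: le_trans h; rewrite lerDr.
rewrite expRN ler_pdivrMr ?expR_gt0// gtr0_norm//.
by move: h; rewrite exprSr ler_pdivrMr// -!mulrA (mulrC t).
Qed.

Lemma flat_is_derive m t : is_derive t 1 (flat m) (flat m.+2 t - m%:R * flat m.+1 t).
Proof.
have [t0|t0|->] := ltgtP t 0.
- rewrite !(flat_eq0 _ (ltW t0)) mulr0 subr0.
  apply: (@near_eq_is_derive _ _ _ (cst 0)).
  by near=> x; rewrite flat_eq0// ltW//; near: x; exact: lt_nbhsl.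
- have tn0 : t != 0 by rewrite gt_eqF.
  apply: (@near_eq_is_derive _ _ _ (fun x : R => x^-1 ^+ m * expR (- x^-1))).
    near=> x; rewrite /flat/= ifT//.
    by near: x; exact: lt_nbhsr.
  have dV : is_derive t 1 (fun x : R => x^-1) (- t ^- 2).
    have := is_deriveV (f := id) tn0 (is_derive_id t 1).
    by rewrite /= => h; apply: is_derive_eq h _; rewrite /GRing.scale/= mulr1.
  have dE : is_derive t 1 (fun x : R => expR (- x^-1)) (t ^- 2 * expR (- t^-1)).
    have h := is_derive1_comp (f := expR) (g := fun x : R => - x^-1) (is_derive_expR (- t^-1)) (is_deriveN dV).
    by apply: is_derive_eq h _; rewrite opprK mulrC.
  rewrite /flat t0.
  case: m => [|m].
    rewrite (_ : (fun _ => _) = (fun x : R => expR (- x^-1))).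
      by apply: is_derive_eq; rewrite mul0r subr0 exprVn.
    by apply/funext => x; rewrite expr0 mul1r.
  have dX : is_derive t 1 (fun x : R => x^-1 ^+ m.+1)
      (m.+1%:R * t^-1 ^+ m * (- t ^- 2)).
    have h := is_deriveX m.+1 dV; rewrite exprfctE in h; exact: h.
  have h := is_deriveM dX dE; apply: is_derive_eq h _.
  rewrite /GRing.scale/= -!exprVn !exprS expr0; ring.
- rewrite !flat_eq0// mulr0 subr0.
  suff lim0 : (fun h : R => h^-1 *: ((flat m \o shift (0 : R)) (h *: (1 : R)) - flat m 0))
      @ 0^' --> (0 : R).
    by apply: DeriveDef; [apply: cvgP lim0|exact: cvg_lim lim0].
  apply/cvgrPdist_le => e e0; near=> h.
  rewrite sub0r normrN /= addr0 /GRing.scale/= mulr1 (flat_eq0 m (lexx 0)) subr0.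
  (* The difference quotient at 0 of one member of the family is the next member, which tends to 0
     by [flat_le]. *)
  have -> : h^-1 * flat m h = flat m.+1 h.
    by rewrite /flat; case: ifP => _; rewrite ?mulr0// mulrA -exprS.
  rewrite ger0_norm ?flat_ge0//; apply: le_trans (flat_le _ _) _.
  rewrite mulrC -ler_pdivlMr ?ltr0n ?fact_gt0//.
  by near: h; apply: dnbhs0_le; rewrite divr_gt0// ltr0n fact_gt0.
Unshelve. all: end_near. Qed.

Lemma continuous_flat m : continuous (flat m).
Proof.
move=> t; apply/differentiable_continuous/derivable1_diffP.
by have [] := flat_is_derive m t.
Qed.

Lemma flat0_gt0 t : 0 < t -> 0 < flat 0 t.
Proof. by move=> t0; rewrite /flat t0 expr0 mul1r expR_gt0. Qed.

Lemma flat0_le1 t : flat 0 t <= 1.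
Proof.
rewrite /flat; case: ifPn => // t0.
by rewrite expr0 mul1r -expR0 ler_expR oppr_le0 invr_ge0 ltW.
Qed.

End flat.

Section smooth_algebra.
Context {R : realType} {n : nat}.
Implicit Types (f g : 'rV[R]_n -> R) (x : 'rV[R]_n) (i : 'I_n).

(** [smooth] quantifies over lists of derivatives, which is awkward for sums and products; recursion
    on the order gives these by induction, and [smoothP] translates back. *)
Fixpoint Ck k f : Prop := continuous f /\
  if k is k'.+1 then forall i, (forall x, derivable f x (delta_mx ord0 i)) /\
    Ck k' (pderiv i f) else True.

Lemma Ck_continuous k f : Ck k f -> continuous f.
Proof. by case: k => [|k] []. Qed.

Lemma Ck_derivable k f i x : Ck k.+1 f -> derivable f x (delta_mx ord0 i).
Proof. by case=> _ /(_ i)[]. Qed.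

Lemma Ck_pderiv k f i : Ck k.+1 f -> Ck k (pderiv i f).
Proof. by case=> _ /(_ i)[]. Qed.

Lemma Ck_continuous_pderiv k f i : Ck k.+1 f -> continuous (pderiv i f).
Proof. by move=> /(Ck_pderiv i)/Ck_continuous. Qed.

Lemma CkW k f : Ck k.+1 f -> Ck k f.
Proof.
elim: k f => [f []//|k IH f [cf df]]; split=> // i; have [dfi Ckf] := df i.
by split=> //; exact: IH.
Qed.

Lemma smooth_pderiv i f : smooth f -> smooth (pderiv i f).
Proof. by move=> sf s; have := sf (rcons s i); rewrite /pderivs foldr_rcons. Qed.

Lemma smoothP f : smooth f <-> forall k, Ck k f.
Proof.
split=> [sf k|Cf s].
  elim: k f sf => [|k IH] f sf; have [cf df] := sf [::]; split=> //= i.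
  by split; [move=> x; exact: df|exact/IH/smooth_pderiv].
suff : Ck 1 (pderivs s f) by move=> Cs; split; [exact: Ck_continuous Cs|move=> i x; exact: Ck_derivable Cs].
move: (Cf (size s + 1)%N); move: {Cf} 1%N.
elim: s f => [//|i s IH] f k; rewrite [size _]/= addSnnS => /IH; exact: Ck_pderiv.
Qed.

Lemma pderivD i f g x : derivable f x (delta_mx ord0 i) ->
  derivable g x (delta_mx ord0 i) ->
  pderiv i (f \+ g) x = pderiv i f x + pderiv i g x.
Proof. exact: deriveD. Qed.

Lemma pderivM i f g x : derivable f x (delta_mx ord0 i) ->
  derivable g x (delta_mx ord0 i) ->
  pderiv i (fun y => f y * g y) x = f x * pderiv i g x + g x * pderiv i f x.
Proof. exact: deriveM. Qed.

Lemma pderiv_cst i (a : R) : pderiv i (cst a) = cst 0.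
Proof. by apply/funext => x; exact: derive_cst. Qed.

Lemma CkD k f g : Ck k f -> Ck k g -> Ck k (f \+ g).
Proof.
elim: k f g => [|k IH] f g [cf df] [cg dg].
  by split=> // x; exact: (cvgD (cf x) (cg x)).
split=> [x|i]; first exact: (cvgD (cf x) (cg x)).
have [dfi Cf] := df i; have [dgi Cg] := dg i; split=> [x|].
  by apply: derivableD; [exact: dfi|exact: dgi].
rewrite (_ : pderiv _ _ = pderiv i f \+ pderiv i g); first exact: IH.
by apply/funext => x; exact: pderivD.
Qed.

Lemma CkM k f g : Ck k f -> Ck k g -> Ck k (fun x => f x * g x).
Proof.
elim: k f g => [|k IH] f g Cf Cg; have [cf df] := Cf; have [cg dg] := Cg.
  by split=> // x; exact: (cvgM (cf x) (cg x)).
split=> [x|i]; first exact: (cvgM (cf x) (cg x)).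
have [dfi Cfi] := df i; have [dgi Cgi] := dg i; split=> [x|].
  by apply: derivableM; [exact: dfi|exact: dgi].
rewrite (_ : pderiv _ _ =
    (fun x => f x * pderiv i g x) \+ (fun x => g x * pderiv i f x)).
  by apply: CkD; apply: IH => //; exact: CkW.
by apply/funext => x; exact: pderivM.
Qed.

Lemma Ck_cst k (a : R) : Ck k (cst a).
Proof.
elim: k a => [|k IH] a; first by split=> //; exact: cst_continuous.
split=> [|i]; first exact: cst_continuous.
by split=> [x|]; [exact: derivable_cst|rewrite pderiv_cst; exact: IH].
Qed.

Lemma Ck_prod k (I : Type) (r : seq I) (F : I -> 'rV[R]_n -> R) :
  (forall j, Ck k (F j)) -> Ck k (fun x => \prod_(j <- r) F j x).
Proof.
move=> CF; elim: r => [|j r IH].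
  rewrite (_ : (fun _ => _) = cst 1); first exact: Ck_cst.
  by apply/funext => x; rewrite big_nil.
rewrite (_ : (fun _ => _) = (fun x => F j x * \prod_(j <- r) F j x)); first exact: CkM.
by apply/funext => x; rewrite big_cons.
Qed.

(** The induction on k has to keep m general, since a derivative of [flat m] involves [flat m.+1]
    and [flat m.+2]. *)
Lemma Ck_flat k m (a c : R) i : Ck k (fun x => flat m (a * x ord0 i + c)).
Proof.
elim: k m => [|k IH] m.
  split=> // x; apply: (@continuous_comp _ _ _ (fun x => a * x ord0 i + c) (flat m)).
    apply: (@continuousD _ _ _ (fun x : 'rV[R]_n => a * x ord0 i) (cst c)); last exact: cst_continuous.
    apply: (@continuousM _ _ (cst a) (fun x : 'rV[R]_n => x ord0 i)); first exact: cst_continuous.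
    exact: coord_continuous.
  exact: continuous_flat.
split=> [|l]; first exact: Ck_continuous (IH m).
have dflat (v t : R) : is_derive t v (flat m) (v * (flat m.+2 t - m%:R * flat m.+1 t)).
  have h := flat_is_derive m t.
  have /derivable1_diffP df : derivable (flat m) t 1 by case: h.
  apply: DeriveDef; first exact: diff_derivable.
  rewrite deriveE// -[v in LHS]mulr1 -/(v *: (1 : R^o)) linearZ/= -deriveE//.
  by have [_ ->] := h.
have line x : forall h, a * (h *: delta_mx ord0 l + x) ord0 i + c =
    h *: (a * (l == i)%:R) + (a * x ord0 i + c) :> R.
  by move=> h; rewrite !mxE eqxx/= eq_sym /GRing.scale/=; ring.
split=> [x|].
  apply/(derivable_line (flat m) (line x)).1.
  by have [] := dflat (a * (l == i)%:R) (a * x ord0 i + c).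
rewrite (_ : pderiv _ _ = (fun x => cst (a * (l == i)%:R) x *
   (flat m.+2 (a * x ord0 i + c) + cst (- m%:R) x * flat m.+1 (a * x ord0 i + c)))).
  by apply: CkM; [exact: Ck_cst|apply: CkD => //; apply: CkM => //; exact: Ck_cst].
apply/funext => x; rewrite /pderiv (derivable_line (flat m) (line x)).2.
by have [_ ->] := dflat (a * (l == i)%:R) (a * x ord0 i + c); rewrite /= mulNr.
Qed.

(** The two factors for coordinate i are both positive exactly when |x_i - c_i| < r; the
    coefficients 1 and -1 put their arguments in the affine form of [Ck_flat]. *)
Definition bump (c : 'rV[R]_n) (r : R) x : R :=
  \prod_(i < n) (flat 0 (1 * x ord0 i + (r - c ord0 i)) *
                 flat 0 (-1 * x ord0 i + (r + c ord0 i))).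

Lemma Ck_bump k c r : Ck k (bump c r).
Proof. by apply: Ck_prod => i; apply: CkM; exact: Ck_flat. Qed.

Lemma bump_ge0 c r x : 0 <= bump c r x.
Proof. by apply: prodr_ge0 => i _; rewrite mulr_ge0// flat_ge0. Qed.

Lemma bump_le1 c r x : bump c r x <= 1.
Proof.
by apply: prodr_ile1 => i _; rewrite mulr_ge0 ?flat_ge0// mulr_ile1// ?flat_ge0 ?flat0_le1.
Qed.

Lemma bump_gt0 c r x : box c r x -> 0 < bump c r x.
Proof.
move=> cx; apply: prodr_gt0 => i _; have := cx i; rewrite ltr_distl => /andP[h1 h2].
by apply: mulr_gt0; apply: flat0_gt0; lra.
Qed.

Lemma bump_eq0 c r x : ~ cbox c r x -> bump c r x = 0.
Proof.
move=> /existsNP[i /negP]; rewrite -ltNge => cx.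
rewrite /bump (bigD1 i)//=.
have [h|h] := leP 0 (x ord0 i - c ord0 i).
  by move: cx; rewrite ger0_norm// => cx; rewrite [flat 0 (-1 * _ + _)]flat_eq0 ?mulr0 ?mul0r//; lra.
by move: cx; rewrite ltr0_norm// => cx; rewrite flat_eq0 ?mul0r//; lra.
Qed.

Lemma smooth_zero_outside K f x i : compact K -> (forall y, ~ K y -> f y = 0) ->
  ~ K x -> pderiv i f x = 0.
Proof.
move=> cK f0 Kx; have oK : open (~` K).
  by apply: closed_openC; exact: compact_closed (@norm_hausdorff _ _) cK.
rewrite /pderiv (@near_eq_derive _ _ _ f (cst 0)) ?derive_cst//.
near=> y; apply: f0; near: y; exact: open_nbhs_nbhs.
Unshelve. all: end_near. Qed.

Variable Omega : set 'rV[R]_n.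

Lemma test_function_pderiv i f : test_function Omega f -> test_function Omega (pderiv i f).
Proof.
move=> [sf [K [cK KO f0]]]; split; first exact: smooth_pderiv.
by exists K; split=> // x; exact: smooth_zero_outside.
Qed.

Lemma test_functionP c f g : test_function Omega f -> test_function Omega g ->
  test_function Omega (c *: f + g).
Proof.
move=> [sf [K [cK KO f0]]] [sg [L [cL LO g0]]]; split.
  apply/smoothP => k; apply: CkD; last exact: (smoothP g).1.
  by apply: (@CkM _ (cst c)); [exact: Ck_cst|exact: (smoothP f).1].
exists (K `|` L); split=> [||x]; first exact: compactU.
  by move=> x [/KO|/LO].
move=> /not_orP[Kx Lx].
by rewrite /= !fctE f0// g0// scaler0 addr0.
Qed.

(** Bounded pointwise approximation is what dominated convergence needs in order to carry
    orthogonality to test functions over to indicators of open sets. *)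
Lemma open_indic_approx U : open U -> exists psi : nat -> 'rV[R]_n -> R,
  [/\ forall N, test_function U (psi N), forall N x, 0 <= psi N x <= 1 &
      forall x, psi ^~ x @ \oo --> (\1_U x : R)].
Proof.
move=> /open_bigcup_box[P [c [r [r0 PU UE]]]].
pose tau k := if `[< P k >] then bump (c k) (r k) else cst 0.
have tau01 k x : 0 <= tau k x <= 1.
  by rewrite /tau; case: ifP => _ /=; rewrite ?bump_ge0 ?bump_le1// lexx ler01.
have tau' k x : 0 <= 1 - tau k x <= 1 by have := tau01 k x; lra.
have pr N x : 0 <= \prod_(k < N) (1 - tau k x) ^+ N <= 1.
  rewrite prodr_ge0 ?prodr_ile1// => k _; have /andP[h1 h2] := tau' k x;
    by rewrite exprn_ge0// exprn_ile1.
(* A product of N-th powers stays smooth, and tends to 0 as soon as one of the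
   bumps is positive at x. *)
exists (fun N x => 1 - \prod_(k < N) (1 - tau k x) ^+ N); split=> [N|N x|x].
- split.
    apply/smoothP => k.
    rewrite (_ : (fun _ => _) = cst 1 \+ (fun x => cst (-1) x *
        \prod_(j < N) \prod_(l < N) (1 + cst (-1) x * tau j x))); last first.
      apply/funext => x /=; rewrite mulN1r; congr (_ - _); apply: eq_bigr => j _.
      by rewrite prodr_const card_ord mulN1r.
    apply: CkD; first exact: Ck_cst.
    apply: CkM; first exact: Ck_cst.
    apply: Ck_prod => j; apply: Ck_prod => l.
    apply: (@CkD _ (cst 1)); first exact: Ck_cst.
    apply: CkM; first exact: Ck_cst.
    by rewrite /tau; case: ifP => _; [exact: Ck_bump|exact: Ck_cst].
  exists (\big[setU/set0]_(k < N) if `[< P k >] then cbox (c k) (r k) else set0); split.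
  + apply: bigsetU_compact => k _; case: ifP => _; first exact: compact_cbox.
    exact: compact0.
  + by rewrite -bigcup_seq => x [k _] /=; case: asboolP => // Pk /PU; exact.
  + move=> x; rewrite -bigcup_seq => xK; rewrite big1 ?subrr// => k _.
    rewrite /tau; case: ifPn => [/asboolP Pk|_]; last by rewrite subr0 expr1n.
    rewrite bump_eq0 ?subr0 ?expr1n// => kx; apply: xK; exists k => /=.
      by rewrite mem_index_enum.
    by rewrite asboolT.
- by have := pr N x; lra.
- rewrite indicE; have [Ux|Ux] := boolP (x \in U); last first.
    rewrite (_ : (fun _ => _) = cst 0); first exact: cvg_cst.
    apply/funext => N /=; rewrite big1 ?subrr// => k _.
    rewrite /tau; case: ifPn => [/asboolP Pk|_]; last by rewrite subr0 expr1n.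
    rewrite bump_eq0 ?subr0 ?expr1n// => /(PU _ Pk) Ux'.
    by rewrite notin_setE in Ux.
  have [k Pk kx] : (\bigcup_(k in P) box (c k) (r k)) x by rewrite -UE -in_setE.
  have tk : 0 < tau k x by rewrite /tau asboolT// bump_gt0.
  have /andP[t0 t1] := tau' k x.
  rewrite -[X in _ --> X]subr0; apply: cvgB; first exact: cvg_cst.
  have lim0 : (fun N => (1 - tau k x) ^+ N) @ \oo --> (0 : R).
    by apply: cvg_expr; rewrite ger0_norm//; lra.
  apply: (squeeze_cvgr _ (cvg_cst 0) lim0).
  exists k.+1 => // N /= kN; have /andP[-> _] /= := pr N x.
  rewrite (bigD1 (Ordinal kN))//= ler_piMr ?exprn_ge0//.
  by apply: prodr_ile1 => j _; have /andP[h1 h2] := tau' j x; rewrite exprn_ge0// exprn_ile1.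
Qed.

End smooth_algebra.

(** * Completeness of L^2 *)

Section L2.
Context {d} {T : measurableType d} {R : realType}.
Variable (mu : {measure set T -> \bar R}) (D : set T).
Hypothesis mD : measurable D.
Implicit Types f g h : T -> R.

(** General in the measure and the set because it is used both on Omega, where it is convertible to
    [in_L2], and on single cells. *)
Definition L2 f := measurable_fun D f /\ (\int[mu]_(x in D) ((f x) ^+ 2)%:E < +oo)%E.

Definition dot f g : R := \int[mu]_(x in D) (f x * g x).

Lemma L2_integrable_sqr f : L2 f -> mu.-integrable D (EFin \o (fun x => f x ^+ 2)).
Proof.
move=> [mf f2]; apply/integrableP; split.
  by apply/measurable_EFinP; exact: measurable_funX.
by under eq_integral do rewrite /= ger0_norm ?sqr_ge0//.
Qed.

Lemma L2_integrable_mul f g : L2 f -> L2 g ->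
  mu.-integrable D (EFin \o (fun x => f x * g x)).
Proof.
move=> Lf Lg; have [mf _] := Lf; have [mg _] := Lg.
apply: (@le_integrable _ _ _ _ _ mD _ (EFin \o (fun x => f x ^+ 2 + g x ^+ 2))).
- by apply/measurable_EFinP; exact: measurable_funM.
- move=> x _ /=; rewrite lee_fin [leRHS]ger0_norm ?addr_ge0 ?sqr_ge0//.
  by rewrite ler_norml; have := sqr_ge0 (f x + g x); have := sqr_ge0 (f x - g x);
    rewrite sqrrB sqrrD; have := sqr_ge0 (f x); have := sqr_ge0 (g x); lra.
- rewrite (_ : _ \o _ = ((EFin \o (fun x => f x ^+ 2)%R) \+ (EFin \o (fun x => g x ^+ 2)%R))%E)//.
  by apply: integrableD => //; exact: L2_integrable_sqr.
Qed.

Lemma L2_linear c f g : L2 f -> L2 g -> L2 (c *: f + g).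
Proof.
move=> Lf Lg; have [mf _] := Lf; have [mg _] := Lg.
have mcf : measurable_fun D (c *: f + g).
  by apply: measurable_funD => //; exact: measurable_funM.
split=> //.
suff : mu.-integrable D (EFin \o (fun x => (c ^+ 2 *+ 2) * (f x * f x) + 2 * (g x * g x))).
  move=> ig; apply: (@integrable_lty _ _ _ mu) => //; apply: (le_integrable mD _ _ ig).
    by apply/measurable_EFinP; exact: measurable_funX.
  move=> x _ /=; rewrite lee_fin -!expr2 !ger0_norm ?sqr_ge0//; last first.
    by apply: addr_ge0; rewrite mulr_ge0 ?mulrn_wge0 ?sqr_ge0.
  rewrite !fctE /GRing.scale/=; have := sqr_ge0 (c * f x - g x).
  by rewrite sqrrB sqrrD exprMn; lra.
rewrite (_ : _ \o _ = ((fun x => (c ^+ 2 *+ 2)%:E * (EFin \o (fun x => f x * f x)%R) x) \+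
    (fun x => 2%:E * (EFin \o (fun x => g x * g x)%R) x))%E)//.
by apply: integrableD => //; apply: integrableZl => //; exact: L2_integrable_mul.
Qed.

Lemma L2_cst0 : L2 (cst 0).
Proof.
split; first exact: measurable_cst.
by rewrite integral0_eq// => x _ /=; rewrite expr0n.
Qed.

Lemma dotC f g : dot f g = dot g f.
Proof. by apply: eq_Rintegral => x _; rewrite mulrC. Qed.

Lemma dot_linear c f g h : L2 f -> L2 g -> L2 h ->
  dot (c *: f + g) h = c * dot f h + dot g h.
Proof.
move=> Lf Lg Lh; rewrite /dot -RintegralZl//; last exact: L2_integrable_mul.
rewrite -RintegralD//; last exact: L2_integrable_mul.
  by apply: eq_Rintegral => x _; rewrite !fctE /GRing.scale/= mulrDl mulrA.
rewrite (_ : _ \o _ = (fun x => c%:E * (EFin \o (fun x => f x * h x)%R) x)%E)//.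
by apply: integrableZl => //; exact: L2_integrable_mul.
Qed.

Lemma dot_ge0 f : 0 <= dot f f.
Proof. by apply: Rintegral_ge0 => x _; rewrite -expr2 sqr_ge0. Qed.

Lemma dotE f : L2 f -> (dot f f)%:E = (\int[mu]_(x in D) ((f x) ^+ 2)%:E)%E.
Proof.
move=> Lf; rewrite /dot /Rintegral.
under eq_integral do rewrite -expr2.
rewrite fineK// ge0_fin_numE; first by case: Lf.
by apply: integral_ge0 => x _; rewrite lee_fin sqr_ge0.
Qed.

Lemma L2_dot_eq0 f : L2 f -> dot f f = 0 -> {ae mu, forall x, D x -> f x = 0}.
Proof.
move=> Lf; have [mf _] := Lf; move=> ff.
have : (\int[mu]_(x in D) `|((f x) ^+ 2)%:E| = 0)%E.
  under eq_integral do rewrite gee0_abs ?lee_fin ?sqr_ge0//.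
  by rewrite -dotE// ff.
move/ae_eq_integral_abs => h.
have : ae_eq mu D (fun x => (f x ^+ 2)%:E) (cst 0%E).
  by apply/h => //; apply/measurable_EFinP; exact: measurable_funX.
apply: filterS => x /= fx Dx; have [] := fx Dx.
by move=> /eqP; rewrite sqrf_eq0 => /eqP.
Qed.

Lemma ae_eq_dot f g h : L2 f -> L2 g -> L2 h ->
  {ae mu, forall x, D x -> f x = g x} -> dot f h = dot g h.
Proof.
move=> [mf _] [mg _] [mh _] fg; rewrite /dot /Rintegral; congr fine.
apply: ae_eq_integral => //; try by apply/measurable_EFinP; exact: measurable_funM.
by apply: filterS fg => x /= fg Dx; rewrite fg.
Qed.

Lemma L2_sub f g : L2 f -> L2 g -> L2 (f - g).
Proof. by move=> Lf Lg; rewrite -[- g]scaleN1r addrC; exact: L2_linear. Qed.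

End L2.

Lemma geometric_cvg (R : realType) (u : nat -> R) (C : R) :
  (forall k, `|u k.+1 - u k| <= C / 2 ^+ k) -> cvgn u.
Proof.
move=> uC.
have C0 : 0 <= C by have := le_trans (normr_ge0 _) (uC 0%N); rewrite expr0 divr1.
suff : cvgn (series (telescope u)).
  rewrite telescopeK => h; rewrite (_ : u = (fun k => (u k - u 0%N) + u 0%N)).
    by apply: is_cvgD => //; exact: is_cvg_cst.
  by apply/funext => k; rewrite subrK.
apply: normed_cvg.
apply: (@series_le_cvg _ _ (geometric C 2^-1)) => [k|k|k|] //=.
- by rewrite mulr_ge0// exprn_ge0.
- by apply: le_trans (uC k) _; rewrite exprVn.
- by apply: is_cvg_geometric_series; rewrite ger0_norm// invf_lt1// ltr1n.
Qed.

Lemma limn_einf_le (R : realType) (u : (\bar R)^nat) (c : \bar R) N :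
  (forall k, (N <= k)%N -> (u k <= c)%E) -> (limn_einf u <= c)%E.
Proof.
move=> uc; rewrite limn_einf_lim; apply: lime_le; first exact: is_cvg_einfs.
exists N => // k /= Nk; apply: le_trans (uc k Nk).
by apply: ereal_inf_lbound; exists k => //=.
Qed.

Section riesz_fischer.
Context {d} {T : measurableType d} {R : realType}.
Variable (mu : {measure set T -> \bar R}) (D : set T).
Hypothesis mD : measurable D.

Local Notation L2 := (L2 mu D).
Local Notation dot := (dot mu D).

(* Where G = sum_k 4^k (g_{k+1} - g_k)^2 is finite, the increments of g_k are
   O(2^-k); G is integrable because its k-th term has integral at most 2^-k. *)
Lemma L2_rapid_cvg (g : nat -> T -> R) : (forall k, L2 (g k)) ->
  (forall k, dot (g k.+1 - g k) (g k.+1 - g k) <= 8^-1 ^+ k) ->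
  exists h f, [/\ forall k, measurable_fun D (h k),
    forall k, {ae mu, forall x, D x -> h k x = g k x} &
    forall x, D x -> (fun k => h k x) @ \oo --> (f x : R)].
Proof.
move=> Lg g8.
have Ldiff k : L2 (g k.+1 - g k) by exact: L2_sub.
have mg k : measurable_fun D (g k) by have [] := Lg k.
pose w k x : \bar R := (4 ^+ k * (g k.+1 x - g k x) ^+ 2)%:E.
have w0 k x : (0 <= w k x)%E by rewrite lee_fin mulr_ge0 ?sqr_ge0// exprn_ge0.
have mw k : measurable_fun D (w k).
  apply/measurable_EFinP; apply: measurable_funM => //.
  by apply: measurable_funX; exact: measurable_funB.
pose G x : \bar R := (\sum_(0 <= k <oo) w k x)%E.
have mG : measurable_fun D G.
  by apply: ge0_emeasurable_sum => // k x _ _.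
have G0 x : (0 <= G x)%E by apply: nneseries_ge0.
have intG : (\int[mu]_(x in D) G x < +oo)%E.
  rewrite integral_nneseries//.
  apply: (@le_lt_trans _ _ (\sum_(0 <= k <oo) (2^-1 ^+ k)%:E)%E).
    apply: lee_nneseries => k; first by move=> _ _; apply: integral_ge0.
    move=> _.
    rewrite (_ : (\int[mu]_(x in D) w k x)%E =
        ((4 ^+ k)%:E * \int[mu]_(x in D) (((g k.+1 - g k) x) ^+ 2)%:E)%E).
      rewrite -(dotE (Ldiff k)) -EFinM; apply: lee_tofin.
      have -> : 2^-1 ^+ k = 4 ^+ k * 8^-1 ^+ k :> R.
        by rewrite -exprMn; congr (_ ^+ _); lra.
      by rewrite ler_wpM2l// exprn_ge0.
    under eq_integral do rewrite /w EFinM.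
    rewrite ge0_integralZl//.
    - by apply/measurable_EFinP; apply: measurable_funX; exact: measurable_funB.
    - by move=> x _; rewrite lee_fin sqr_ge0.
  have cg : cvgn (series (geometric 1 (2^-1 : R))).
    by apply: is_cvg_geometric_series; rewrite ger0_norm// invf_lt1// ltr1n.
  apply: (@le_lt_trans _ _ (limn (series (geometric 1 (2^-1 : R))))%:E); last exact: ltry.
  rewrite -EFin_lim// le_eqVlt; apply/orP; left; apply/eqP; congr (limn _).
  apply/funext => n; rewrite /series/= -sumEFin.
  by apply: eq_bigr => k _; rewrite mul1r.
pose E := [set x | (G x < +oo)%E].
have aeE : {ae mu, forall x, D x -> E x}.
  have iG : mu.-integrable D G.
    apply/integrableP; split=> //.
    by under eq_integral do rewrite gee0_abs//.
  have := integrable_ae mD iG; apply: filterS => x /= h Dx.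
  by have := h Dx; rewrite ge0_fin_numE.
have cvgE x : E x -> cvgn (fun k => g k x).
  move=> Ex.
  have Gfin : G x \is a fin_num by rewrite ge0_fin_numE.
  set C := fine (G x); have C0 : 0 <= C by exact: fine_ge0.
  have wC k : 4 ^+ k * (g k.+1 x - g k x) ^+ 2 <= C.
    rewrite -lee_fin /C fineK//.
    apply: (@le_trans _ _ (\sum_(0 <= i < k.+1) w i x)%E).
      rewrite big_nat_recr//= leeDr//; exact: sume_ge0.
    exact: nneseries_lim_ge.
  (* The bound C + 1 avoids a square root: 4^k times the squared increment is at most C, hence at
     most (C + 1)^2. *)
  apply: (@geometric_cvg _ _ (C + 1)) => k.
  have p2 : 0 < 2 ^+ k :> R by rewrite exprn_gt0.
  rewrite ler_pdivlMr// -(@ler_pXn2r _ 2)// ?nnegrE ?mulr_ge0 ?(ltW p2)//; last lra.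
  rewrite exprMn -normrX ger0_norm ?sqr_ge0// -exprM mulnC exprM.
  rewrite (_ : 2 ^+ 2 = 4 :> R); last by rewrite expr2; lra.
  by have := wC k; have := sqr_ge0 C; rewrite sqrrD1; lra.
(* Cutting to 0 off [E] makes the sequence converge at every point of D, so that the limit is
   measurable; each g k is altered on a null set only. *)
pose f x : R := if `[< E x >] then limn (fun k => g k x) else 0.
pose h k x := if `[< E x >] then g k x else 0.
exists h, f; split=> [k|k|x Dx].
- apply: measurable_fun_if => //.
    apply: (@measurable_fun_bool _ _ _ _ true).
    rewrite (_ : D `&` _ = D `&` E); first exact: emeasurable_fun_infty_o.
    congr (_ `&` _).
    by apply/seteqP; split=> x /=; [move/asboolP|move=> ?; apply/asboolP].
  by apply: measurable_funS (mg k) => // x [].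
- by apply: filterS aeE => x /= DE Dx; rewrite /h asboolT//; exact: DE.
- rewrite /h /f; case: asboolP => Ex; last exact: cvg_cst.
  exact: cvgE.
Qed.

Lemma L2_complete (u : nat -> T -> R) : (forall k, L2 (u k)) ->
  (forall e : R, 0 < e -> exists N, forall k l, (N <= k)%N -> (N <= l)%N ->
    dot (u k - u l) (u k - u l) < e) ->
  exists f, L2 f /\ (fun k => dot (u k - f) (u k - f)) @ \oo --> (0 : R).
Proof.
move=> Lu cu.
have /choice[N NP] k : exists N, forall p q, (N <= p)%N -> (N <= q)%N ->
    dot (u p - u q) (u p - u q) < 8^-1 ^+ k.
  by apply: cu; rewrite exprn_gt0// invr_gt0.
(* The maximum over all i <= k makes M nondecreasing, whence N k <= M k <= M k.+1 and increments
   below 8^-k; the term k ensures that M k tends to infinity. *)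
pose M k := maxn k (\max_(i < k.+1) N i).
have NM k : (N k <= M k)%N by rewrite leq_max (bigD1 ord_max)//= leq_maxl orbT.
have MM k : (M k <= M k.+1)%N.
  rewrite geq_max !leq_max leqnSn/=; apply/orP; right.
  by apply/bigmax_leqP => i _; rewrite (bigD1 (widen_ord (leqnSn _) i))//= leq_maxl.
have [h [f [mh hu hf]]] : exists h f, [/\ forall k, measurable_fun D (h k),
    forall k, {ae mu, forall x, D x -> h k x = u (M k) x} &
    forall x, D x -> (fun k => h k x) @ \oo --> (f x : R)].
  apply: L2_rapid_cvg => // k; apply/ltW/NP => //.
  exact: leq_trans (NM k) (MM k).
have mf : measurable_fun D f by exact: (measurable_fun_cvg mh hf).
have mu_ k : measurable_fun D (u k) by have [] := Lu k.
(* Fatou along the subsequence, applied to the modified functions [h], which converge everywhere on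
   D to f. *)
have key (e : R) p : 0 < e -> (forall q, (p <= q)%N -> dot (u q - u p) (u q - u p) <= e) ->
    (\int[mu]_(x in D) (((f - u p) x) ^+ 2)%:E <= e%:E)%E.
  move=> e0 pe.
  pose w k x := ((h k x - u p x) ^+ 2)%:E.
  have mw k : measurable_fun D (w k).
    by apply/measurable_EFinP; apply: measurable_funX; exact: measurable_funB.
  have w0 k x : D x -> (0 <= w k x)%E by rewrite lee_fin sqr_ge0.
  rewrite (_ : (\int[mu]_(x in D) _)%E = (\int[mu]_(x in D) limn_einf (w^~ x))%E).
    apply: le_trans (fatou mu mD mw w0) _.
    apply: (@limn_einf_le _ _ _ p) => k pk.
    rewrite (_ : (\int[mu]_(x in D) _)%E =
        (\int[mu]_(x in D) (((u (M k) - u p) x) ^+ 2)%:E)%E).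
      rewrite -(dotE (L2_sub mD (Lu _) (Lu _))); apply: lee_tofin; apply: pe.
      by rewrite leq_max pk.
    apply: ae_eq_integral => //.
      by apply/measurable_EFinP; apply: measurable_funX; exact: measurable_funB.
    by apply: filterS (hu k) => x /= hux Dx; rewrite /w hux.
  apply: eq_integral => x; rewrite inE => Dx; apply/esym.
  apply: (cvg_limn_einf_sup _).1; apply: cvg_EFin; first exact: nearW.
  apply: (@cvg_comp _ _ _ (fun k => h k x - u p x) (fun y : R => y ^+ 2)); last exact: exprn_continuous.
  by apply: cvgB; [exact: hf|exact: cvg_cst].
have Lfp (e : R) p : 0 < e -> (forall q, (p <= q)%N -> dot (u q - u p) (u q - u p) <= e) ->
    L2 (f - u p) /\ dot (f - u p) (f - u p) <= e.
  move=> e0 pe; have fp := key e p e0 pe.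
  have Lfp : L2 (f - u p).
    by split; [exact: measurable_funB|apply: le_lt_trans fp _; exact: ltry].
  by split=> //; rewrite -lee_fin dotE.
exists f; split.
  have [p pe] := cu 1 ltr01; have [Lp _] := Lfp 1 p ltr01 (fun q pq => ltW (pe q p pq (leqnn p))).
  have := L2_linear mD 1 Lp (Lu p); rewrite scale1r subrK//.
apply/cvgrPdist_lt => e e0.
have e20 : 0 < e / 2 by rewrite divr_gt0.
have [p pe] := cu _ e20; exists p => // q /= pq.
have [_] := Lfp (e / 2) q e20 (fun r qr => ltW (pe r q (leq_trans pq qr) pq)).
rewrite sub0r normrN ger0_norm ?dot_ge0// => h'.
rewrite (_ : dot _ _ = dot (f - u q) (f - u q)).
  by apply: le_lt_trans h' _; rewrite ltr_pdivrMr// ltr_pMr// ltr1n.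
by apply: eq_Rintegral => x _; rewrite !fctE; ring.
Qed.

End riesz_fischer.

(** * Integration over cubes *)

Section tonelli_on_sets.
Context {d1 d2} {X : measurableType d1} {Y : measurableType d2} {R : realType}.
Variables (m1 : {sigma_finite_measure set X -> \bar R})
  (m2 : {sigma_finite_measure set Y -> \bar R}).
Variables (A : set X) (B : set Y).
Hypotheses (mA : measurable A) (mB : measurable B).
Local Open Scope ereal_scope.

Lemma integral_setX (F : X * Y -> \bar R) : measurable_fun setT F ->
  (forall z, 0 <= F z) ->
  \int[m1 \x m2]_(z in A `*` B) F z = \int[m1]_(x in A) \int[m2]_(y in B) F (x, y).
Proof.
move=> mF F0; rewrite integral_mkcond.
have mAB : measurable (A `*` B) by exact: measurableX.
have mFAB : measurable_fun setT (F \_ (A `*` B)).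
  by apply/(measurable_restrictT _ _).1 => //; exact: measurable_funTS.
have F0' z : 0 <= (F \_ (A `*` B)) z by rewrite patchE; case: ifP.
rewrite (fubini_tonelli1 _ mFAB F0').
rewrite [RHS]integral_mkcond; apply: eq_integral => x _.
rewrite /fubini_F [RHS]patchE; case: ifPn => xA.
  rewrite [RHS]integral_mkcond; apply: eq_integral => y _.
  by rewrite !patchE in_setX xA.
by apply: integral0_eq => y _; rewrite patchE in_setX (negbTE xA).
Qed.

Lemma integral_swap (F : X * Y -> \bar R) : measurable_fun setT F ->
  (forall z, 0 <= F z) ->
  \int[m1]_(x in A) \int[m2]_(y in B) F (x, y) =
  \int[m2]_(y in B) \int[m1]_(x in A) F (x, y).
Proof.
move=> mF F0.
have mAB : measurable (A `*` B) by exact: measurableX.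
have mFAB : measurable_fun setT (F \_ (A `*` B)).
  by apply/(measurable_restrictT _ _).1 => //; exact: measurable_funTS.
have /= := @fubini_tonelli _ _ _ _ _ m1 m2 _ mFAB.
move=> /(_ (ltac:(move=> z; rewrite patchE; case: ifP => //))) E.
transitivity (\int[m1]_x \int[m2]_y (F \_ (A `*` B)) (x, y)).
  rewrite integral_mkcond; apply: eq_integral => x _.
  rewrite patchE; case: ifPn => xA.
    rewrite integral_mkcond; apply: eq_integral => y _.
    by rewrite !patchE in_setX xA.
  by apply/esym/integral0_eq => y _; rewrite patchE in_setX (negbTE xA).
rewrite E [RHS]integral_mkcond; apply: eq_integral => y _.
rewrite [RHS]patchE; case: ifPn => yB.
  rewrite [RHS]integral_mkcond; apply: eq_integral => x _.
  by rewrite !patchE in_setX yB andbT.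
by apply/integral0_eq => x _; rewrite patchE in_setX (negbTE yB) andbF.
Qed.

Lemma measurable_integral_snd (F : X * Y -> \bar R) : measurable_fun setT F ->
  (forall z, 0 <= F z) -> measurable_fun setT (fun x => \int[m2]_(y in B) F (x, y)).
Proof.
move=> mF F0.
have mAB : measurable ([set: X] `*` B) by exact: measurableX.
have mFAB : measurable_fun setT (F \_ (setT `*` B)).
  by apply/(measurable_restrictT _ _).1 => //; exact: measurable_funTS.
have := @measurable_fun_fubini_tonelli_F _ _ _ _ _ m2 _ mFAB.
move=> /(_ (ltac:(move=> z; rewrite patchE; case: ifP => //))).
congr (measurable_fun _ _); apply/funext => x; rewrite /fubini_F.
rewrite [RHS]integral_mkcond; apply: eq_integral => y _.
by rewrite !patchE in_setX in_setT.
Qed.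

End tonelli_on_sets.

Section cells.
Context {R : realType}.
Local Notation leb n := (@lebesgue_rV R n).
Local Notation mu := (@lebesgue_measure R).
Implicit Types h : R.

(** Half-open, so that the cells of a grid are disjoint and still cover. *)
Definition cell n (c : 'rV[R]_n) (h : R) : set 'rV[R]_n :=
  [set v | forall i, `[c ord0 i, c ord0 i + h[%classic (v ord0 i)].

Definition tail_rV n (c : 'rV[R]_n.+1) := (uncons_rV c).2.

Lemma measurable_cell n (c : 'rV[R]_n) h : measurable (cell c h).
Proof.
rewrite (_ : cell c h = \bigcap_(i in [set: 'I_n])
    ((fun v : 'rV[R]_n => v ord0 i) @^-1` `[c ord0 i, c ord0 i + h[%classic)).
  apply: fin_bigcap_measurable => // i _; rewrite -[X in measurable X]setTI.
  by apply: (measurable_coord_rV (T := R)) => //; exact: measurable_itv.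
by apply/seteqP; split=> v cv i; [move=> _; exact: cv|exact: cv].
Qed.

Lemma lebesgue_itvco (a h : R) : 0 <= h -> mu `[a, a + h[%classic = h%:E.
Proof.
move=> h0; rewrite lebesgue_measure_itv/= lte_fin; case: ifPn => [_|].
  by rewrite -EFinB addrAC subrr add0r.
by rewrite ltrDl -leNgt => h0'; congr EFin; apply/le_anti/andP.
Qed.

Lemma lebesgue_cell n (c : 'rV[R]_n) h : 0 <= h -> leb n (cell c h) = (h ^+ n)%:E.
Proof.
move=> h0.
transitivity (\prod_(i < n) mu `[c ord0 i, (c ord0 i + h)%R[%classic)%E.
  by apply: (lebesgue_rV_box (A := fun i => `[c ord0 i, c ord0 i + h[%classic)) => i;
    exact: measurable_itv.
rewrite (eq_bigr (fun=> h%:E)) => [|i _].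
  by rewrite big_const_ord; elim: n {c} => //= m ->; rewrite -EFinM exprS.
exact: lebesgue_itvco.
Qed.

Lemma cell_cons n (c : 'rV[R]_n.+1) h :
  @cons_rV R n @^-1` cell c h =
  `[c ord0 ord0, c ord0 ord0 + h[%classic `*` cell (tail_rV c) h.
Proof.
apply/seteqP; split=> -[x v] /=.
  move=> cx; split; first by have := cx ord0; rewrite mxE unlift_none.
  by move=> i; have := cx (lift ord0 i); rewrite !mxE liftK.
move=> [cx cv] i; rewrite mxE; case: unliftP => [k|] -> //=.
by have := cv k; rewrite /= !mxE.
Qed.

Lemma integral_cell n (c : 'rV[R]_n.+1) h (F : 'rV[R]_n.+1 -> \bar R) :
  measurable_fun setT F -> (forall z, 0 <= F z)%E ->
  (\int[leb n.+1]_(z in cell c h) F z =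
   \int[mu]_(x in `[c ord0 ord0, (c ord0 ord0 + h)%R[)
     \int[leb n]_(v in cell (tail_rV c) h) F (cons_rV (x, v)))%E.
Proof.
move=> mF F0.
transitivity (\int[pushforward (mu \x leb n)%E (@cons_rV R n)]_(z in cell c h) F z)%E => //.
rewrite ge0_integral_pushforward//.
- rewrite cell_cons integral_setX//.
  + exact: measurable_cell.
  + by apply: measurableT_comp => //; exact: measurable_cons_rV.
  + by move=> z; exact: F0.
- exact: measurable_cons_rV.
- exact: measurable_cell.
- exact: measurable_funTS.
Qed.

Lemma derivable_cons_head n (f : 'rV[R]_n.+1 -> R) (v : 'rV[R]_n) x :
  derivable f (cons_rV (x, v)) (delta_mx ord0 ord0) ->
  is_derive x 1 (fun x => f (cons_rV (x, v))) (pderiv ord0 f (cons_rV (x, v))).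
Proof.
move=> df.
have line (h : R) : cons_rV (h *: 1 + x, v) = h *: delta_mx ord0 ord0 + cons_rV (x, v).
  apply/rowP => i; rewrite !mxE/=; case: unliftP => [k|] -> /=.
    by rewrite mulr0 add0r.
  by rewrite mulr1 /GRing.scale/= mulr1.
have [h1 h2] := derivable_line (g := fun x => cons_rV (x, v)) f line.
by apply: DeriveDef; [exact/h1|exact: h2].
Qed.

Lemma cons_tail_line n (v : 'rV[R]_n) x (i : 'I_n) (h : R) :
  cons_rV (x, h *: delta_mx ord0 i + v) =
  h *: delta_mx ord0 (lift ord0 i) + cons_rV (x, v).
Proof.
apply/rowP => k; rewrite !mxE/=; case: unliftP => [l|] -> /=.
  by rewrite !mxE (inj_eq lift_inj).
by rewrite mulr0 add0r.
Qed.

Lemma derivable_cons_tail n (f : 'rV[R]_n.+1 -> R) (v : 'rV[R]_n) x i :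
  derivable f (cons_rV (x, v)) (delta_mx ord0 (lift ord0 i)) ->
  derivable (fun w => f (cons_rV (x, w))) v (delta_mx ord0 i).
Proof.
move=> df.
by apply/(derivable_line (g := fun w => cons_rV (x, w)) f (cons_tail_line v x i)).1.
Qed.

Lemma pderiv_cons_tail n (f : 'rV[R]_n.+1 -> R) x i :
  pderiv i (fun w => f (cons_rV (x, w))) =
  fun v => pderiv (lift ord0 i) f (cons_rV (x, v)).
Proof.
apply/funext => v.
exact: (derivable_line (g := fun w => cons_rV (x, w)) f (cons_tail_line v x i)).2.
Qed.

Lemma continuous_cons_tail n x : continuous (fun w : 'rV[R]_n => cons_rV (x, w)).
Proof.
move=> v A /nbhs_ballP[e /= e0 eA]; apply/nbhs_ballP; exists e => //= w.
rewrite ball_box// => vw; apply: eA; rewrite ball_box// => i.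
rewrite !mxE; case: unliftP => [k|] _ /=; first exact: vw.
by rewrite subrr normr0.
Qed.

Lemma continuous_cons_head n (v : 'rV[R]_n) : continuous (fun x : R => cons_rV (x, v)).
Proof.
move=> x A /nbhs_ballP[e /= e0 eA]; apply/nbhs_ballP; exists e => //= w.
rewrite /ball/= => vw; apply: eA; rewrite ball_box// => i.
rewrite !mxE; case: unliftP => [k|] _ /=; last by rewrite distrC.
by rewrite subrr normr0.
Qed.

Lemma Ck1_cons_tail n (f : 'rV[R]_n.+1 -> R) x : Ck 1 f ->
  Ck 1 (fun w => f (cons_rV (x, w))).
Proof.
move=> Cf; have [cf df] := Cf; split=> [v|i].
  exact: (continuous_comp (@continuous_cons_tail n x v) (cf _)).
split=> [v|]; first by apply: derivable_cons_tail; exact: Ck_derivable Cf.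
split=> //; rewrite pderiv_cons_tail => v.
apply: (continuous_comp (@continuous_cons_tail n x v)).
exact: Ck_continuous_pderiv Cf _.
Qed.

Lemma FTC_itvco (F f : R -> R) (a b : R) : a < b -> continuous f ->
  (forall x : R, is_derive x 1 F (f x)) ->
  (\int[mu]_(x in `[a, b[) (f x)%:E = (F b - F a)%:E)%E.
Proof.
move=> ab cf dF.
have cF : continuous F.
  by move=> x; apply/differentiable_continuous/derivable1_diffP; case: (dF x).
rewrite integral_itv_bndo_bndc; last first.
  by apply/measurable_EFinP/measurable_funTS; exact: continuous_measurable_fun.
rewrite EFinB; apply: continuous_FTC2 => //.
- exact: continuous_subspaceT.
- split=> [x _||]; first by case: (dF x).
  + by apply: cvg_at_right_filter; exact: cF.
  + by apply: cvg_at_left_filter; exact: cF.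
- by move=> x _; rewrite derive1E; case: (dF x).
Qed.

(* Adding the constant C keeps the integrand nonnegative, so that Tonelli
   suffices. *)
Lemma integral_pderiv_cell n (phi : 'rV[R]_n -> R) (c : 'rV[R]_n) (h C : R) (i : 'I_n) :
  0 < h -> Ck 1 phi ->
  (forall v : 'rV[R]_n, (exists k, ~ `]c ord0 k, c ord0 k + h[%classic (v ord0 k)) -> phi v = 0) ->
  (forall v : 'rV[R]_n, 0 <= pderiv i phi v + C) ->
  (\int[leb n]_(v in cell c h) (pderiv i phi v + C)%:E = (C * h ^+ n)%:E)%E.
Proof.
move=> h0; elim: n => [|n IH] in phi c i *; first by case: i.
move=> Cphi phi0 C0; have cphi' k : continuous (pderiv k phi).
  exact: Ck_continuous_pderiv Cphi.
have mphi' k : measurable_fun setT (fun v => (pderiv k phi v + C)%:E).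
  apply/measurable_EFinP; apply: measurable_funD => //.
  exact: continuous_measurable_rV.
rewrite integral_cell//.
case: (unliftP ord0 i) => [k|] ik.
  rewrite (eq_integral (fun=> (C * h ^+ n)%:E)) => [|x _].
    rewrite integral_cst; last exact: measurable_itv.
rewrite [X in (_ * X)%E](lebesgue_itvco _ (ltW h0)) -EFinM.
    by congr EFin; rewrite exprSr; ring.
  have := IH (fun w => phi (cons_rV (x, w))) (tail_rV c) k.
  rewrite pderiv_cons_tail -ik; apply => //; first exact: Ck1_cons_tail.
  move=> v [l vl]; apply: phi0; exists (lift ord0 l).
  by rewrite mxE liftK /=; rewrite /= !mxE in vl.
rewrite ik in C0 *.
(* For the first direction the integrals are exchanged and the fundamental theorem is applied to phi
   + C x along a line; phi vanishes at both ends because the hypothesis covers the faces of the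
   cube. *)
transitivity (\int[leb n]_(v in cell (tail_rV c) h)
    \int[mu]_(x in `[c ord0 ord0, (c ord0 ord0 + h)%R[)
      (pderiv ord0 phi (cons_rV (x, v)) + C)%:E)%E.
  apply: (@integral_swap _ _ _ _ _ mu (leb n) _ _ _ _
    (fun z => (pderiv ord0 phi (cons_rV z) + C)%:E)) => [|||z].
  - exact: measurable_itv.
  - exact: measurable_cell.
  - apply: (@measurableT_comp _ _ _ _ _ _ (fun v => (pderiv ord0 phi v + C)%:E)) => //.
    exact: measurable_cons_rV.
  - by rewrite lee_fin.
rewrite (eq_integral (fun=> (C * h)%:E)) => [|v _].
  rewrite integral_cst; last exact: measurable_cell.
  by rewrite [X in (_ * X)%E](lebesgue_cell _ (ltW h0)) -EFinM exprS mulrA.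
have dF (x : R) : is_derive x 1 (fun x => phi (cons_rV (x, v)) + C * x)
    (pderiv ord0 phi (cons_rV (x, v)) + C).
  apply: is_deriveD.
    by apply: derivable_cons_head; exact: Ck_derivable Cphi.
  by apply: is_derive_eq; rewrite /GRing.scale/= mulr1.
rewrite (FTC_itvco _ _ dF).
- rewrite !phi0; first by congr EFin; ring.
    by exists ord0; rewrite mxE unlift_none /= in_itv/= ltxx.
  by exists ord0; rewrite mxE unlift_none /= in_itv/= ltxx andbF.
- by rewrite ltrDl.
- move=> x; have cpx := continuous_comp (@continuous_cons_head n v x) (cphi' ord0 _).
  by apply: (@continuousD _ _ _ _ (cst C) x cpx); exact: cst_continuous.
Qed.

End cells.

(** * Poincare inequality on a cube *)

Section cell_poincare.
Context {R : realType}.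
Local Notation leb n := (@lebesgue_rV R n).
Local Notation mu := (@lebesgue_measure R).

(** The integral is taken over the whole side of the cube so that the bound depends on neither point
    and can be integrated in both. *)
Lemma sqr_increment_le (F f : R -> R) (a h x y : R) : continuous f ->
  (forall t : R, is_derive t 1 F (f t)) ->
  `[a, a + h[%classic x -> `[a, a + h[%classic y ->
  (((F x - F y) ^+ 2)%:E <= h%:E * \int[mu]_(t in `[a, (a + h)%R[) ((f t) ^+ 2)%:E)%E.
Proof.
move=> cf dF.
wlog yx : x y / y <= x.
  move=> wl Ix Iy; have [/wl|/ltW/wl] := leP y x; first exact.
  by rewrite -sqrrN opprB; exact.
rewrite /= !in_itv/= => /andP[ax xa] /andP[ay ya].
have h0 : 0 < h by lra.
have I0 : (0 <= \int[mu]_(t in `[a, (a + h)%R[) ((f t) ^+ 2)%:E)%E.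
  by apply: integral_ge0 => t _; rewrite lee_fin sqr_ge0.
have cf2 : continuous (fun t => f t ^+ 2).
  by move=> t; apply: (@continuous_comp _ _ _ f (fun y => y ^+ 2) t (cf t)); exact: exprn_continuous.
have mf2 : measurable_fun setT (fun t => ((f t) ^+ 2)%:E).
  by apply/measurable_EFinP; exact: continuous_measurable_fun.
move: yx; rewrite le_eqVlt => /predU1P[->|yx].
  by rewrite subrr expr0n /=; apply: mule_ge0 => //; rewrite lee_fin ltW.
(* f^2 >= 2 c f - c^2, integrated with c the mean slope. *)
have [c cE] : exists c, c = (F x - F y) / (x - y) by eexists.
have sub : (\int[mu]_(t in `[y, x[) ((f t) ^+ 2)%:E <=
    \int[mu]_(t in `[a, (a + h)%R[) ((f t) ^+ 2)%:E)%E.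
  apply: ge0_subset_integral => //.
  - exact: measurable_funTS.
  - by move=> t _; rewrite lee_fin sqr_ge0.
  - by move=> t; rewrite /= !in_itv/= => /andP[yt tx]; rewrite (le_trans ay)//= (lt_trans tx).
have ci (g : R -> R) : continuous g -> mu.-integrable `[y, x[ (EFin \o g).
  move=> cg.
  have ig : mu.-integrable `[y, x] (EFin \o g).
    by apply: continuous_compact_integrable; [exact: segment_compact|exact: continuous_subspaceT].
  apply: (integrableS _ _ _ ig); [exact: measurable_itv|exact: measurable_itv|].
  by move=> t; rewrite /= !in_itv/= => /andP[-> /ltW].
have cl : continuous (fun t => 2 * c * f t - c ^+ 2).
  move=> t; apply: (@continuousB _ _ _ (fun t => 2 * c * f t) (cst (c ^+ 2))).
    by apply: (@continuousM _ _ (cst (2 * c)) f); [exact: cst_continuous|exact: cf].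
  exact: cst_continuous.
have low : (\int[mu]_(t in `[y, x[) (2 * c * f t - c ^+ 2)%:E <=
    \int[mu]_(t in `[y, x[) ((f t) ^+ 2)%:E)%E.
  apply: le_integral => //; [exact: ci|exact: ci|] => t _.
  rewrite lee_fin -subr_ge0 (_ : _ - _ = (f t - c) ^+ 2) ?sqr_ge0//; ring.
have dL (t : R) : is_derive t 1 (fun t => 2 * c * F t - c ^+ 2 * t) (2 * c * f t - c ^+ 2).
  have h1 : is_derive t 1 (fun t => 2 * c * F t) (2 * c * f t).
    have := dF t => dFt; apply: is_derive_eq (is_deriveZ (2 * c) dFt) _ => //.
  have h2 : is_derive t 1 (fun t => c ^+ 2 * t) (c ^+ 2).
    apply: is_derive_eq (is_deriveZ (c ^+ 2) (is_derive_id t (1 : R))) _.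
    by rewrite /GRing.scale/= mulr1.
  exact: is_deriveB.
have := le_trans low sub; rewrite (FTC_itvco yx cl dL).
move=> /(lee_wpmul2l (ltac:(by rewrite lee_fin ltW) : (0 <= h%:E)%E)).
apply: le_trans; rewrite -EFinM lee_fin.
have xy : 0 < x - y by lra.
rewrite [X in _ <= h * X](_ : _ = (F x - F y) ^+ 2 / (x - y)); last first.
  by rewrite cE; field; rewrite gt_eqF.
rewrite mulrA ler_pdivlMr// mulrC ler_wpM2r ?sqr_ge0//; lra.
Qed.

Definition grad2 n (phi : 'rV[R]_n -> R) v := \sum_i (pderiv i phi v) ^+ 2.

Lemma measurable_cons_comp n (f : 'rV[R]_n.+1 -> R) : continuous f ->
  measurable_fun setT (fun z : (measurableTypeR R * 'rV[R]_n)%type => f (cons_rV z)).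
Proof.
move=> cf; apply: (@measurableT_comp _ _ _ _ _ _ f); first exact: continuous_measurable_rV.
exact: measurable_cons_rV.
Qed.

Lemma measurable_sqr_diff d (T : measurableType d) (f g : T -> R) :
  measurable_fun setT f -> measurable_fun setT g ->
  measurable_fun setT (fun z => ((f z - g z) ^+ 2)%:E).
Proof.
by move=> mf mg; apply/measurable_EFinP; apply: measurable_funX; exact: measurable_funB.
Qed.

(* phi(x,v) - phi(y,w) is split at phi(y,v): the first increment is controlled by
   one-dimensional integrals, the second one by induction on the dimension. *)
Lemma cell_poincare n : exists2 K : R, 0 <= K &
  forall (phi : 'rV[R]_n -> R) c h, 0 < h -> Ck 1 phi ->
  (\int[leb n]_(v in cell c h) \int[leb n]_(w in cell c h) ((phi v - phi w) ^+ 2)%:E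
   <= (K * h ^+ 2 * h ^+ n)%:E * \int[leb n]_(v in cell c h) (grad2 phi v)%:E)%E.
Proof.
elim: n => [|n [K K0 IH]].
  exists 0 => // phi c h h0 _; rewrite !mul0r mul0e.
  rewrite integral0_eq// => v _; rewrite integral0_eq// => w _.
  by rewrite (_ : v = w) ?subrr ?expr0n//; apply/rowP => -[].
(* From (p + q)^2 <= 2 p^2 + 2 q^2: the first coordinate contributes 2, and the constant of
   dimension n is doubled. *)
exists (2 + 2 * K) => [|phi c h h0 Cphi]; first by rewrite addr_ge0// mulr_ge0.
set I := `[c ord0 ord0, (c ord0 ord0 + h)%R[%classic; set Q := cell (tail_rV c) h.
have mI : measurable I by exact: measurable_itv.
have mQ : measurable Q by exact: measurable_cell.
have mC : measurable (cell c h) by exact: measurable_cell.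
have h0' : (0 <= h%:E)%E by rewrite lee_fin ltW.
have cphi := Ck_continuous Cphi.
have mphi : measurable_fun setT phi by exact: continuous_measurable_rV.
have mphic := measurable_cons_comp cphi.
have cd k : continuous (pderiv k phi) by exact: Ck_continuous_pderiv Cphi.
(* S is the energy of the first derivative along the line over v; T compares points having the same
   first coordinate, which is the n-dimensional situation. *)
pose S v : \bar R := (\int[mu]_(t in I) ((pderiv ord0 phi (cons_rV (t, v))) ^+ 2)%:E)%E.
pose T v : \bar R := (\int[leb n.+1]_(z in cell c h)
  ((phi (cons_rV (z ord0 ord0, v)) - phi z) ^+ 2)%:E)%E.
have S0 v : (0 <= S v)%E by apply: integral_ge0 => t _; rewrite lee_fin sqr_ge0.
have T0 v : (0 <= T v)%E by apply: integral_ge0 => t _; rewrite lee_fin sqr_ge0.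
have mcons1 (f : 'rV[R]_n.+1 -> R) : continuous f ->
    measurable_fun setT (fun z : ('rV[R]_n * measurableTypeR R)%type => f (cons_rV (z.2, z.1))).
  move=> cf; apply: (measurableT_comp (measurable_cons_comp cf)).
  by apply/measurable_fun_pairP; split; [exact: measurable_snd|exact: measurable_fst].
have mS : measurable_fun setT S.
  apply: (@measurable_integral_snd _ _ _ (measurableTypeR R) _ mu _ mI
    (fun z => ((pderiv ord0 phi (cons_rV (z.2, z.1))) ^+ 2)%:E)) => [|z].
    by apply/measurable_EFinP; apply: measurable_funX; exact: mcons1.
  by rewrite lee_fin sqr_ge0.
have mT : measurable_fun setT T.
  apply: (@measurable_integral_snd _ _ _ _ _ (leb n.+1) _ mC
    (fun z : ('rV[R]_n * 'rV[R]_n.+1)%type =>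
      ((phi (cons_rV (z.2 ord0 ord0, z.1)) - phi z.2) ^+ 2)%:E)) => [|z].
    apply: measurable_sqr_diff; last exact: (measurableT_comp mphi measurable_snd).
    apply: (measurableT_comp mphic).
    apply/measurable_fun_pairP; split; last exact: measurable_fst.
    exact: (measurableT_comp (measurable_coord_rV (T := R) ord0) measurable_snd).
  by rewrite lee_fin sqr_ge0.
have inner x v : I x -> (\int[leb n.+1]_(z in cell c h) ((phi (cons_rV (x, v)) - phi z) ^+ 2)%:E
    <= (2 * h * h ^+ n.+1)%:E * S v + 2%:E * T v)%E.
  move=> Ix.
  have m2 : measurable_fun setT (fun z : 'rV[R]_n.+1 =>
      ((phi (cons_rV (z ord0 ord0, v)) - phi z) ^+ 2)%:E).
    apply: measurable_sqr_diff => //; apply: (measurableT_comp mphic).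
    apply/measurable_fun_pairP; split; last exact: measurable_cst.
    exact: measurable_coord_rV.
  apply: (@le_trans _ _ (\int[leb n.+1]_(z in cell c h) ((2 * h)%:E * S v +
      2%:E * ((phi (cons_rV (z ord0 ord0, v)) - phi z) ^+ 2)%:E))%E).
    apply: ge0_le_integral => //.
    - by move=> z _; rewrite lee_fin sqr_ge0.
    - by apply: measurable_funTS; apply: measurable_sqr_diff => //; exact: measurable_cst.
    - apply: measurable_funTS; apply: emeasurable_funD; first exact: measurable_cst.
      exact: measurable_funeM.
    move=> z cz; have Iz : I (z ord0 ord0) by have := cz ord0.
    have dphi (t : R) : is_derive t 1 (fun t => phi (cons_rV (t, v)))
        (pderiv ord0 phi (cons_rV (t, v))).
      by apply: derivable_cons_head; exact: Ck_derivable Cphi.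
    have cdphi : continuous (fun t => pderiv ord0 phi (cons_rV (t, v))).
      by move=> t; apply: (continuous_comp (@continuous_cons_head R n v t)); exact: cd.
    have h1 := sqr_increment_le cdphi dphi Ix Iz.
    set p := phi (cons_rV (x, v)) in h1 *; set q := phi (cons_rV (z ord0 ord0, v)) in h1 *.
    apply: (@le_trans _ _ (2%:E * ((p - q) ^+ 2)%:E + 2%:E * ((q - phi z) ^+ 2)%:E)%E).
      rewrite -!EFinM -EFinD lee_fin -subr_ge0.
      rewrite (_ : _ - _ = (p - q - (q - phi z)) ^+ 2) ?sqr_ge0//; ring.
    by rewrite leeD2r// [(2 * h)%:E]EFinM -muleA lee_wpmul2l// lee_fin.
  rewrite ge0_integralD//.
  - rewrite integral_cst// ge0_integralZl//.
    + rewrite leeD2r//.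
      rewrite [X in (_ * X)%E](lebesgue_cell _ (ltW h0)) -muleA.
      by rewrite [X in (_ * X <= _)%E]muleC muleA -EFinM.
    + exact: measurable_funTS.
    + by move=> z _; rewrite lee_fin sqr_ge0.
  - by move=> z _; rewrite mule_ge0// lee_fin mulr_ge0// ltW.
  - by move=> z _; rewrite mule_ge0// lee_fin sqr_ge0.
  - by apply: measurable_funeM; exact: measurable_funTS.
have mg : measurable_fun setT (fun v => (grad2 phi v)%:E).
  apply/measurable_EFinP; apply: measurable_sum => k.
  by apply: measurable_funX; exact: continuous_measurable_rV.
have g0 v : (0 <= (grad2 phi v)%:E)%E.
  by rewrite lee_fin; apply: sumr_ge0 => k _; exact: sqr_ge0.
have intS : (\int[leb n]_(v in Q) S v <= \int[leb n.+1]_(v in cell c h) (grad2 phi v)%:E)%E.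
  rewrite /S -(@integral_swap _ _ _ _ _ mu (leb n) _ _ mI mQ
    (fun z => ((pderiv ord0 phi (cons_rV z)) ^+ 2)%:E)).
  - rewrite -(integral_cell c h (F := fun z => ((pderiv ord0 phi z) ^+ 2)%:E)).
    + apply: ge0_le_integral => //.
      * by move=> z _; rewrite lee_fin sqr_ge0.
      * apply: measurable_funTS; apply/measurable_EFinP; apply: measurable_funX.
        exact: continuous_measurable_rV.
      * exact: measurable_funTS.
      * move=> v _; rewrite lee_fin /grad2 big_ord_recl lerDl.
        by apply: sumr_ge0 => k _; exact: sqr_ge0.
    + apply/measurable_EFinP; apply: measurable_funX.
      exact: continuous_measurable_rV.
    + by move=> z; rewrite lee_fin sqr_ge0.
  - by apply/measurable_EFinP; apply: measurable_funX; exact: measurable_cons_comp.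
  - by move=> z; rewrite lee_fin sqr_ge0.
have intT : (\int[leb n]_(v in Q) T v <=
    (K * h ^+ 2 * h ^+ n)%:E * \int[leb n.+1]_(v in cell c h) (grad2 phi v)%:E)%E.
  have mT3 : measurable_fun setT
      (fun z : ((measurableTypeR R * 'rV[R]_n) * 'rV[R]_n)%type =>
        ((phi (cons_rV z.1) - phi (cons_rV (z.1.1, z.2))) ^+ 2)%:E).
    apply: measurable_sqr_diff; first exact: (measurableT_comp mphic measurable_fst).
    apply: (measurableT_comp mphic).
    apply/measurable_fun_pairP; split; last exact: measurable_snd.
    exact: (measurableT_comp measurable_fst measurable_fst).
  pose F (z : (measurableTypeR R * 'rV[R]_n)%type) :=
    (\int[leb n]_(w in Q) ((phi (cons_rV z) - phi (cons_rV (z.1, w))) ^+ 2)%:E)%E.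
  have mF : measurable_fun setT F.
    apply: (@measurable_integral_snd _ _ _ _ _ (leb n) _ mQ
      (fun z => ((phi (cons_rV z.1) - phi (cons_rV (z.1.1, z.2))) ^+ 2)%:E)) => // z.
    by rewrite lee_fin sqr_ge0.
  have F0 z : (0 <= F z)%E by apply: integral_ge0 => w _; rewrite lee_fin sqr_ge0.
  have TF v : T v = (\int[mu]_(y in I) F (y, v))%E.
    have mH : measurable_fun setT (fun z : 'rV[R]_n.+1 =>
        ((phi (cons_rV (z ord0 ord0, v)) - phi z) ^+ 2)%:E).
      apply: measurable_sqr_diff => //; apply: (measurableT_comp mphic).
      apply/measurable_fun_pairP; split; last exact: measurable_cst.
      exact: measurable_coord_rV.
    have H0 (z : 'rV[R]_n.+1) : (0 <= ((phi (cons_rV (z ord0 ord0, v)) - phi z) ^+ 2)%:E)%E.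
      by rewrite lee_fin sqr_ge0.
    rewrite /T (integral_cell c h mH H0).
    apply: eq_integral => y _; apply: eq_integral => w _.
    by rewrite /= mxE unlift_none.
  rewrite (eq_integral (fun v => \int[mu]_(y in I) F (y, v))%E) => [|v _]; last exact: TF.
  rewrite -(@integral_swap _ _ _ _ _ mu (leb n) _ _ mI mQ F)//.
  pose Gt y := (\int[leb n]_(v in Q) (grad2 (fun w => phi (cons_rV (y, w))) v)%:E)%E.
  have cK : (0 <= (K * h ^+ 2 * h ^+ n)%:E)%E.
    by rewrite lee_fin !mulr_ge0// exprn_ge0// ltW.
  have gt_le y v : grad2 (fun w => phi (cons_rV (y, w))) v <= grad2 phi (cons_rV (y, v)).
    rewrite /grad2 [leRHS]big_ord_recl.
    rewrite (eq_bigr (fun k => pderiv (lift ord0 k) phi (cons_rV (y, v)) ^+ 2)) => [|k _].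
      by rewrite lerDr sqr_ge0.
    by rewrite pderiv_cons_tail.
  have mgc : measurable_fun setT
      (fun z : (measurableTypeR R * 'rV[R]_n)%type => (grad2 phi (cons_rV z))%:E).
    by apply: (measurableT_comp mg); exact: measurable_cons_rV.
  have mgQ : measurable_fun setT
      (fun y : measurableTypeR R => \int[leb n]_(v in Q) (grad2 phi (cons_rV (y, v)))%:E)%E.
    exact: (@measurable_integral_snd _ _ _ _ _ (leb n) _ mQ (fun z => (grad2 phi (cons_rV z))%:E)).
  apply: (@le_trans _ _ (\int[mu]_(y in I) ((K * h ^+ 2 * h ^+ n)%:E *
      \int[leb n]_(v in Q) (grad2 phi (cons_rV (y, v)))%:E))%E).
    apply: ge0_le_integral => //.
    - by move=> y _; apply: integral_ge0.
    - apply: measurable_funTS.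
      exact: (@measurable_integral_snd _ _ _ _ _ (leb n) _ mQ F).
    - by apply: measurable_funTS; apply: measurable_funeM.
    - move=> y _; apply: le_trans (IH _ _ _ h0 (Ck1_cons_tail y Cphi)) _.
      apply: lee_wpmul2l => //; apply: ge0_le_integral => //.
      + by move=> v _; rewrite lee_fin; apply: sumr_ge0 => k _; exact: sqr_ge0.
      + apply: measurable_funTS; apply/measurable_EFinP; apply: measurable_sum => k.
        apply: measurable_funX; apply: continuous_measurable_rV.
        exact: Ck_continuous_pderiv (Ck1_cons_tail y Cphi).
      + apply: measurable_funTS.
        apply: (measurableT_comp mgc); apply/measurable_fun_pairP; split.
          exact: measurable_cst.
        exact: measurable_id.
      + by move=> v _; rewrite lee_fin.
  rewrite ge0_integralZl//.
  - by rewrite lee_wpmul2l// integral_cell.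
  - exact: measurable_funTS.
  - by move=> y _; apply: integral_ge0.
pose E z : \bar R := (\int[leb n.+1]_(w in cell c h) ((phi z - phi w) ^+ 2)%:E)%E.
have E0 z : (0 <= E z)%E by apply: integral_ge0 => w _; rewrite lee_fin sqr_ge0.
have mE : measurable_fun setT E.
  apply: (@measurable_integral_snd _ _ _ _ _ (leb n.+1) _ mC
    (fun z : ('rV[R]_n.+1 * 'rV[R]_n.+1)%type => ((phi z.1 - phi z.2) ^+ 2)%:E)) => [|z].
    apply: measurable_sqr_diff; first exact: (measurableT_comp mphi measurable_fst).
    exact: (measurableT_comp mphi measurable_snd).
  by rewrite lee_fin sqr_ge0.
rewrite -/E (integral_cell c h mE E0).
set G := (\int[leb n.+1]_(v in cell c h) (grad2 phi v)%:E)%E in intS intT *.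
have hh : 0 <= 2 * h * h ^+ n.+1 by rewrite !mulr_ge0 ?exprn_ge0// ltW.
have slice x : I x -> (\int[leb n]_(v in Q) E (cons_rV (x, v)) <=
    ((2 + 2 * K) * h * h ^+ n.+1)%:E * G)%E.
  move=> Ix; apply: (@le_trans _ _ (\int[leb n]_(v in Q)
    ((2 * h * h ^+ n.+1)%:E * S v + 2%:E * T v))%E).
    apply: ge0_le_integral => //.
    - apply: measurable_funTS; apply: (measurableT_comp mE).
      apply: (measurableT_comp (@measurable_cons_rV R n)).
      apply/measurable_fun_pairP; split; [exact: measurable_cst|exact: measurable_id].
    - by apply: measurable_funTS; apply: emeasurable_funD; exact: measurable_funeM.
    - by move=> v _; exact: inner.
  rewrite ge0_integralD//.
  - rewrite !ge0_integralZl//; try exact: measurable_funTS.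
    apply: le_trans (leeD (lee_wpmul2l _ intS) (lee_wpmul2l _ intT)) _ => //.
    rewrite [(2%:E * _)%E]muleA -EFinM -ge0_muleDl ?lee_fin//.
      rewrite -EFinD le_eqVlt; apply/orP; left; apply/eqP; congr (_%:E * _)%E.
      by rewrite exprS; ring.
    by rewrite !mulr_ge0 ?exprn_ge0// ltW.
  - by move=> v _; rewrite mule_ge0// lee_fin.
  - by apply: measurable_funTS; exact: measurable_funeM.
  - by move=> v _; rewrite mule_ge0.
  - by apply: measurable_funTS; exact: measurable_funeM.
apply: (@le_trans _ _ (\int[mu]_(x in I) (cst (((2 + 2 * K) * h * h ^+ n.+1)%:E * G) x))%E).
  apply: ge0_le_integral => //.
  - by move=> x _; apply: integral_ge0.
  - apply: measurable_funTS.
    apply: (@measurable_integral_snd _ _ _ _ _ (leb n) _ mQ (fun z => E (cons_rV z))) => //.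
    by apply: (measurableT_comp mE); exact: measurable_cons_rV.
rewrite integral_cst// [X in (_ * X)%E](lebesgue_itvco _ (ltW h0)).
rewrite muleC muleA -EFinM le_eqVlt; apply/orP; left; apply/eqP; congr (_%:E * _)%E.
by ring.
Qed.

End cell_poincare.

(** * Test functions: integration by parts, compactness, density *)

Lemma bounded_L2 d (T : measurableType d) (R : realType) (mu : {measure set T -> \bar R})
    (D : set T) (f : T -> R) (B : R) : measurable D -> (mu D < +oo)%E ->
  measurable_fun D f -> (forall x, D x -> `|f x| <= B) -> L2 mu D f.
Proof.
move=> mD Doo mf fB; split=> //.
apply: (@le_lt_trans _ _ (\int[mu]_(x in D) (cst (B ^+ 2)%:E x))%E).
  apply: ge0_le_integral => //.
  - by move=> x _; rewrite lee_fin sqr_ge0.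
  - by apply/measurable_EFinP; exact: measurable_funX.
  - move=> x Dx; rewrite lee_fin -real_normK ?num_real//.
    by rewrite lerXn2r ?nnegrE ?fB// (le_trans _ (fB x Dx)).
by rewrite integral_cst// lte_mul_pinfty// ?lee_fin ?sqr_ge0.
Qed.

Section test_functions.
Context {R : realType} {n : nat}.
Variable Omega : set 'rV[R]_n.
Hypotheses (oO : open Omega) (bO : bounded_set Omega).
Local Notation leb := (@lebesgue_rV R n).

Lemma bounded_box : exists2 M : R, 0 < M & Omega `<=` box 0 M.
Proof.
have [M M0 OM] := ex_strict_bound_gt0 bO; exists M => // x Ox.
have := OM x Ox; rewrite /= -ball_box// -ball_normE /=.
by rewrite sub0r normrN.
Qed.

Lemma Omega_measurable : measurable Omega.
Proof. exact: open_measurable_rV. Qed.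

Lemma box_cell (M : R) : 0 < M -> box (0 : 'rV[R]_n) M `<=` cell (const_mx (- M)) (2 * M).
Proof.
move=> M0 v vM i; have := vM i; rewrite /= !mxE subr0 in_itv/= ltr_norml => /andP[h1 h2].
by apply/andP; split; lra.
Qed.

Lemma Omega_finite : (leb Omega < +oo)%E.
Proof.
have [M M0 OM] := bounded_box.
apply: (@le_lt_trans _ _ (leb (cell (const_mx (- M)) (2 * M)))).
  apply: le_measure; rewrite ?inE.
  - exact: Omega_measurable.
  - exact: measurable_cell.
  - exact: subset_trans OM (box_cell M0).
by rewrite [X in (X < _)%E]lebesgue_cell ?ltry// mulr_ge0// ltW.
Qed.

Lemma test_continuous phi : test_function Omega phi -> continuous phi.
Proof. by move=> [/(_ [::])[]]. Qed.

Lemma test_Ck k phi : test_function Omega phi -> Ck k phi.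
Proof. by move=> [/smoothP]. Qed.

Lemma test_outside phi x : test_function Omega phi -> ~ Omega x -> phi x = 0.
Proof. by move=> [_ [K [_ KO phi0]]] Ox; apply: phi0 => /KO. Qed.

Lemma test_bounded phi : test_function Omega phi -> exists2 B : R, 0 <= B & forall x, `|phi x| <= B.
Proof.
move=> tphi; have [_ [K [cK KO phi0]]] := tphi.
have cphi := test_continuous tphi.
have /compact_bounded bK : compact (phi @` K).
  by apply: continuous_compact => //; exact: continuous_subspaceT.
have [B B0 phiB] := ex_strict_bound_gt0 bK.
exists B; first exact: ltW.
move=> x; have [Kx|/phi0 ->] := pselect (K x); last by rewrite normr0 ltW.
by apply/ltW/phiB; exists x.
Qed.

Lemma test_measurable phi D : test_function Omega phi -> measurable_fun D phi.
Proof.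
by move=> /test_continuous/continuous_measurable_rV; exact: measurable_funTS.
Qed.

Lemma test_L2 phi (D : set 'rV[R]_n) : measurable D -> (leb D < +oo)%E ->
  test_function Omega phi -> L2 leb D phi.
Proof.
move=> mD Doo tphi; have [B B0 phiB] := test_bounded tphi.
by apply: bounded_L2 Doo _ (fun x _ => phiB x) => //; exact: test_measurable.
Qed.

Lemma test_in_L2 phi : test_function Omega phi -> in_L2 Omega phi.
Proof. exact: (test_L2 Omega_measurable Omega_finite). Qed.

Lemma integral_outside (D : set 'rV[R]_n) (f : 'rV[R]_n -> \bar R) :
  Omega `<=` D -> (forall x, ~ Omega x -> f x = 0%E) ->
  (\int[leb]_(x in Omega) f x = \int[leb]_(x in D) f x)%E.
Proof.
move=> OD f0; rewrite integral_mkcond [RHS]integral_mkcond; congr (integral _ _ _).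
apply/funext => x; rewrite !patchE.
case: ifPn => [/set_mem Ox|/negP Ox]; first by rewrite mem_set//; exact: OD.
by case: ifP => // _; rewrite f0// => Ox'; apply: Ox; exact: mem_set.
Qed.

(** The product of the two functions vanishes outside an open box, so the integral of its derivative
    over the cube is 0; the Leibniz rule splits this integral, and both parts live on Omega. *)
Lemma test_integration_by_parts phi psi i :
  test_function Omega phi -> test_function Omega psi ->
  dotL2 Omega phi (pderiv i psi) = - dotL2 Omega (pderiv i phi) psi.
Proof.
move=> tphi tpsi; have [M M0 OM] := bounded_box.
have tdphi := test_function_pderiv i tphi; have tdpsi := test_function_pderiv i tpsi.
pose Q : set 'rV[R]_n := cell (const_mx (- M)) (2 * M); have OQ : Omega `<=` Q.
  exact: subset_trans OM (box_cell M0).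
have h0 : 0 < 2 * M by rewrite mulr_gt0.
have mQ : measurable Q by exact: measurable_cell.
have lQ : leb Q = ((2 * M) ^+ n)%:E by apply: lebesgue_cell; exact: ltW.
have Qoo : (leb Q < +oo)%E by rewrite lQ ltry.
pose g x := phi x * psi x.
have Cg : Ck 1 g by apply: CkM; exact: test_Ck.
have dg x : pderiv i g x = phi x * pderiv i psi x + psi x * pderiv i phi x.
  by rewrite pderivM//; [exact: Ck_derivable (test_Ck 1 tphi)|exact: Ck_derivable (test_Ck 1 tpsi)].
have [B1 B10 phiB] := test_bounded tphi; have [B2 B20 psiB] := test_bounded tpsi.
have [B3 B30 dphiB] := test_bounded tdphi; have [B4 B40 dpsiB] := test_bounded tdpsi.
have dgB x : `|pderiv i g x| <= B1 * B4 + B2 * B3.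
  by rewrite dg; apply: le_trans (ler_normD _ _) _; rewrite !normrM lerD// ler_pM.
have i1 : leb.-integrable Q (EFin \o (fun x => phi x * pderiv i psi x)).
  by apply: L2_integrable_mul => //; exact: test_L2.
have i2 : leb.-integrable Q (EFin \o (fun x => psi x * pderiv i phi x)).
  by apply: L2_integrable_mul => //; exact: test_L2.
have ic : leb.-integrable Q (EFin \o cst (B1 * B4 + B2 * B3)).
  apply/integrableP; split; first by apply/measurable_EFinP; exact: measurable_cst.
  by rewrite (eq_integral (cst (`|B1 * B4 + B2 * B3|)%:E))// integral_cst// lte_mul_pinfty.
have igC := @integral_pderiv_cell R n g (const_mx (- M)) (2 * M) (B1 * B4 + B2 * B3) i h0 Cg.
have : \int[leb]_(x in Q) (pderiv i g x + (B1 * B4 + B2 * B3)) =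
    (B1 * B4 + B2 * B3) * (2 * M) ^+ n.
  rewrite /Rintegral igC// => [v [k vk]|v]; last first.
    by have := dgB v; rewrite ler_norml => /andP[h1 _]; lra.
  rewrite /g (test_outside tphi) ?mul0r// => /OM /(_ k); rewrite !mxE subr0 ltr_norml => hk.
  by apply: vk; rewrite /= in_itv/= !mxE; case/andP: hk => h1 h2; apply/andP; split; lra.
rewrite RintegralD//; last first.
  rewrite (_ : _ \o _ = ((EFin \o (fun x => phi x * pderiv i psi x)%R) \+
     (EFin \o (fun x => psi x * pderiv i phi x)%R))%E); first exact: integrableD.
  by apply/funext => x /=; rewrite dg.
rewrite Rintegral_cst// [X in _ + _ * fine X]lQ /=.
rewrite -[X in _ = X]add0r => /addIr.
under eq_Rintegral do rewrite dg.
rewrite RintegralD// => /eqP; rewrite addr_eq0 => /eqP.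
rewrite /dotL2 /Rintegral => E.
rewrite (@integral_outside Q)// => [|x Ox]; last by rewrite (test_outside tphi)// mul0r.
rewrite E; congr (- fine _).
under eq_integral do rewrite mulrC.
by apply/esym/integral_outside => // x Ox; rewrite (test_outside tpsi)// mulr0.
Qed.

End test_functions.

Section quadratic_integral.
Context {d} {T : measurableType d} {R : realType}.
Variables (mu : {measure set T -> \bar R}) (D : set T).
Variable V : R.
Hypotheses (mD : measurable D) (DV : mu D = V%:E).
Implicit Types f : T -> R.

Lemma integral_quadratic f (a b c : R) : L2 mu D f ->
  (\int[mu]_(x in D) (a * f x ^+ 2 + b * f x + c)%:E =
   (a * dot mu D f f + b * dot mu D f (cst 1) + c * V)%:E)%E.
Proof.
move=> Lf; have L1 : L2 mu D (cst 1 : T -> R).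
  apply: (bounded_L2 (B := 1)) => // [|x _]; first by rewrite DV ltry.
  by rewrite /= normr1.
have if2 : mu.-integrable D (EFin \o (fun x => a * (f x * f x))).
  rewrite (_ : _ \o _ = (fun x => a%:E * (EFin \o (fun x => (f x * f x)%R)) x)%E)//.
  by apply: integrableZl => //; exact: L2_integrable_mul.
have if1 : mu.-integrable D (EFin \o (fun x => b * (f x * cst 1 x))).
  rewrite (_ : _ \o _ = (fun x => b%:E * (EFin \o (fun x => (f x * cst 1 x)%R)) x)%E)//.
  by apply: integrableZl => //; exact: L2_integrable_mul.
have i11 := L2_integrable_mul mD L1 L1.
have ic : mu.-integrable D (EFin \o (fun x => c * (cst 1 x * cst 1 x))).
  rewrite (_ : _ \o _ = (fun x => c%:E * (EFin \o (fun x => (cst 1 x * cst 1 x)%R)) x)%E)//.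
  exact: integrableZl.
have i21 : mu.-integrable D (EFin \o (fun x => a * (f x * f x) + b * (f x * cst 1 x))).
  rewrite (_ : _ \o _ = ((EFin \o (fun x => a * (f x * f x))%R) \+
    (EFin \o (fun x => b * (f x * cst 1 x))%R))%E)//.
  exact: integrableD.
have i : mu.-integrable D (EFin \o (fun x => a * (f x * f x) + b * (f x * cst 1 x) +
    c * (cst 1 x * cst 1 x))).
  rewrite (_ : _ \o _ = ((EFin \o (fun x => a * (f x * f x) + b * (f x * cst 1 x))%R) \+
    (EFin \o (fun x => c * (cst 1 x * cst 1 x))%R))%E)//.
  exact: integrableD.
rewrite (eq_integral (EFin \o (fun x => a * (f x * f x) + b * (f x * cst 1 x) +
    c * (cst 1 x * cst 1 x)))) => [|x _]; last by rewrite /= expr2 !mulr1.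
rewrite -(fineK (integrable_fin_num mD i)); congr _%:E.
rewrite -/(Rintegral mu D _) RintegralD// RintegralD//.
have ip := L2_integrable_mul mD Lf Lf; have iq := L2_integrable_mul mD Lf L1.
do 3 (rewrite RintegralZl//).
congr (_ + _ * _).
rewrite (@eq_Rintegral _ _ _ mu D (cst 1)) => [|x _]; last by rewrite /= mulr1.
by rewrite Rintegral_cst// mul1r DV.
Qed.

End quadratic_integral.

(** * Compactness of H^1_0 in L^2 *)

Section rellich.
Context {R : realType} {n : nat}.
Local Notation leb := (@lebesgue_rV R n).

(** With V the volume, A the integral of phi^2 and m that of phi, the double integral of
    [cell_poincare] is 2 V A - 2 m^2; dividing by 2 V isolates A. *)
Lemma cell_mean_poincare : exists2 K : R, 0 <= K &
  forall (phi : 'rV[R]_n -> R) c (h B : R), 0 < h -> Ck 1 phi ->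
    (forall x, `|phi x| <= B) ->
  ((dot leb (cell c h) phi phi)%:E <=
   (K * h ^+ 2)%:E * (\int[leb]_(v in cell c h) (grad2 phi v)%:E) +
   ((h ^+ n)^-1 * dot leb (cell c h) phi (cst 1) ^+ 2)%:E)%E.
Proof.
have [K K0 HK] := @cell_poincare R n.
exists (K / 2) => [|phi c h B h0 Cphi phiB]; first by rewrite divr_ge0.
have mQ := @measurable_cell R n c h.
have lQ := @lebesgue_cell R n c h (ltW h0).
have Qoo : (leb (cell c h) < +oo)%E by rewrite lQ ltry.
have Lphi : L2 leb (cell c h) phi.
  apply: bounded_L2 Qoo _ (fun x _ => phiB x) => //.
  by apply: measurable_funTS; apply: continuous_measurable_rV; exact: Ck_continuous Cphi.
have := HK phi c h h0 Cphi.
set G := (\int[leb]_(v in cell c h) (grad2 phi v)%:E)%E.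
set A := dot _ _ phi phi; set m := dot _ _ phi (cst 1); set V := h ^+ n in lQ *.
have V0 : 0 < V by rewrite exprn_gt0.
have inner v : (\int[leb]_(w in cell c h) ((phi v - phi w) ^+ 2)%:E =
    (V * phi v ^+ 2 + (- 2 * m) * phi v + A)%:E)%E.
  rewrite (eq_integral (fun w => (1 * phi w ^+ 2 + (- 2 * phi v) * phi w + phi v ^+ 2)%:E)).
    rewrite (integral_quadratic mQ lQ)// -/A -/m; congr _%:E; ring.
  by move=> w _; congr _%:E; ring.
rewrite (eq_integral (fun v => (V * phi v ^+ 2 + (- 2 * m) * phi v + A)%:E)) => [|v _]; last exact: inner.
rewrite (integral_quadratic mQ lQ)// -/A -/m => h1.
have V2 : (0 <= ((2 * V)^-1)%:E)%E by rewrite lee_fin invr_ge0 mulr_ge0// ltW.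
have := lee_wpmul2l V2 h1; rewrite muleA -!EFinM => h2.
have -> : A = (2 * V)^-1 * (V * A + - 2 * m * m + A * V) + V^-1 * m ^+ 2.
  by field; rewrite gt_eqF.
rewrite EFinD leeD2r//; apply: le_trans h2 _.
rewrite le_eqVlt; apply/orP; left; apply/eqP; congr (_%:E * _)%E.
by field; rewrite gt_eqF.
Qed.

Section subdivision.
Variables (M : R) (N : nat).
Hypotheses (M0 : 0 < M) (N0 : (0 < N)%N).
Let h := 2 * M / N%:R.

Definition grid (k : {ffun 'I_n -> 'I_N}) : 'rV[R]_n := \row_i (- M + (k i)%:R * h).

Let h0 : 0 < h. Proof. by rewrite divr_gt0 ?mulr_gt0// ltr0n. Qed.

Lemma grid_cover : box 0 M `<=` \big[setU/set0]_(k <- index_enum {ffun 'I_n -> 'I_N}) cell (grid k) h.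
Proof.
move=> v vM; rewrite -bigcup_seq.
have vb i : 0 < v ord0 i + M /\ v ord0 i + M < 2 * M.
  by have := vM i; rewrite !mxE subr0 ltr_norml => /andP[h1 h2]; split; lra.
have kN i : (Num.truncn ((v ord0 i + M) / h) < N)%N.
  have [v0 v2] := vb i.
  rewrite -(ltr_nat R); apply: le_lt_trans (_ : (v ord0 i + M) / h < _).
    by rewrite truncn_le divr_ge0// ltW.
  by rewrite ltr_pdivrMr// /h mulrCA divff ?mulr1// pnatr_eq0 -lt0n.
exists [ffun i => Ordinal (kN i)] => /=; first exact: mem_index_enum.
move=> i; rewrite /= mxE ffunE /= in_itv/=.
have [v0 v2] := vb i.
have t0 : 0 <= (v ord0 i + M) / h by rewrite divr_ge0// ltW.
have := truncn_itv t0; rewrite ler_pdivlMr// ltr_pdivrMr// -natr1 => /andP[h1 h2].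
by apply/andP; split; lra.
Qed.

Lemma grid_trivIset : trivIset [set` index_enum {ffun 'I_n -> 'I_N}] (fun k => cell (grid k) h).
Proof.
move=> k l _ _ [v [vk vl]]; apply/ffunP => i; apply/val_inj => /=.
have := vk i; have := vl i; rewrite /= !mxE !in_itv/= => /andP[h1 h2] /andP[h3 h4].
have le (p q : nat) : - M + p%:R * h <= v ord0 i -> v ord0 i < - M + q%:R * h + h -> (p <= q)%N.
  move=> a b; rewrite -ltnS -(ltr_nat R) -natr1 -(ltr_pM2r h0); lra.
by apply/eqP; rewrite eqn_leq !le.
Qed.

End subdivision.

Variable Omega : set 'rV[R]_n.
Hypotheses (oO : open Omega) (bO : bounded_set Omega).

Lemma sqnorm_gradientE phi : test_function Omega phi ->
  (sqnorm_gradient Omega (fun i => pderiv i phi))%:E =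
  (\int[leb]_(v in Omega) (grad2 phi v)%:E)%E.
Proof.
move=> tphi; have mO := Omega_measurable oO.
have Ld i : L2 leb Omega (pderiv i phi) by apply: test_in_L2 => //; exact: test_function_pderiv.
rewrite /grad2; under eq_integral do rewrite -sumEFin.
rewrite ge0_integral_sum//.
- rewrite /sqnorm_gradient -sumEFin; apply: eq_bigr => i _.
  by rewrite -dotE.
- by move=> i; apply/measurable_EFinP; apply: measurable_funX; have [] := Ld i.
- by move=> i x _; rewrite lee_fin sqr_ge0.
Qed.

(** Summing the cube inequality over a grid of mesh h covering Omega, with K h^2 <= e, leaves the
    integrals over the cells as the finitely many functionals, weighted by h^-n. *)
Lemma rellich_test (e : R) : 0 < e -> exists K (q : 'I_K -> set 'rV[R]_n) (C : R),
  [/\ 0 <= C, forall k, measurable (q k) &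
    forall phi, test_function Omega phi -> sqnormL2 Omega phi <=
      e * sqnorm_gradient Omega (fun i => pderiv i phi) +
      C * \sum_k dotL2 Omega phi (\1_(q k)) ^+ 2].
Proof.
move=> e0; have [M M0 OM] := bounded_box bO.
have [K K0 HK] := cell_mean_poincare.
(* As N <= N^2, it is enough that N exceed K (2M)^2 / e. *)
have [N [N0 KN]] : exists N : nat, (0 < N)%N /\ K * (2 * M / N%:R) ^+ 2 <= e.
  pose N := (Num.truncn (K * (2 * M) ^+ 2 / e)).+1; exists N; split=> //.
  have N1 : K * (2 * M) ^+ 2 / e < N%:R by exact: truncnS_gt.
  rewrite expr_div_n mulrA ler_pdivrMr ?exprn_gt0// [e * _]mulrC -ler_pdivrMr//.
  apply: le_trans (ltW N1) _; rewrite expr2 ler_peMr//; by rewrite ler1n.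
pose h := 2 * M / N%:R; have h0 : 0 < h by rewrite divr_gt0 ?mulr_gt0// ltr0n.
pose T := {ffun 'I_n -> 'I_N}.
pose Q (k : T) := cell (grid M k) h.
have mQ k : measurable (Q k) by exact: measurable_cell.
exists #|T|, (fun i => Q (enum_val i)), (h ^+ n)^-1; split=> [||phi tphi].
- by rewrite invr_ge0 exprn_ge0// ltW.
- by move=> k; exact: mQ.
have mO := Omega_measurable oO.
have OU : Omega `<=` \big[setU/set0]_(k <- index_enum T) Q k.
  exact: subset_trans OM (grid_cover M0 N0).
have tQ := @grid_trivIset M N M0 N0.
have uT : uniq (index_enum T) by exact: index_enum_uniq.
have Lphi := test_in_L2 oO bO tphi.
have [B B0 phiB] := test_bounded tphi.
have mphi2 : measurable_fun setT (fun v => (phi v ^+ 2)%:E).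
  by apply/measurable_EFinP; apply: measurable_funX; exact: test_measurable tphi.
have mg : measurable_fun setT (fun v => (grad2 phi v)%:E).
  apply/measurable_EFinP; apply: measurable_sum => k.
  by apply: measurable_funX; apply: test_measurable; exact: (test_function_pderiv k tphi).
have g0 v : (0 <= (grad2 phi v)%:E)%E.
  by rewrite lee_fin; apply: sumr_ge0 => k _; exact: sqr_ge0.
have sumphi : ((sqnormL2 Omega phi)%:E = \sum_(k <- index_enum T) (dot leb (Q k) phi phi)%:E)%E.
  rewrite [LHS](dotE Lphi) (integral_outside OU); last first.
    by move=> x Ox; rewrite (test_outside tphi)// expr0n.
  rewrite ge0_integral_bigsetU//.
  - apply: eq_bigr => k _; rewrite dotE//; apply: test_L2 tphi => //.
    by rewrite [X in (X < _)%E]lebesgue_cell ?ltry// ltW.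
  - exact: measurable_funTS.
  - by move=> x _; rewrite lee_fin sqr_ge0.
have sumgrad : ((sqnorm_gradient Omega (fun i => pderiv i phi))%:E =
    \sum_(k <- index_enum T) \int[leb]_(v in Q k) (grad2 phi v)%:E)%E.
  rewrite sqnorm_gradientE// (integral_outside OU); last first.
    move=> x Ox; rewrite /grad2 big1// => i _.
    by rewrite (test_outside (test_function_pderiv i tphi))// expr0n.
  rewrite ge0_integral_bigsetU//; exact: measurable_funTS.
have dotQ k : dot leb (Q k) phi (cst 1) = dotL2 Omega phi \1_(Q k).
  rewrite /dot /dotL2 Rintegral_mkcond [RHS]Rintegral_mkcond; congr (Rintegral _ _ _).
  apply/funext => x; rewrite !patchE indicE /=.
  case: (x \in Q k); rewrite ?mulr1 ?mulr0; last by case: ifP.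
  by case: ifPn => // /negP Ox; rewrite (test_outside tphi)// => Ox'; apply: Ox; exact: mem_set.
rewrite -lee_fin sumphi.
apply: (@le_trans _ _ (\sum_(k <- index_enum T) ((K * h ^+ 2)%:E *
    (\int[leb]_(v in Q k) (grad2 phi v)%:E) +
    ((h ^+ n)^-1 * dot leb (Q k) phi (cst 1) ^+ 2)%:E))%E).
  by apply: lee_sum => k _; apply: HK h0 (test_Ck 1 tphi) phiB.
rewrite big_split/= EFinD.
apply: leeD.
  rewrite -ge0_sume_distrr => [|k _]; last by apply: integral_ge0.
  rewrite -sumgrad -EFinM lee_fin ler_wpM2r//.
  by rewrite -lee_fin sqnorm_gradientE//; apply: integral_ge0.
rewrite sumEFin lee_fin mulr_sumr.
rewrite (reindex (fun i : 'I_#|T| => enum_val i)) /=; last first.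
  by apply: onW_bij; exact: enum_val_bij.
by apply: ler_sum => i _; rewrite dotQ.
Qed.

End rellich.

(** * Density of test functions in L^2 *)

Section density.
Context {R : realType} {n : nat}.
Local Notation leb := (@lebesgue_rV R n).
Variable Omega : set 'rV[R]_n.
Hypotheses (oO : open Omega) (bO : bounded_set Omega).

(** Dominated convergence makes the integral of g vanish over the trace on Omega of every open set.
    Open sets are stable under intersection and generate, so the integral vanishes over every
    measurable part and g is 0 almost everywhere. Finite measure of Omega makes g integrable. *)
Lemma test_functions_dense g : in_L2 Omega g ->
  (forall phi, test_function Omega phi -> dotL2 Omega g phi = 0) ->
  sqnormL2 Omega g = 0.
Proof.
move=> Lg gphi.
have mO := Omega_measurable oO; have Ofin := Omega_finite oO bO.
have L1 : L2 leb Omega (cst 1).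
  by apply: (bounded_L2 (B := 1)) => // x _; rewrite /= normr1.
have [mg _] := Lg.
have ig : leb.-integrable Omega (EFin \o g).
  have := L2_integrable_mul mO Lg L1; rewrite (_ : EFin \o _ = EFin \o g)//.
  by apply/funext => x /=; rewrite mulr1.
have i0 A : measurable A -> leb.-integrable (Omega `&` A) (EFin \o g).
  by move=> mA; apply: (integrableS mO _ _ ig) => //; exact: measurableI.
pose P A := (\int[leb]_(x in Omega `&` A) (g x)%:E = 0)%E.
have Popen U : open U -> P U.
  move=> oU; have [|psi [tpsi psi01 psilim]] := @open_indic_approx R n (Omega `&` U).
    exact: openI.
  have tpsiO N : test_function Omega (psi N).
    have [spsi [K [cK KO psi0]]] := tpsi N; split=> //.
    by exists K; split=> // x /KO[].
  have : (fun N => \int[leb]_(x in Omega) (g x * psi N x)%:E)%E @ \oo -->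
      (\int[leb]_(x in Omega) (g x * \1_(Omega `&` U) x)%:E)%E.
    apply: (@dominated_cvg _ _ _ leb _ mO _ _ (fun x => `|g x|%:E)) => //.
    - move=> N; apply/measurable_EFinP; apply: measurable_funM => //.
      exact: test_measurable (tpsiO N).
    - move=> x _; apply: cvg_EFin; first exact: nearW.
      by apply: cvgM; [exact: cvg_cst|exact: psilim].
    - exact: (integrable_abse ig).
    - move=> N x _ /=; rewrite lee_fin normrM ler_piMr//.
      by have /andP[h1 h2] := psi01 N x; rewrite ger0_norm.
  rewrite (_ : (fun _ => _) = cst 0%E); last first.
    apply/funext => N /=; rewrite -(fineK (integrable_fin_num mO (L2_integrable_mul mO Lg (test_in_L2 oO bO (tpsiO N))))).
    by congr _%:E; exact: gphi.
  move=> h; have h0 := cvg_unique _ h (cvg_cst 0%E).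
  rewrite /P -[RHS]h0// integral_mkcond [RHS]integral_mkcond; congr (integral _ _ _).
  apply/funext => x; rewrite !patchE indicE in_setI.
  by case: (x \in Omega) => //=; case: (x \in U); rewrite ?mulr1 ?mulr0.
have PA A : measurable A -> P A.
  move=> mA; apply: (@dynkin_induction _ _ (@open 'rV[R]_n) P) => //.
  - exact: measurable_rV_open.
  - exact: openI.
  - by apply: Popen; exact: openT.
  - move=> S mS PS; have := Popen _ openT; rewrite /P.
    rewrite -(setUv S) setIUr integral_setU//.
    + by move: PS; rewrite /P => ->; rewrite add0e.
    + exact: measurableI.
    + by apply: measurableI => //; exact: measurableC.
    + apply/measurable_EFinP; apply: measurable_funS mg => //.
      by move=> x [[]|[]].
    + by apply/disj_setPS => x [[_ Sx] [_ nSx]].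
  - move=> F mF tF PF; rewrite /P setI_bigcupr integral_bigcup//.
    + by apply: eseries0 => i _ _; exact: PF.
    + exact: trivIset_setIl.
    + by move=> k; exact: measurableI.
    + by rewrite -setI_bigcupr; apply: i0; exact: bigcup_measurable.
  - by rewrite -measurable_rV_open.
have g0 : ae_eq leb Omega (EFin \o g) (cst 0%E).
  apply: integral_ae_eq => // E EO mE.
  by rewrite integral0 -[E](setIidr EO); exact: PA.
have L0 : L2 leb Omega (cst 0) by exact: L2_cst0.
have -> : sqnormL2 Omega g = dot leb Omega (cst 0) g.
  apply: (ae_eq_dot mO Lg L0 Lg); apply: filterS g0 => x /= h Ox.
  by have [] := h Ox.
by rewrite /dot; under eq_Rintegral do rewrite mul0r; rewrite Rintegral_cst// mul0r.
Qed.

End density.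

(** * The Dirichlet form on H^1_0 *)

Section submodule.
Context {R : pzRingType} {V : lmodType R}.

(** The abstract part asks for an [lmodType]; this construction makes one out of a set of functions,
    or of pairs, stable under linear combinations. *)
Definition submodule_pred (P : set V) : {pred V} := [pred x | `[< P x >]].

(* Same predicate, but carrying the closure proof, on which the algebraic
   instances below are keyed. *)
Definition closed_pred (P : set V) (cl : submod_closed (submodule_pred P)) : {pred V} :=
  submodule_pred P.

Record submodule (P : set V) (cl : submod_closed (submodule_pred P)) : Type :=
  Submodule { submodule_val :> V; _ : submodule_val \in closed_pred cl }.

Section instances.
Variables (P : set V) (cl : submod_closed (submodule_pred P)).
HB.instance Definition _ := GRing.isSubmodClosed.Build R V (closed_pred cl) cl.
HB.instance Definition _ := [isSub for @submodule_val P cl].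
HB.instance Definition _ := [Choice of submodule cl by <:].
HB.instance Definition _ := [SubChoice_isSubLmodule of submodule cl by <:].

Lemma submoduleP (x : submodule cl) : P (submodule_val x).
Proof. by case: x => x /= /asboolP. Qed.

Lemma submodule_linear (c : R) (x y : submodule cl) :
  submodule_val (c *: x + y) = c *: submodule_val x + submodule_val y.
Proof. exact: (linearP (val : submodule cl -> V)). Qed.

Lemma submodule_val_inj : injective (@submodule_val P cl).
Proof. exact: val_inj. Qed.

Definition submodule_of x (Px : P x) : submodule cl :=
  @Submodule P cl x (asboolT Px).

End instances.
End submodule.

Lemma submodule_closed (R : pzRingType) (V : lmodType R) (P : set V) : P 0 ->
  (forall c x y, P x -> P y -> P (c *: x + y)) -> submod_closed (submodule_pred P).
Proof.
move=> P0 Plin; split=> [|c x y /asboolP Px /asboolP Py]; first exact/asboolP.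
by apply/asboolP; exact: Plin.
Qed.

Lemma cvgr_sum (R : realType) (T : Type) (F : set_system T) (I : Type) (r : seq I)
    (f : I -> T -> R) (l : I -> R) : Filter F -> (forall i, f i @ F --> l i) ->
  (fun x => \sum_(i <- r) f i x) @ F --> \sum_(i <- r) l i.
Proof.
move=> FF fl; elim: r => [|i r IH].
  rewrite big_nil (_ : (fun _ => _) = cst 0); first exact: cvg_cst.
  by apply/funext => x; rewrite big_nil.
rewrite big_cons (_ : (fun _ => _) = f i \+ (fun x => \sum_(i <- r) f i x)).
  by apply: cvgD.
by apply/funext => x; rewrite big_cons.
Qed.

Section dirichlet.
Context {R : realType} {n : nat}.
Variable Omega : set 'rV[R]_n.
Hypotheses (oO : open Omega) (bO : bounded_set Omega).
Local Notation leb := (@lebesgue_rV R n).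
Local Notation fT := ('rV[R]_n -> R).

Let mO : measurable Omega := Omega_measurable oO.

Lemma in_L2_closed : submod_closed (submodule_pred (in_L2 Omega)).
Proof.
apply: submodule_closed; first exact: (L2_cst0 leb Omega).
by move=> c f g; exact: (L2_linear mO).
Qed.

Local Notation L2_space := (submodule in_L2_closed).

Definition L2_elt f (Lf : in_L2 Omega f) : L2_space := submodule_of in_L2_closed Lf.

Definition L2_form (f g : L2_space) := dotL2 Omega (submodule_val f) (submodule_val g).

Lemma L2_form_psd : psd_form L2_form.
Proof.
split=> [c x y z|x y|x].
- rewrite /L2_form submodule_linear.
  exact: (dot_linear mO c (submoduleP x) (submoduleP y) (submoduleP z)).
- exact: dotC.
- exact: dot_ge0.
Qed.

Lemma sqnormL2_sub_cvg (u : nat -> fT) v w (Lu : forall k, in_L2 Omega (u k))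
    (Lv : in_L2 Omega v) (Lw : in_L2 Omega w) :
  (fun k => sqnormL2 Omega (u k \- v)) @ \oo --> (0 : R) ->
  (fun k => dotL2 Omega (u k) w) @ \oo --> dotL2 Omega v w.
Proof.
exact: (psd_cvg L2_form_psd (u := fun k => L2_elt (Lu k)) (z := L2_elt Lv) (y := L2_elt Lw)).
Qed.

Lemma sqnormL2_sub_trans (u v w : fT) : in_L2 Omega u -> in_L2 Omega v -> in_L2 Omega w ->
  sqnormL2 Omega (u \- w) <= sqnormL2 Omega (u \- v) *+ 2 + sqnormL2 Omega (v \- w) *+ 2.
Proof.
by move=> Lu Lv Lw; exact: (psdBB_le L2_form_psd (L2_elt Lu) (L2_elt Lv) (L2_elt Lw)).
Qed.

Lemma sqnormL2_ge0 (u : fT) : 0 <= sqnormL2 Omega u.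
Proof. exact: dot_ge0. Qed.

Lemma sqnormL2_sub_cvg_trans (phi u : nat -> fT) v (e : nat -> R) :
  (forall k, in_L2 Omega (phi k)) -> (forall k, in_L2 Omega (u k)) -> in_L2 Omega v ->
  (forall k, sqnormL2 Omega (phi k \- u k) <= e k) -> e @ \oo --> (0 : R) ->
  (fun k => sqnormL2 Omega (u k \- v)) @ \oo --> (0 : R) ->
  (fun k => sqnormL2 Omega (phi k \- v)) @ \oo --> (0 : R).
Proof.
move=> Lphi Lu Lv phie e0 u0.
have lim0 : (fun k => e k *+ 2 + sqnormL2 Omega (u k \- v) *+ 2) @ \oo --> (0 *+ 2 + 0 *+ 2 : R).
  by apply: cvgD; exact: cvgMn.
rewrite !mul0rn addr0 in lim0.
apply: (squeeze_cvgr _ (cvg_cst 0) lim0); apply: nearW => k; rewrite sqnormL2_ge0/=.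
apply: le_trans (sqnormL2_sub_trans (Lphi k) (Lu k) Lv) _.
by rewrite lerD2r lerMn2r phie orbT.
Qed.

Lemma H10_L2 u du : H10_gradient Omega u du -> in_L2 Omega u.
Proof. by move=> [[]]. Qed.

Lemma H10_gradient_L2 u du i : H10_gradient Omega u du -> in_L2 Omega (du i).
Proof. by move=> [[]]. Qed.

(** Keeping the gradient as data makes it linear by construction, so [dirichlet_form] is bilinear
    without any discussion of uniqueness of weak gradients. *)
Definition H10_pair (x : fT * ('I_n -> fT)) := H10_gradient Omega x.1 x.2.

Lemma test_H10 phi : test_function Omega phi -> H10_pair (phi, fun i => pderiv i phi).
Proof.
move=> tphi; have tdphi i := test_function_pderiv i tphi.
have sub0 f : (fun k : nat => sqnormL2 Omega (f \- f)) @ \oo --> (0 : R).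
  rewrite (_ : (fun _ => _) = cst 0); first exact: cvg_cst.
  apply/funext => k; rewrite /sqnormL2 /dotL2.
  under eq_Rintegral do rewrite /= subrr mulr0.
  by rewrite Rintegral_cst// mul0r.
split=> /=.
  split=> [|i|i psi tpsi]; [exact: test_in_L2|exact: test_in_L2|].
  exact: test_integration_by_parts.
by exists (fun=> phi); split=> [k||i]; [exact: tphi|exact: sub0|exact: sub0].
Qed.

Lemma H10_linear c x y : H10_pair x -> H10_pair y -> H10_pair (c *: x + y).
Proof.
move=> Hx Hy.
have Lx := H10_L2 Hx; have Ldx i := H10_gradient_L2 i Hx.
have Ly := H10_L2 Hy; have Ldy i := H10_gradient_L2 i Hy.
have [[_ _ wx] [p [tp pu pdu]]] := Hx; have [[_ _ wy] [q [tq qv qdv]]] := Hy.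
have comb (f g h k : fT) : in_L2 Omega f -> in_L2 Omega g -> in_L2 Omega h -> in_L2 Omega k ->
    sqnormL2 Omega ((c *: f + g) \- (c *: h + k)) <=
    c ^+ 2 * sqnormL2 Omega (f \- h) *+ 2 + sqnormL2 Omega (g \- k) *+ 2.
  move=> Lf Lg Lh Lk.
  have Lfh : in_L2 Omega (f - h) by exact: (L2_sub mO).
  have Lgk : in_L2 Omega (g - k) by exact: (L2_sub mO).
  have := psdDD_le L2_form_psd (c *: L2_elt Lfh) (L2_elt Lgk).
  rewrite (psdZl L2_form_psd) (psdZr L2_form_psd) mulrA -expr2.
  apply: le_trans; rewrite le_eqVlt; apply/orP; left; apply/eqP.
  by apply: eq_Rintegral => z _ /=; rewrite !fctE /GRing.scale/=; ring.
have lim (f g : nat -> fT) h k : (forall j, in_L2 Omega (f j)) -> (forall j, in_L2 Omega (g j)) ->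
    in_L2 Omega h -> in_L2 Omega k ->
    (fun j => sqnormL2 Omega (f j \- h)) @ \oo --> (0 : R) ->
    (fun j => sqnormL2 Omega (g j \- k)) @ \oo --> (0 : R) ->
    (fun j => sqnormL2 Omega ((c *: f j + g j) \- (c *: h + k))) @ \oo --> (0 : R).
  move=> Lf Lg Lh Lk fh gk.
  have lim0 : (fun j => c ^+ 2 * sqnormL2 Omega (f j \- h) *+ 2 +
      sqnormL2 Omega (g j \- k) *+ 2) @ \oo --> (c ^+ 2 * 0 *+ 2 + 0 *+ 2 : R).
    apply: cvgD; last exact: cvgMn.
    by apply: cvgMn; apply: cvgM => //; exact: cvg_cst.
  rewrite mulr0 !mul0rn addr0 in lim0.
  apply: (squeeze_cvgr _ (cvg_cst 0) lim0); apply: nearW => j; rewrite sqnormL2_ge0/=.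
  exact: comb.
have pderiv_comb (f g : fT) i : test_function Omega f -> test_function Omega g ->
    pderiv i (c *: f + g) = c *: pderiv i f + pderiv i g.
  move=> tf tg; apply/funext => z.
  have df : derivable f z (delta_mx ord0 i) by exact: Ck_derivable (test_Ck 1 tf).
  have dg : derivable g z (delta_mx ord0 i) by exact: Ck_derivable (test_Ck 1 tg).
  by rewrite /pderiv (deriveD (derivableZ df) dg) (deriveZ _ df).
split.
  split=> [|i|i phi tphi] /=; [exact: (L2_linear mO c Lx Ly)|exact: (L2_linear mO c (Ldx i) (Ldy i))|].
  have Lphi := test_in_L2 oO bO tphi.
  have Ldphi := test_in_L2 oO bO (test_function_pderiv i tphi).
  have -> : dotL2 Omega (c *: x.1 + y.1) (pderiv i phi) =
      c * dotL2 Omega x.1 (pderiv i phi) + dotL2 Omega y.1 (pderiv i phi).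
    exact: (dot_linear mO c Lx Ly Ldphi).
  have -> : dotL2 Omega (c *: x.2 i + y.2 i) phi =
      c * dotL2 Omega (x.2 i) phi + dotL2 Omega (y.2 i) phi.
    exact: (dot_linear mO c (Ldx i) (Ldy i) Lphi).
  by rewrite wx// wy//; ring.
exists (fun k => c *: p k + q k); split=> [k|/=|i /=]; first exact: test_functionP.
  by apply: lim => // j; exact: test_in_L2.
under eq_fun do rewrite pderiv_comb//.
by apply: lim => // j; apply: test_in_L2 => //; exact: test_function_pderiv.
Qed.

Lemma test_function0 : test_function Omega (0 : fT).
Proof.
split; first by apply/smoothP => k; exact: (@Ck_cst R n k 0).
by exists set0; split=> //; exact: compact0.
Qed.

Lemma H10_closed : submod_closed (submodule_pred H10_pair).
Proof.
apply: submodule_closed => [|c x y]; last exact: H10_linear.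
rewrite (_ : 0 = (0 : fT, fun i => pderiv i (0 : fT))); first exact: (test_H10 test_function0).
congr pair; apply/funext => i; apply/funext => x.
by rewrite (_ : pderiv i 0 = cst 0)//; exact: pderiv_cst.
Qed.

Local Notation H10_space := (submodule H10_closed).

Definition H10_elt x (Hx : H10_pair x) : H10_space := submodule_of H10_closed Hx.

Lemma H10_spaceP (x : H10_space) : H10_pair (submodule_val x).
Proof. exact: submoduleP. Qed.

Definition H10_embed (x : H10_space) : L2_space := L2_elt (H10_L2 (H10_spaceP x)).

Lemma H10_embed_linear : linear H10_embed.
Proof.
move=> c x y; apply: submodule_val_inj.
apply: (etrans _ (esym (submodule_linear c (H10_embed x) (H10_embed y)))).
exact: (congr1 fst (submodule_linear c x y)).
Qed.

HB.instance Definition _ := GRing.isLinear.Build R H10_space L2_space _ H10_embed H10_embed_linear.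

Definition dirichlet_form (x y : H10_space) : R :=
  \sum_i dotL2 Omega ((submodule_val x).2 i) ((submodule_val y).2 i).

Lemma dirichlet_form_psd : psd_form dirichlet_form.
Proof.
have Ld (x : H10_space) i : in_L2 Omega ((submodule_val x).2 i).
  exact: H10_gradient_L2 (H10_spaceP x).
split=> [c x y z|x y|x].
- rewrite /dirichlet_form (submodule_linear c x y) mulr_sumr -big_split/=.
  apply: eq_bigr => i _; exact: (dot_linear mO c (Ld x i) (Ld y i) (Ld z i)).
- by apply: eq_bigr => i _; exact: dotC.
- by apply: sumr_ge0 => i _; exact: dot_ge0.
Qed.


Local Notation V := H10_space.
Local Notation j := [the {linear H10_space -> L2_space} of H10_embed].

(** Simultaneous convergence in both forms is what lets identities and inequalities pass from test
    functions to all of H^1_0. *)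
Lemma H10_approx (x : V) : exists p : nat -> V,
  (forall k, exists2 phi, test_function Omega phi &
     submodule_val (p k) = (phi, fun i => pderiv i phi)) /\
  (fun k => L2_form (j (p k - x)) (j (p k - x))) @ \oo --> (0 : R) /\
  (fun k => dirichlet_form (p k - x) (p k - x)) @ \oo --> (0 : R).
Proof.
have [_ [phi [tphi pu pdu]]] := H10_spaceP x.
exists (fun k => H10_elt (test_H10 (tphi k))); split; [|split].
- by move=> k; exists (phi k).
- exact: pu.
- rewrite /dirichlet_form [X in _ --> X](_ : _ = \sum_(i < n) 0); last by rewrite big1.
  by apply: cvgr_sum => i; exact: pdu.
Qed.

Lemma H10_complete (x : nat -> V) :
  (forall e : R, 0 < e -> exists N, forall k l, (N <= k)%N -> (N <= l)%N ->
     L2_form (j (x k - x l)) (j (x k - x l)) + dirichlet_form (x k - x l) (x k - x l) < e) ->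
  exists z, (fun k => L2_form (j (x k - z)) (j (x k - z)) +
     dirichlet_form (x k - z) (x k - z)) @ \oo --> (0 : R).
Proof.
move=> cx.
pose u k := (submodule_val (x k)).1; pose du i k := (submodule_val (x k)).2 i.
have Lu k : in_L2 Omega (u k) by exact: H10_L2 (H10_spaceP (x k)).
have Ldu i k : in_L2 Omega (du i k) by exact: H10_gradient_L2 (H10_spaceP (x k)).
have a_ge0 (y : V) i : dotL2 Omega ((submodule_val y).2 i) ((submodule_val y).2 i) <= dirichlet_form y y.
  rewrite /dirichlet_form (bigD1 i)//= lerDl.
  by apply: sumr_ge0 => l _; exact: dot_ge0.
have [z [Lz uz]] : exists z, in_L2 Omega z /\
    (fun k => sqnormL2 Omega (u k - z)) @ \oo --> (0 : R).
  apply: (L2_complete mO Lu) => e e0; have [N NP] := cx e e0; exists N => k l Nk Nl.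
  apply: le_lt_trans (NP k l Nk Nl); rewrite [leLHS]/(L2_form (j (x k - x l)) (j (x k - x l))).
  by rewrite lerDl (psd_ge0 dirichlet_form_psd).
have /choice[dz dzP] i : exists z, in_L2 Omega z /\
    (fun k => sqnormL2 Omega (du i k - z)) @ \oo --> (0 : R).
  apply: (L2_complete mO (Ldu i)) => e e0; have [N NP] := cx e e0; exists N => k l Nk Nl.
  apply: le_lt_trans (NP k l Nk Nl); apply: le_trans (a_ge0 (x k - x l) i) _.
  by rewrite lerDr (psd_ge0 L2_form_psd).
have Ldz i : in_L2 Omega (dz i) by have [] := dzP i.
have duz i : (fun k => sqnormL2 Omega (du i k - dz i)) @ \oo --> (0 : R) by have [] := dzP i.
have Hz : H10_pair (z, dz).
  split=> /=.
    split=> // i phi tphi.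
    have Lphi := test_in_L2 oO bO tphi.
    have Ldphi := test_in_L2 oO bO (test_function_pderiv i tphi).
    have lim1 := sqnormL2_sub_cvg Lu Lz Ldphi uz.
    have lim2 := sqnormL2_sub_cvg (Ldu i) (Ldz i) Lphi (duz i).
    apply: (cvg_unique _ lim1) => //.
    rewrite (_ : (fun _ => _) = (fun k => - dotL2 Omega (du i k) phi)); first exact: cvgN.
    by apply/funext => k; have [[_ _ w] _] := H10_spaceP (x k); exact: w.
  (* Diagonal choice: each x k is itself a limit of test functions, and one is taken within 1/(k+1),
     in squared norm, for the function and all its derivatives at once. *)
  have /choice[phi phiP] k : exists phi, test_function Omega phi /\
      sqnormL2 Omega (phi \- u k) <= harmonic k /\
      forall i, sqnormL2 Omega (pderiv i phi \- du i k) <= harmonic k.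
    have [_ [phi [tphi pu pdu]]] := H10_spaceP (x k).
    have hk : 0 < harmonic k :> R by rewrite /harmonic/= invr_gt0.
    have pu' : \forall l \near \oo, sqnormL2 Omega (phi l \- u k) <= harmonic k.
      move/cvgrPdist_le : pu => /(_ _ hk); apply: filterS => l /=.
      by rewrite sub0r normrN ger0_norm// sqnormL2_ge0.
    have pdu' : \forall l \near \oo, forall i, sqnormL2 Omega (pderiv i (phi l) \- du i k) <= harmonic k.
      apply: filter_forall => i.
      move/cvgrPdist_le : (pdu i) => /(_ _ hk); apply: filterS => l /=.
      by rewrite sub0r normrN ger0_norm// sqnormL2_ge0.
    have [l [h1 h2]] := filter_ex (filterI pu' pdu').
    by exists (phi l); split; [exact: tphi|split].
  exists phi; split=> [k||i]; first by have [] := phiP k.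
    apply: (sqnormL2_sub_cvg_trans _ Lu Lz _ (@cvg_harmonic R) uz) => k.
      by apply: test_in_L2 => //; have [] := phiP k.
    by have [_ []] := phiP k.
  apply: (sqnormL2_sub_cvg_trans _ (Ldu i) (Ldz i) _ (@cvg_harmonic R) (duz i)) => k.
    by apply: test_in_L2 => //; apply: test_function_pderiv; have [] := phiP k.
  by have [_ []] := phiP k.
exists (H10_elt Hz); rewrite -[X in _ --> X]addr0; apply: cvgD; first exact: uz.
rewrite /dirichlet_form [X in _ --> X](_ : _ = \sum_(i < n) 0); last by rewrite big1.
by apply: cvgr_sum => i; exact: duz.
Qed.

(** Both sides of the inequality for test functions converge along the approximating sequence; the
    functionals are products with indicators, which are in L^2 because Omega has finite measure. *)
Lemma H10_rellich (e : R) : 0 < e ->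
  exists K (l : 'I_K -> L2_space) (C : R), 0 <= C /\
    forall x : V, L2_form (j x) (j x) <=
      e * dirichlet_form x x + C * \sum_k L2_form (j x) (l k) ^+ 2.
Proof.
move=> e0; have [K [q [C [C0 mq HC]]]] := rellich_test oO bO e0.
have Lq k : in_L2 Omega (\1_(q k)).
  apply: (bounded_L2 (B := 1)) => //; first exact: Omega_finite.
  by move=> x _; rewrite indicE; case: (_ \in _); rewrite ?normr1 ?normr0.
exists K, (fun k => L2_elt (Lq k)), C; split=> // x.
have [p [pP [pj pa]]] := H10_approx x.
have l1 := psd_cvg_diag (psd_form_comp j L2_form_psd) pj.
have l2 := psd_cvg_diag dirichlet_form_psd pa.
have l3 k := psd_cvg L2_form_psd (u := fun i => j (p i)) (z := j x) (y := L2_elt (Lq k)).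
have lim : (fun i => e * dirichlet_form (p i) (p i) +
      C * \sum_k L2_form (j (p i)) (L2_elt (Lq k)) ^+ 2) @ \oo -->
    (e * dirichlet_form x x + C * \sum_k L2_form (j x) (L2_elt (Lq k)) ^+ 2).
  apply: cvgD; apply: cvgM => //; try exact: cvg_cst.
  apply: cvgr_sum => k; apply: cvgM; apply: l3;
  by under eq_fun do rewrite -linearB.
apply: (ler_cvg_to l1 lim); apply: nearW => i.
have [phi tphi pE] := pP i; have := HC phi tphi.
by rewrite /L2_form /dirichlet_form /= pE.
Qed.

Lemma H10_dense (g : L2_space) : (forall x : V, L2_form g (j x) = 0) -> L2_form g g = 0.
Proof.
move=> gx; apply: (test_functions_dense oO bO); first exact: submoduleP.
by move=> phi tphi; exact: (gx (H10_elt (test_H10 tphi))).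
Qed.

End dirichlet.

(** * Variational and distributional eigenfunctions *)

Section dirichlet_eigenfunctions.
Context {R : realType} {n : nat}.
Variable Omega : set 'rV[R]_n.
Hypotheses (oO : open Omega) (bO : bounded_set Omega).
Local Notation leb := (@lebesgue_rV R n).
Local Notation fT := ('rV[R]_n -> R).
Local Notation V := (submodule (H10_closed oO bO)).
Local Notation W := (submodule (in_L2_closed oO)).
Local Notation j := [the {linear V -> W} of @H10_embed R n Omega oO bO].
Local Notation dotW := (@L2_form R n Omega oO).
Local Notation a := (@dirichlet_form R n Omega oO bO).

Let mO : measurable Omega := Omega_measurable oO.

Lemma dotL2_sumr (I : Type) (r : seq I) (F : I -> fT) u : in_L2 Omega u ->
  (forall i, in_L2 Omega (F i)) ->
  in_L2 Omega (fun x => \sum_(i <- r) F i x) /\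
  dotL2 Omega u (fun x => \sum_(i <- r) F i x) = \sum_(i <- r) dotL2 Omega u (F i).
Proof.
move=> Lu LF; elim: r => [|i r [Lr IH]].
  rewrite big_nil (_ : (fun _ => _) = (cst 0 : fT)); last first.
    by apply/funext => x; rewrite big_nil.
  split; first exact: (L2_cst0 leb Omega).
  rewrite /dotL2; under eq_Rintegral do rewrite /= mulr0.
  by rewrite Rintegral_cst// mul0r.
rewrite big_cons (_ : (fun _ => _) = 1 *: F i + (fun x => \sum_(i <- r) F i x)); last first.
  by apply/funext => x; rewrite big_cons !fctE scale1r.
split; first exact: (L2_linear mO 1 (LF i) Lr).
rewrite -IH [LHS]dotC [dotL2 _ _ (F i)]dotC [X in _ = _ + X]dotC.
by rewrite [LHS](dot_linear mO 1 (LF i) Lr Lu) mul1r.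
Qed.

(** The weak gradient of x is tested against each first derivative of phi, itself a test
    function. *)
Lemma dirichlet_form_test (x : V) phi (tphi : test_function Omega phi) :
  a x (H10_elt oO bO (test_H10 oO bO tphi)) =
  - dotL2 Omega (submodule_val x).1 (laplacian phi).
Proof.
have Hx := H10_spaceP x; have Lx := H10_L2 Hx.
have tdd i : test_function Omega (pderiv i (pderiv i phi)).
  by do 2 apply: test_function_pderiv.
have [_ ->] := dotL2_sumr (index_enum 'I_n) Lx (fun i => test_in_L2 oO bO (tdd i)).
rewrite -sumrN; apply: eq_bigr => i _.
have [[_ _ w] _] := Hx.
by rewrite (w i _ (test_function_pderiv i tphi)) opprK.
Qed.

(** The distributional equation is the variational one restricted to test functions; the converse
    follows by approximating y in both forms. *)
Lemma eigenP mu (x : V) : eigen dotW j a mu x <->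
  forall phi, test_function Omega phi ->
    - dotL2 Omega (submodule_val x).1 (laplacian phi) =
    mu * dotL2 Omega (submodule_val x).1 phi.
Proof.
split=> [ex phi tphi|ex y].
  by rewrite -(dirichlet_form_test x tphi) ex.
have [p [pP [pj pa]]] := H10_approx y.
have l1 := psd_cvg (dirichlet_form_psd oO bO) (y := x) pa.
have l2 := psd_cvg (psd_form_comp j (L2_form_psd oO)) (y := x) pj.
have l3 : (fun k => mu * dotW (j (p k)) (j x)) @ \oo --> mu * dotW (j y) (j x).
  by apply: cvgM => //; exact: cvg_cst.
rewrite (psd_sym (dirichlet_form_psd oO bO)) (psd_sym (L2_form_psd oO)).
apply: (cvg_unique _ l1) => //.
rewrite (_ : (fun _ => _) = (fun k => mu * dotW (j (p k)) (j x)))//.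
apply/funext => k; have [phi tphi pE] := pP k.
have -> : p k = H10_elt oO bO (test_H10 oO bO tphi).
  by apply: submodule_val_inj; rewrite pE.
rewrite (psd_sym (dirichlet_form_psd oO bO)) (psd_sym (L2_form_psd oO)).
by rewrite dirichlet_form_test ex.
Qed.

Lemma eigen_dirichlet mu (x : V) : eigen dotW j a mu x ->
  dirichlet_eigen Omega mu (submodule_val x).1.
Proof.
move=> /eigenP ex; split=> //.
by exists (submodule_val x).2; exact: H10_spaceP.
Qed.

Lemma dirichlet_eigen_elt mu u : dirichlet_eigen Omega mu u ->
  exists x : V, eigen dotW j a mu x /\ (submodule_val x).1 = u.
Proof.
move=> [[du Hu] eu]; exists (H10_elt oO bO (Hu : H10_pair Omega (u, du))).
by split=> //; apply/eigenP.
Qed.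

(** Needed because the abstract result yields an eigenfunction equal to the basis element only
    almost everywhere; the same gradient and the same approximating test functions serve for v. *)
Lemma dirichlet_eigen_ae mu u v : dirichlet_eigen Omega mu u -> in_L2 Omega v ->
  sqnormL2 Omega (v \- u) = 0 -> dirichlet_eigen Omega mu v.
Proof.
move=> [[du Hu] eu] Lv vu; have Lu := H10_L2 Hu.
have pW := L2_form_psd oO.
have same w : in_L2 Omega w -> dotL2 Omega v w = dotL2 Omega u w.
  move=> Lw; apply/eqP; rewrite -subr_eq0; apply/eqP.
  have := psd_eq0l pW (x := L2_elt oO Lv - L2_elt oO Lu) (L2_elt oO Lw) vu.
  by rewrite (psdBl pW).
have [[_ Ldu wu] [phi [tphi pu pdu]]] := Hu.
split.
  exists du; split.
    split=> // i psi tpsi; rewrite same; first exact: wu.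
    by apply: test_in_L2 => //; exact: test_function_pderiv.
  exists phi; split=> //.
  have Lphi k := test_in_L2 oO bO (tphi k).
  have uv : sqnormL2 Omega (u \- v) = 0.
    by rewrite -vu; exact: (psdBC pW (L2_elt oO Lu) (L2_elt oO Lv)).
  have lim0 : (fun k => sqnormL2 Omega (phi k \- u) *+ 2) @ \oo --> (0 *+ 2 : R) by exact: cvgMn.
  rewrite mul0rn in lim0.
  apply: (squeeze_cvgr _ (cvg_cst 0) lim0); apply: nearW => k; rewrite sqnormL2_ge0/=.
  apply: le_trans (sqnormL2_sub_trans oO (Lphi k) Lu Lv) _.
  by rewrite uv mul0rn addr0.
move=> psi tpsi.
have tdd i : test_function Omega (pderiv i (pderiv i psi)).
  by do 2 apply: test_function_pderiv.
have [Ll _] := dotL2_sumr (index_enum 'I_n) Lu (fun i => test_in_L2 oO bO (tdd i)).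
by rewrite !same ?eu//; exact: test_in_L2.
Qed.

Lemma submodule_val_comb (k : nat) (c : 'I_k -> R) (x : 'I_k -> V) z :
  (submodule_val (\sum_i c i *: x i)).1 z = \sum_i c i * (submodule_val (x i)).1 z.
Proof.
have -> : (submodule_val (\sum_i c i *: x i)).1 = \sum_i c i *: (submodule_val (x i)).1.
  elim/big_rec2: _ => // i u v _ <-.
  exact: (congr1 fst (submodule_linear (c i) (x i) v)).
by rewrite fct_sumE; apply: eq_bigr.
Qed.

End dirichlet_eigenfunctions.

(* Sequences are indexed from 0: lam m and b m stand for the (m+1)-st
   eigenvalue and basis element. *)
Theorem theorem5p3 (R : realType) (n : nat) (n_gt0 : (0 < n)%N)
  (Omega : set 'rV[R]_n) (Omega_smooth : bounded_smooth_domain Omega)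
  (lam : nat -> R) (lam_spectrum : dirichlet_spectrum Omega lam)
  (lam0_gt0 : 0 < lam 0%N) (lam0_lt1 : lam 0%N < lam 1%N)
  (b : nat -> 'rV[R]_n -> R) (b_basis : orthonormal_basisL2 Omega b)
  (b_optimal : forall m : nat, (1 <= m)%N ->
     forall (f : 'rV[R]_n -> R) (df : 'I_n -> 'rV[R]_n -> R),
       H10_gradient Omega f df ->
       sqnormL2 Omega (f \- partial_sumL2 Omega b f m) <=
         sqnorm_gradient Omega df / lam m) :
  forall i : nat, dirichlet_eigen Omega (lam i) (b i).
Proof.
have [oO _ _ bO _] := Omega_smooth; have [lam_homo lamP] := lam_spectrum.
have [Lb b_ortho _] := b_basis.
pose j := [the {linear submodule (H10_closed oO bO) -> submodule (in_L2_closed oO)}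
  of @H10_embed R n Omega oO bO].
have pdot := L2_form_psd oO; have pa := dirichlet_form_psd oO bO.
(* Zero norm of a combination means vanishing almost everywhere, which matches [free_L2] with the
   independence used in the abstract part. *)
have free0 k (c : 'I_k -> R) (x : 'I_k -> submodule (H10_closed oO bO)) :
    L2_form (j (\sum_i c i *: x i)) (j (\sum_i c i *: x i)) = 0 <->
    {ae @lebesgue_rV R n, forall z, Omega z ->
      \sum_(i < k) c i * (submodule_val (x i)).1 z = 0}.
  have Ly := H10_L2 (H10_spaceP (\sum_i c i *: x i)).
  have L0 : in_L2 Omega (cst 0) by exact: (L2_cst0 (@lebesgue_rV R n) Omega).
  have mO := Omega_measurable oO.
  split=> [s0|ae0].
    have := L2_dot_eq0 mO Ly s0; apply: filterS => z /= h /h.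
    by rewrite submodule_val_comb.
  have ae0' : {ae @lebesgue_rV R n, forall z, Omega z ->
      (submodule_val (\sum_i c i *: x i)).1 z = cst 0 z}.
    by apply: filterS ae0 => z /= h /h; rewrite submodule_val_comb.
  rewrite /L2_form /= [LHS](ae_eq_dot mO Ly L0 Ly ae0').
  by rewrite /dot; under eq_Rintegral do rewrite mul0r; rewrite Rintegral_cst// mul0r.
have spectrum (mu : R) (k : nat) :
    (exists t : 'I_k -> nat, injective t /\ forall i, lam (t i) = mu) <->
    (exists u : 'I_k -> submodule (H10_closed oO bO),
       (forall i, eigen (@L2_form R n Omega oO) j (@dirichlet_form R n Omega oO bO) mu (u i)) /\
       forall c : 'I_k -> R,
         L2_form (j (\sum_i c i *: u i)) (j (\sum_i c i *: u i)) = 0 -> forall i, c i = 0).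
  rewrite lamP; split=> [[u [eu fu]]|[x [ex fx]]].
    have /choice[x xP] i := dirichlet_eigen_elt oO bO (eu i).
    exists x; split=> [i|c /free0 ae0]; first by have [] := xP i.
    apply: fu; apply: filterS ae0 => z /= h Oz; rewrite -[RHS](h Oz).
    by apply: eq_bigr => i _; have [_ ->] := xP i.
  exists (fun i => (submodule_val (x i)).1); split=> [i|c ae0].
    exact: eigen_dirichlet (ex i).
  by apply: fx; apply/free0.
have [e oe] := orthonormal_eigen_sequence pdot pa spectrum.
have opt m (x : submodule (H10_closed oO bO)) : (1 <= m)%N ->
    L2_form (j x - \sum_(i < m) L2_form (j x) (L2_elt oO (Lb i)) *: L2_elt oO (Lb i))
            (j x - \sum_(i < m) L2_form (j x) (L2_elt oO (Lb i)) *: L2_elt oO (Lb i)) <=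
    dirichlet_form x x / lam m.
  move=> m1; have := b_optimal m m1 _ _ (H10_spaceP x).
  suff -> : (submodule_val x).1 \- partial_sumL2 Omega b (submodule_val x).1 m =
      submodule_val (j x - \sum_(i < m) L2_form (j x) (L2_elt oO (Lb i)) *: L2_elt oO (Lb i)) by [].
  have sumE (r : seq 'I_m) :
      submodule_val (\sum_(i <- r) L2_form (j x) (L2_elt oO (Lb i)) *: L2_elt oO (Lb i)) =
      (fun z => \sum_(i <- r) dotL2 Omega (submodule_val x).1 (b i) * b i z).
    elim: r => [|i r IH]; first by rewrite big_nil; apply/funext => z; rewrite big_nil.
    rewrite big_cons submodule_linear IH; apply/funext => z.
    by rewrite big_cons.
  rewrite addrC -scaleN1r submodule_linear sumE; apply/funext => z.
  by rewrite !fctE /partial_sumL2 addrC scaleN1r.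
move=> i.
(* The eigenvector x differs from b i by a function of zero norm, and the last step transfers the
   eigenvalue property to b i itself. *)
have [x ex bx] := basis_eigen pdot pa (@H10_complete _ _ _ oO bO) (@H10_rellich _ _ _ oO bO)
  (@H10_dense _ _ _ oO bO) lam_homo spectrum lam0_gt0 oe (b := fun i => L2_elt oO (Lb i)) b_ortho opt i.
exact: (dirichlet_eigen_ae oO bO (eigen_dirichlet ex) (Lb i) bx).
Qed.
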